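(* Let $0<p<1$ and $1<\alpha<2$, and let $\mu,\nu$ be real numbers with $\alpha-2<\mu,\nu<0$ satisfying $$\mu+\nu=\alpha-2,\qquad p\sin(\pi\mu)=(1-p)\sin(\pi\nu).$$ Then for every $n=0,1,2,\ldots$ and $t\in(0,1)$, $$\mathcal{I}_{p,0,1}^{\mu,\nu,2-\alpha}\big[\omega_{*}^{\mu,\nu}G_{n}(\mu,\nu,\cdot)\big](t)=\lambda_{n}G_{n}(\nu,\mu,t),\qquad \lambda_{n}=\frac{\Gamma(n+\alpha-1)}{\Gamma(n+1)}.$$
   Context: $P_n^{a,b}$ denotes the classical Jacobi polynomial of degree $n$ with parameters $a,b>-1$. For $t\in(0,1)$, $G_n(a,b,t):=P_n^{a,b}(2t-1)$ and $\omega_*^{\mu,\nu}(t):=t^{\nu}(1-t)^{\mu}$. For $\sigma>0$ and an interval $(a,b)$, ${}_{a}I_x^{\sigma}v(x)=\frac{1}{\Gamma(\sigma)}\int_a^x (x-y)^{\sigma-1}v(y)\,dy$ and ${}_{x}I_b^{\sigma}v(x)=\frac{1}{\Gamma(\sigma)}\int_x^b (y-x)^{\sigma-1}v(y)\,dy$. With $C_{\alpha,p}:=(\sin\pi\mu+\sin\pi\nu)/\sin\pi\alpha$, the two-sided fractional integral is $\mathcal{I}_{p,a,b}^{\mu,\nu,\varrho}v:=C_{\alpha,p}\big(p\,{}_{a}I_x^{\varrho}v+(1-p)\,{}_{x}I_b^{\varrho}v\big)$. *)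

(* Defs.v *)
From mathcomp Require Import all_boot all_order all_algebra.
From mathcomp Require Import all_classical all_reals all_analysis.
Set Implicit Arguments. Unset Strict Implicit. Unset Printing Implicit Defensive.
Import Order.TTheory GRing.Theory Num.Theory.
Local Open Scope classical_set_scope.
Local Open Scope ring_scope.

Section Defs.
Variable R : realType.

Definition Gamma (s : R) : R :=
  Rintegral (@lebesgue_measure R) [set x : R | 0 < x]
    (fun x => x `^ (s - 1) * expR (- x)).

Definition genbinom (r : R) (m : nat) : R :=
  (\prod_(i < m) (r - i%:R)) / (m`!)%:R.

Definition jacobiP (n : nat) (a b x : R) : R :=
  \sum_(k < n.+1) genbinom (n%:R + a) (n - k) * genbinom (n%:R + b) k
     * ((x - 1) / 2) ^+ k * ((x + 1) / 2) ^+ (n - k).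

Definition Gn (n : nat) (a b t : R) : R := jacobiP n a b (2 * t - 1).

Definition omega_star (mu nu t : R) : R := t `^ nu * (1 - t) `^ mu.

Definition RL_left (a sigma : R) (v : R -> R) (x : R) : R :=
  (Gamma sigma)^-1 * Rintegral (@lebesgue_measure R) [set y : R | a < y < x]
    (fun y => (x - y) `^ (sigma - 1) * v y).

Definition RL_right (b sigma : R) (v : R -> R) (x : R) : R :=
  (Gamma sigma)^-1 * Rintegral (@lebesgue_measure R) [set y : R | x < y < b]
    (fun y => (y - x) `^ (sigma - 1) * v y).

Definition C_const (alpha mu nu : R) : R :=
  (sin (pi * mu) + sin (pi * nu)) / sin (pi * alpha).

Definition frac_int2 (alpha p a b mu nu rho : R) (v : R -> R) (x : R) : R :=
  C_const alpha mu nu * (p * RL_left a rho v x + (1 - p) * RL_right b rho v x).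

End Defs.

(* Main.v *)
(** Put [a = - mu], [b = - nu] and [s = a + b = 2 - alpha], so that [0 < s < 1].
    The relation between [p], [mu] and [nu] makes the weights of the right and
    left integrals proportional to [sin (pi a)] and [sin (pi b)], so it suffices
    to compute the moments

      F_m(t) = sin (pi a) \int_t^1 (y - t)^(s-1) y^(m-b) (1 - y)^(-a) dy
             + sin (pi b) \int_0^t (t - y)^(s-1) y^(m-b) (1 - y)^(-a) dy.

    The derivative of [F_0] is a constant multiple of [t^(a-1) (1 - t)^(b-1)],
    and [F_0] tends to [pi] at both ends of [(0, 1)]; hence the multiple vanishes
    and [F_0 = pi]. Integration by parts gives a three-term recursion in [m], so
    [F_m / pi] is the polynomial with generating function
    [(1 - t z)^(s-1) (1 - z)^(-a)].

    The linear map [y^m |-> F_m / pi] intertwines the Jacobi operators of the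
    parameters [(mu, nu)] and [(nu, mu)]. Hence it sends [G_n(mu, nu)] to an
    eigenvector with the eigenvalue of [G_n(nu, mu)], and comparing leading
    coefficients yields the factor [(1 - s)_n / n!]. The constant is then
    [Gamma(n + 1 - s) / Gamma(n + 1)] by [Gamma(s) Gamma(1 - s) = pi / sin (pi s)].

    The reflection formula reduces to [\int_0^oo w^(x-1) / (1 + w) dw], that is to
    the identity of [pi cot (pi x) - 1/x + 1/(1-x)] with the integral of
    [(w^x - w^(1-x)) / (1 - w)] over [(0, 1)] (Herglotz' trick: both satisfy
    [2 f(x) = f(x/2) + f((x+1)/2)], and both are Lipschitz and odd about [1/2]). *)

Require Import Defs.
From mathcomp Require Import all_boot all_order all_algebra.
From mathcomp Require Import ring lra zify.
From mathcomp Require Import all_classical all_reals all_analysis.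
From mathcomp Require Import measurable_realfun lebesgue_integral_under.
Set Implicit Arguments. Unset Strict Implicit. Unset Printing Implicit Defensive.
Import Order.TTheory GRing.Theory Num.Theory.
Import numFieldNormedType.Exports.
Local Open Scope classical_set_scope.
Local Open Scope ring_scope.

(** * Integrals over an interval exhausted by compact ones *)

(** The sine weights are forced because neither half of F_m is a polynomial. The right half of F_0
    has a derivative proportional to t^(a-1) (1-t)^(b-1), so up to constants it is an incomplete
    beta function, and the right half of F_1 carries a multiple of t^a (1-t)^b; the vanishing of one
    and the same constant removes both. From m = 2 on the recursion holds for each half alone, so
    only two moments need the combination.

    The limit pi is sin(pi a) B(a, 1-a): reflection is therefore needed for the moments as well as
    for the final constant.

    All integrands may be singular at the ends of their intervals, and one end moves with t. The
    halves are rescaled to ]0, 1[, where t enters only through a base that stays positive, and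
    calculus is done on compact intervals exhausting the open one. Since [Rintegral] returns 0 for
    an infinite integral, identities for nonnegative integrands are proved in the extended reals
    first, and integrability is read off from the finite value. *)

Definition exhausts (R : realType) (D : set R) (c d : nat -> R) : Prop :=
  [/\ forall n, c n < d n, forall n, c n.+1 <= c n, forall n, d n <= d n.+1 &
      D = \bigcup_n `[c n, d n]%classic].

Lemma exhausts_nondecreasing (R : realType) (D : set R) (c d : nat -> R) :
  exhausts D c d -> nondecreasing_seq (fun n => `[c n, d n]%classic : set R).
Proof.
move=> [_ cc dd _]; apply/nondecreasing_seqP => n; rewrite subsetEset.
by apply: subset_itv; rewrite bnd_simp.
Qed.

Lemma exhausts_sub (R : realType) (D : set R) (c d : nat -> R) :
  exhausts D c d -> forall n, `[c n, d n] `<=` D.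
Proof. by move=> [_ _ _ ->] n x xn; exists n. Qed.
Arguments exhausts_sub {R D c d} _ n.

Lemma exhausts_measurable (R : realType) (D : set R) (c d : nat -> R) :
  exhausts D c d -> measurable D.
Proof. by move=> [_ _ _ ->]; apply: bigcup_measurable => n _; exact: measurable_itv. Qed.

Lemma continuous_within_sub (R : realType) (D A : set R) (f : R -> R) :
  A `<=` D -> (forall x, D x -> {for x, continuous f}) ->
  {within A, continuous f}.
Proof.
move=> AD cf; apply: (continuous_subspaceW AD).
by apply: continuous_in_subspaceT => x /set_mem Dx; exact: cf.
Qed.

Lemma exhausts_measurable_fun (R : realType) (D : set R) (c d : nat -> R)
    (f : R -> R) : exhausts D c d ->
  (forall x, D x -> {for x, continuous f}) -> measurable_fun D f.
Proof.
move=> ex cf; have [_ _ _ DE] := ex.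
rewrite DE; apply/measurable_fun_bigcup => [n|n]; first exact: measurable_itv.
have h := continuous_within_sub (exhausts_sub ex n) cf.
by apply: (subspace_continuous_measurable_fun _ h); exact: measurable_itv.
Qed.

Lemma exhausts_cvg_integral (R : realType) (D : set R) (c d : nat -> R)
    (f : R -> R) : exhausts D c d -> measurable_fun D f ->
  (forall x, D x -> 0 <= f x) ->
  (\int[lebesgue_measure]_(x in `[c n, d n]) (f x)%:E)%E @[n --> \oo] -->
  (\int[lebesgue_measure]_(x in D) (f x)%:E)%E.
Proof.
move=> ex mf f0; have [_ _ _ DE] := ex; rewrite DE.
apply: ge0_nondecreasing_set_cvg_integral.
- exact: exhausts_nondecreasing ex.
- by move=> n; exact: measurable_itv.
- move=> n; apply/measurable_EFinP.
  by apply: measurable_funS mf; [exact: exhausts_measurable ex|exact: exhausts_sub].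
- by move=> n x xn; rewrite lee_fin; apply: f0; exact: (exhausts_sub ex n).
Qed.

(** Splitting [f] as [f + |f|] minus [|f|], two nonnegative integrable functions, reduces the claim
    to monotone convergence. *)
Lemma exhausts_cvg_Rintegral (R : realType) (D : set R) (c d : nat -> R)
    (f : R -> R) : exhausts D c d ->
  lebesgue_measure.-integrable D (EFin \o f) ->
  (\int[lebesgue_measure]_(x in `[c n, d n]) f x) @[n --> \oo] -->
  \int[lebesgue_measure]_(x in D) f x.
Proof.
move=> ex; have mD := exhausts_measurable ex.
have ge0case (g : R -> R) : lebesgue_measure.-integrable D (EFin \o g) ->
    (forall x, 0 <= g x) ->
    (\int[lebesgue_measure]_(x in `[c n, d n]) g x) @[n --> \oo] -->
    \int[lebesgue_measure]_(x in D) g x.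
  move=> intg g0; apply: fine_cvg; rewrite fineK; last exact: integrable_fin_num.
  apply: exhausts_cvg_integral => //.
  by apply/measurable_EFinP; have /integrableP[] := intg.
move=> intf; have intn := integrable_norm intf.
have intg : lebesgue_measure.-integrable D (fun x => (f x + `|f x|)%:E).
  under eq_fun do rewrite EFinD; exact: integrableD.
have intE (A : set R) : measurable A -> A `<=` D ->
    \int[lebesgue_measure]_(x in A) f x =
    \int[lebesgue_measure]_(x in A) (f x + `|f x|) -
    \int[lebesgue_measure]_(x in A) `|f x|.
  move=> mA AD; rewrite -RintegralB//.
  - by apply: eq_Rintegral => x _; rewrite addrK.
  - by apply: integrableS intg.
  - by apply: integrableS intn.
rewrite intE//.
under eq_cvg => n do rewrite (intE _ (measurable_itv _) (exhausts_sub ex n)).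
apply: cvgB; apply: ge0case => // x.
by rewrite addrC -lerBlDr sub0r -normrN ler_norm.
Qed.

Lemma improper_FTC_itv (R : realType) (D : set R) (c d : nat -> R)
    (f F : R -> R) n : exhausts D c d ->
  (forall x, D x -> {for x, continuous f}) ->
  (forall x, D x -> is_derive x 1 F (f x)) ->
  (\int[lebesgue_measure]_(x in `[c n, d n]) (f x)%:E = (F (d n) - F (c n))%:E)%E.
Proof.
move=> ex cf dF; have [cd _ _ _] := ex; have sub := exhausts_sub ex n.
have dFc x : D x -> {for x, continuous F}.
  move=> Dx; have := dF x Dx => -[dx _].
  exact/differentiable_continuous/derivable1_diffP.
rewrite EFinB; apply: continuous_FTC2 => //.
- exact: continuous_within_sub cf.
- have /continuous_within_itvP : {within `[c n, d n], continuous F}.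
    exact: continuous_within_sub dFc.
  move=> /(_ (cd n))[_ Fc Fd]; split => // x xcd.
  have Dx : D x by apply: sub => /=; exact: subset_itv_oo_cc.
  by have [] := dF x Dx.
- move=> x xcd; have Dx : D x by apply: sub => /=; exact: subset_itv_oo_cc.
  by rewrite derive1E; have [] := dF x Dx.
Qed.

(** Monotone convergence over the exhausting intervals. In the extended reals finiteness is part of
    the conclusion, whereas the signed [improper_FTC] has to assume integrability. *)
Lemma ge0_improper_FTC (R : realType) (D : set R) (c d : nat -> R)
    (f F : R -> R) (l : R) : exhausts D c d ->
  (forall x, D x -> {for x, continuous f}) -> (forall x, D x -> 0 <= f x) ->
  (forall x, D x -> is_derive x 1 F (f x)) ->
  (F (d n) - F (c n)) @[n --> \oo] --> l ->
  (\int[lebesgue_measure]_(x in D) (f x)%:E = l%:E)%E.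
Proof.
move=> ex cf f0 dF Fl.
have := exhausts_cvg_integral ex (exhausts_measurable_fun ex cf) f0.
under eq_cvg do rewrite (improper_FTC_itv _ ex cf dF).
by move=> H; apply: (cvg_unique _ H) => //; apply: cvg_EFin => //; exact: nearW.
Qed.

Lemma improper_FTC (R : realType) (D : set R) (c d : nat -> R)
    (f F : R -> R) (l : R) : exhausts D c d ->
  (forall x, D x -> {for x, continuous f}) ->
  lebesgue_measure.-integrable D (EFin \o f) ->
  (forall x, D x -> is_derive x 1 F (f x)) ->
  (F (d n) - F (c n)) @[n --> \oo] --> l ->
  \int[lebesgue_measure]_(x in D) f x = l.
Proof.
move=> ex cf intf dF Fl.
have := exhausts_cvg_Rintegral ex intf.
under eq_cvg do rewrite /Rintegral (improper_FTC_itv _ ex cf dF).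
by move=> H; exact: (cvg_unique _ H Fl).
Qed.

(** * Change of variables, on compact intervals and then by exhaustion *)

Section substitution_itv.
Context {R : realType}.
Variables (phi phi' f : R -> R) (c d : R).
Hypotheses (cd : c < d) (dphi : {in `[c, d], forall x : R, is_derive x 1 phi (phi' x)})
  (cphi' : {in `[c, d], forall x : R, {for x, continuous phi'}}).

Let phiE x : x \in `[c, d] -> derive1 phi x = phi' x.
Proof. by move=> /dphi[_ <-]; rewrite derive1E. Qed.

Let cphi : {within `[c, d], continuous phi}.
Proof.
apply: continuous_in_subspaceT => x /set_mem/= /dphi[dx _].
exact/differentiable_continuous/derivable1_diffP.
Qed.

Let dphi_oo : derivable_oo_LRcontinuous phi c d.
Proof.
move/continuous_within_itvP : cphi => /(_ cd)[_ Fc Fd]; split => // x xcd.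
by have /dphi[] : x \in `[c, d] by exact: subset_itv_oo_cc.
Qed.

Let cphi1 : {in `]c, d[, continuous (derive1 phi)}.
Proof.
move=> x xcd; have xcd' : x \in `[c, d] by exact: subset_itv_oo_cc.
rewrite /continuous_at (phiE xcd'); apply: cvg_trans (cphi' xcd').
apply: near_eq_cvg; near=> y; rewrite phiE//; apply: subset_itv_oo_cc.
by near: y; exact: near_in_itvoo.
Unshelve. all: end_near. Qed.

Let cvgc : cvg (derive1 phi x @[x --> c^'+]).
Proof.
have ccd : c \in `[c, d] by rewrite in_itv/= lexx ltW.
apply/cvg_ex; exists (phi' c).
apply: cvg_trans (cvg_at_right_filter (cphi' ccd)).
apply: near_eq_cvg; near=> y; rewrite phiE// in_itv/=; apply/andP; split.
  by near: y; exact: nbhs_right_ge.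
by near: y; exact: nbhs_right_le.
Unshelve. all: end_near. Qed.

Let cvgd : cvg (derive1 phi x @[x --> d^'-]).
Proof.
have dcd : d \in `[c, d] by rewrite in_itv/= lexx ltW.
apply/cvg_ex; exists (phi' d).
apply: cvg_trans (cvg_at_left_filter (cphi' dcd)).
apply: near_eq_cvg; near=> y; rewrite phiE// in_itv/=; apply/andP; split.
  by near: y; exact: nbhs_left_ge.
by near: y; exact: nbhs_left_le.
Unshelve. all: end_near. Qed.

Lemma substitution_homo : {in `[c, d], forall x, 0 < phi' x} ->
  {in `[c, d] &, {homo phi : x y / x < y}}.
Proof.
move=> phi'0; have sub x : x \in `]c, d[ -> x \in `[c, d].
  exact: subset_itv_oo_cc.
apply: (@gtr0_derive1_lt_cc _ _ c d) => [x /sub xcd|x /sub xcd|].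
- by case: (dphi xcd).
- by rewrite phiE; [exact: phi'0|].
- exact: cphi.
Qed.

Lemma substitution_nhomo : {in `[c, d], forall x, phi' x < 0} ->
  {in `[c, d] &, {homo phi : x y /~ x < y}}.
Proof.
move=> phi'0; have sub x : x \in `]c, d[ -> x \in `[c, d].
  exact: subset_itv_oo_cc.
apply: (@ltr0_derive1_lt_cc _ _ c d) => [x /sub xcd|x /sub xcd|].
- by case: (dphi xcd).
- by rewrite phiE; [exact: phi'0|].
- exact: cphi.
Qed.

Lemma substitution_itv_incr : {in `[c, d], forall x, 0 < phi' x} ->
  {within `[phi c, phi d], continuous f} ->
  (\int[lebesgue_measure]_(x in `[phi c, phi d]) (f x)%:E =
   \int[lebesgue_measure]_(x in `[c, d]) (f (phi x) * phi' x)%:E)%E.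
Proof.
move=> phi'0 cf; rewrite (integration_by_substitution_increasing (ltW cd) (substitution_homo phi'0)
  cphi1 cvgc cvgd dphi_oo cf).
by apply: eq_integral => x /set_mem/= xcd; rewrite fctE/= (phiE xcd).
Qed.

Lemma substitution_itv_decr : {in `[c, d], forall x, phi' x < 0} ->
  {within `[phi d, phi c], continuous f} ->
  (\int[lebesgue_measure]_(x in `[phi d, phi c]) (f x)%:E =
   \int[lebesgue_measure]_(x in `[c, d]) (f (phi x) * - phi' x)%:E)%E.
Proof.
move=> phi'0 cf; rewrite (integration_by_substitution_decreasing (ltW cd) (substitution_nhomo phi'0)
  cphi1 cvgc cvgd dphi_oo cf).
by apply: eq_integral => x /set_mem/= xcd; rewrite fctE/= fctE (phiE xcd).
Qed.

Lemma substitution_image_incr y : {in `[c, d], forall x, 0 < phi' x} ->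
  y \in `[phi c, phi d] -> exists2 x, x \in `[c, d] & phi x = y.
Proof.
move=> phi'0; rewrite in_itv/= => ycd; apply: IVT => //; first exact: ltW.
have le : phi c <= phi d.
  by apply/ltW/substitution_homo => //; rewrite in_itv/= lexx ltW.
by rewrite (min_idPl le) (max_idPr le).
Qed.

Lemma substitution_image_decr y : {in `[c, d], forall x, phi' x < 0} ->
  y \in `[phi d, phi c] -> exists2 x, x \in `[c, d] & phi x = y.
Proof.
move=> phi'0; rewrite in_itv/= => ycd; apply: IVT => //; first exact: ltW.
have le : phi d <= phi c.
  by apply/ltW/substitution_nhomo => //; rewrite in_itv/= lexx ltW.
by rewrite (min_idPr le) (max_idPl le).
Qed.

End substitution_itv.

Lemma ge0_substitution_incr (R : realType) (D D' : set R) (c d : nat -> R)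
    (phi phi' f : R -> R) : exhausts D c d -> D' = phi @` D ->
  (forall x, D x -> is_derive x 1 phi (phi' x)) ->
  (forall x, D x -> {for x, continuous phi'}) ->
  (forall x, D x -> 0 < phi' x) ->
  (forall x, D' x -> {for x, continuous f}) -> (forall x, D' x -> 0 <= f x) ->
  (\int[lebesgue_measure]_(x in D') (f x)%:E =
   \int[lebesgue_measure]_(x in D) (f (phi x) * phi' x)%:E)%E.
Proof.
move=> ex D'E dphi cphi' phi'0 cf f0; have [cd cc dd DE] := ex.
have DD' x : D x -> D' (phi x) by move=> Dx; rewrite D'E; exists x.
have sub n x : x \in `[c n, d n] -> D x.
  by move=> xn; exact: (exhausts_sub ex n).
have dphin n : {in `[c n, d n], forall x : R, is_derive x 1 phi (phi' x)}.
  by move=> x /sub; exact: dphi.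
have phi'n n : {in `[c n, d n], forall x, 0 < phi' x} by move=> x /sub; exact: phi'0.
have homo n := substitution_homo (dphin n) (phi'n n).
have whomo n := ltW_homo_in (homo n).
(* The images of the exhausting intervals exhaust [D']: monotonicity orders their ends and the
   intermediate value theorem supplies preimages. *)
have ex' : exhausts D' (phi \o c) (phi \o d).
  split => [n|n|n|] /=.
  - by apply: (homo n) => //; rewrite in_itv/= lexx ltW.
  - apply: (whomo n.+1) => //; rewrite in_itv/= ?lexx ?cc ltW//.
    exact: lt_le_trans (cd n) _.
  - apply: (whomo n.+1) => //; rewrite in_itv/= ?lexx ?dd ?andbT ltW//.
    exact: le_lt_trans (cc n) _.
  - rewrite D'E; apply/seteqP; split => [_ [x Dx <-]|y [n _ /= yn]].
      move: Dx; rewrite DE => -[n _ /= xn]; exists n => //=.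
      move: (xn); rewrite !in_itv/= => /andP[cx xd].
      by apply/andP; split; apply: (whomo n) => //; rewrite in_itv/= lexx ltW.
    have [x xn <-] := substitution_image_incr (cd n) (dphin n) (phi'n n) yn.
    by exists x => //; exact: sub xn.
have cphi x : D x -> {for x, continuous phi}.
  move=> Dx; have [dx _] := dphi x Dx.
  exact/differentiable_continuous/derivable1_diffP.
have cg x : D x -> {for x, continuous (fun x => f (phi x) * phi' x)}.
  move=> Dx; apply: continuousM; last exact: cphi'.
  by apply: continuous_comp; [exact: cphi|exact/cf/DD'].
have H1 := exhausts_cvg_integral ex' (exhausts_measurable_fun ex' cf) f0.
have g0 x : D x -> 0 <= f (phi x) * phi' x.
  by move=> Dx; rewrite mulr_ge0 ?f0 ?ltW ?phi'0//; exact: DD'.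
have H2 := exhausts_cvg_integral ex (exhausts_measurable_fun ex cg) g0.
have cphi'n n : {in `[c n, d n], forall x, {for x, continuous phi'}}.
  by move=> x /sub; exact: cphi'.
suff E : (fun n => \int[lebesgue_measure]_(x in `[(phi \o c) n, (phi \o d) n])
      (f x)%:E)%E = (fun n => \int[lebesgue_measure]_(x in `[c n, d n])
      (f (phi x) * phi' x)%:E)%E.
  by move: H1; rewrite E => H1; exact: (cvg_unique _ H1 H2).
apply/funext => n; apply: (substitution_itv_incr (cd n) (dphin n) (cphi'n n) (phi'n n)).
exact: (continuous_within_sub (exhausts_sub ex' n) cf).
Qed.

Lemma ge0_substitution_decr (R : realType) (D D' : set R) (c d : nat -> R)
    (phi phi' f : R -> R) : exhausts D c d -> D' = phi @` D ->
  (forall x, D x -> is_derive x 1 phi (phi' x)) ->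
  (forall x, D x -> {for x, continuous phi'}) ->
  (forall x, D x -> phi' x < 0) ->
  (forall x, D' x -> {for x, continuous f}) -> (forall x, D' x -> 0 <= f x) ->
  (\int[lebesgue_measure]_(x in D') (f x)%:E =
   \int[lebesgue_measure]_(x in D) (f (phi x) * - phi' x)%:E)%E.
Proof.
move=> ex D'E dphi cphi' phi'0 cf f0; have [cd cc dd DE] := ex.
have DD' x : D x -> D' (phi x) by move=> Dx; rewrite D'E; exists x.
have sub n x : x \in `[c n, d n] -> D x.
  by move=> xn; exact: (exhausts_sub ex n).
have dphin n : {in `[c n, d n], forall x : R, is_derive x 1 phi (phi' x)}.
  by move=> x /sub; exact: dphi.
have phi'n n : {in `[c n, d n], forall x, phi' x < 0} by move=> x /sub; exact: phi'0.
have homo n := substitution_nhomo (dphin n) (phi'n n).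
have whomo n : {in `[c n, d n] &, {homo phi : x y /~ x <= y}}.
  move=> x y xn yn; rewrite le_eqVlt => /predU1P[->//|yx].
  by apply/ltW/(homo n).
have ex' : exhausts D' (phi \o d) (phi \o c).
  split => [n|n|n|] /=.
  - by apply: (homo n) => //; rewrite in_itv/= lexx ltW.
  - apply: (whomo n.+1) => //; rewrite in_itv/= ?lexx ?dd ?andbT ltW//.
    exact: le_lt_trans (cc n) _.
  - apply: (whomo n.+1) => //; rewrite in_itv/= ?lexx ?cc ltW//.
    exact: lt_le_trans (cd n) _.
  - rewrite D'E; apply/seteqP; split => [_ [x Dx <-]|y [n _ /= yn]].
      move: Dx; rewrite DE => -[n _ /= xn]; exists n => //=.
      move: (xn); rewrite !in_itv/= => /andP[cx xd].
      by apply/andP; split; apply: (whomo n) => //; rewrite in_itv/= lexx ltW.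
    have [x xn <-] := substitution_image_decr (cd n) (dphin n) (phi'n n) yn.
    by exists x => //; exact: sub xn.
have cphi x : D x -> {for x, continuous phi}.
  move=> Dx; have [dx _] := dphi x Dx.
  exact/differentiable_continuous/derivable1_diffP.
have cg x : D x -> {for x, continuous (fun x => f (phi x) * - phi' x)}.
  move=> Dx; apply: continuousM; last by apply: continuousN; exact: cphi'.
  by apply: continuous_comp; [exact: cphi|exact/cf/DD'].
have H1 := exhausts_cvg_integral ex' (exhausts_measurable_fun ex' cf) f0.
have g0 x : D x -> 0 <= f (phi x) * - phi' x.
  by move=> Dx; rewrite mulr_ge0 ?f0 ?oppr_ge0 ?ltW ?phi'0//; exact: DD'.
have H2 := exhausts_cvg_integral ex (exhausts_measurable_fun ex cg) g0.
have cphi'n n : {in `[c n, d n], forall x, {for x, continuous phi'}}.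
  by move=> x /sub; exact: cphi'.
suff E : (fun n => \int[lebesgue_measure]_(x in `[(phi \o d) n, (phi \o c) n])
      (f x)%:E)%E = (fun n => \int[lebesgue_measure]_(x in `[c n, d n])
      (f (phi x) * - phi' x)%:E)%E.
  by move: H1; rewrite E => H1; exact: (cvg_unique _ H1 H2).
apply/funext => n; apply: (substitution_itv_decr (cd n) (dphin n) (cphi'n n) (phi'n n)).
exact: (continuous_within_sub (exhausts_sub ex' n) cf).
Qed.

(** The offset 3 makes even the first interval nondegenerate, since 2 / (n + 3) < 1. *)
Lemma exhausts_oo (R : realType) (a b : R) : a < b ->
  exhausts `]a, b[ (fun n => a + (b - a) / n.+3%:R) (fun n => b - (b - a) / n.+3%:R).
Proof.
move=> ab; have ba : 0 < b - a by rewrite subr_gt0.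
have h n : (b - a) / n.+4%:R <= (b - a) / n.+3%:R.
  by rewrite ler_pM2l// lef_pV2 ?posrE// ler_nat.
split => [n|n|n|].
- have : (b - a) / n.+3%:R < (b - a) / 2.
    by rewrite ltr_pM2l// ltf_pV2 ?posrE// ltr_nat.
  by move: (_ / n.+3%:R) => e; lra.
- by rewrite lerD2l.
- by rewrite lerD2l lerN2.
- apply/seteqP; split => [x /=|x [n _] /=]; rewrite !in_itv/= => /andP[ax xb].
    pose e := Num.min (x - a) (b - x).
    have e0 : 0 < e by rewrite lt_min !subr_gt0 ax.
    pose n := Num.truncn ((b - a) / e).
    exists n => //=; rewrite in_itv/=.
    have : (b - a) / n.+3%:R <= e.
      rewrite ler_pdivrMr// mulrC -ler_pdivrMr//; apply/ltW.
      by apply: lt_trans (truncnS_gt _) _; rewrite ltr_nat.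
    rewrite le_min => /andP[]; move: (_ / n.+3%:R) => r h1 h2; apply/andP; split; lra.
  have : 0 < (b - a) / n.+3%:R by rewrite divr_gt0.
  move: (_ / n.+3%:R) ax xb => r ax xb r0; apply/andP; split; lra.
Qed.

Lemma exhausts_oy (R : realType) : exhausts (`]0, +oo[%classic : set R)
  (fun n => n.+2%:R^-1) (fun n => n.+2%:R).
Proof.
split => [n|n|n|].
- by rewrite (@lt_trans _ _ 1)// ?ltr1n// invf_lt1// ltr1n.
- by rewrite lef_pV2 ?posrE// ler_nat.
- by rewrite ler_nat.
- apply/seteqP; split => [x /=|x [n _] /=]; rewrite !in_itv/= ?andbT; last first.
    by move=> /andP[+ _]; apply: lt_le_trans; rewrite invr_gt0.
  move=> x0; pose n := Num.truncn (Num.max x x^-1).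
  have : Num.max x x^-1 <= n.+2%:R.
    by apply/ltW; apply: lt_trans (truncnS_gt _) _; rewrite ltr_nat.
  rewrite ge_max => /andP[xn xVn]; exists n => //=; rewrite in_itv/= xn andbT.
  by rewrite -[leRHS]invrK lef_pV2 ?posrE ?invr_gt0.
Qed.

(** * The reflection formula *)

Lemma is_derive_continuous (R : realType) (f : R -> R) (x df : R) :
  is_derive x 1 f df -> {for x, continuous f}.
Proof. by move=> [dx _]; exact/differentiable_continuous/derivable1_diffP. Qed.

Lemma derive_bounded_lipschitz (R : realType) (f f' : R -> R) (M a b : R) :
  {in `]a, b[, forall x : R, is_derive x 1 f (f' x)} ->
  {in `]a, b[, forall x : R, `|f' x| <= M} ->
  {in `]a, b[ &, forall x y : R, `|f x - f y| <= M * `|x - y|}.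
Proof.
move=> df f'M.
have main x y : x \in `]a, b[ -> y \in `]a, b[ -> x < y ->
    `|f x - f y| <= M * `|x - y|.
  rewrite !in_itv/= => /andP[ax _] /andP[_ yb] xy.
  have sub z : z \in `[x, y] -> z \in `]a, b[.
    rewrite !in_itv/= => /andP[xz zy].
    by rewrite (lt_le_trans ax xz) (le_lt_trans zy yb).
  have [z zxy E] : exists2 z, z \in `]x, y[%R & f y - f x = f' z * (y - x).
    apply: MVT => // [z zxy|]; first by apply/df/sub; exact: subset_itv_oo_cc.
    apply: continuous_in_subspaceT => z /set_mem/= /sub /df.
    exact: is_derive_continuous.
  rewrite distrC E (distrC x) normrM ler_wpM2r// f'M// sub//.
  exact: subset_itv_oo_cc.
move=> x y xab yab; have [xy|yx|->] := ltgtP x y; first exact: main.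
- by rewrite distrC (distrC x); exact: main.
- by rewrite !subrr normr0 mulr0.
Qed.

(** * The function pi cot(pi x) without its poles at 0 and 1 *)

Lemma mul_cos_le_sin (R : realType) (y : R) :
  0 <= y <= pi / 2 -> y * cos y <= sin y.
Proof.
move=> /andP[y0 ypi]; rewrite -subr_ge0.
pose f (z : R) := sin z - z * cos z.
have df (z : R) : is_derive z 1 f (z * sin z).
  apply: is_derive_eq; rewrite /GRing.scale/=; ring.
have fc : {within `[0, pi / 2], continuous f}.
  apply: continuous_in_subspaceT => z _; exact: is_derive_continuous (df z).
have : f 0 <= f y.
  apply: (@ger0_derive1_le_cc _ f 0 (pi / 2)) => //.
  - move=> z zp; rewrite derive1E; have [_ ->] := df z.
    move: zp; rewrite in_itv/= => /andP[z0 zp]; rewrite mulr_ge0 ?(ltW z0)//.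
    by rewrite sin_ge0_pi// (ltW z0)/= (le_trans (ltW zp))// ler_pdivrMr// ler_peMr ?pi_ge0// ler1n.
  - by rewrite in_itv/= lexx divr_ge0// pi_ge0.
  - by rewrite in_itv/= y0.
by rewrite /f sin0 mul0r subrr.
Qed.

(** Squaring y cos y <= sin y gives cot^2 y <= y^-2, and sin^-2 = 1 + cot^2. This keeps the
    derivative of [cot_reg] bounded, although pi^2 / sin^2(pi x) and x^-2 are each unbounded near
    0. *)
Lemma invr_sin2_bounds (R : realType) (y : R) : 0 < y <= pi / 2 ->
  y ^- 2 <= sin y ^- 2 <= y ^- 2 + 1.
Proof.
move=> /andP[y0 yp].
have pi0 := pi_gt0 R.
have siny0 : 0 < sin y by apply: sin_gt0_pi; rewrite y0/=; lra.
have cosy0 : 0 <= cos y by apply: cos_ge0_pihalf; rewrite yp andbT; lra.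
have ycs : y * cos y <= sin y by apply: mul_cos_le_sin; rewrite ltW.
have siny : sin y <= y.
  (* The interval starts at -1 so that 0 lies in its interior. *)
  have := @derive_bounded_lipschitz R sin cos 1 (-1) (pi) .
  move=> /(_ _ _ 0 y).
  rewrite sub0r sin0 sub0r !normrN mul1r (gtr0_norm siny0) (gtr0_norm y0); apply.
  - by move=> x _; exact: is_derive_sin.
  - by move=> x _; exact: cos_max.
  - by rewrite in_itv/= pi0 andbT; lra.
  - by rewrite in_itv/=; apply/andP; split; lra.
apply/andP; split; first by rewrite lef_pV2 ?posrE ?exprn_gt0// lerXn2r ?nnegrE ?(ltW siny0) ?(ltW y0).
rewrite -[X in _ + X](@divff _ (y ^+ 2)) ?lt0r_neq0 ?exprn_gt0//.
rewrite -[X in X + _]mul1r -mulrDl ler_pdivlMr ?exprn_gt0// mulrC ler_pdivrMr ?exprn_gt0//.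
have : (y * cos y) ^+ 2 <= sin y ^+ 2 by rewrite lerXn2r ?nnegrE ?mulr_ge0 ?(ltW siny0) ?(ltW y0).
rewrite exprMn cos2sin2; lra.
Qed.

(** The rational terms cancel the poles at 0 and 1; the result is Lipschitz on ]0, 1[, as the
    halving argument of [cot_int_eq] requires. *)
Definition cot_reg (R : realType) (x : R) : R :=
  pi * (cos (pi * x) / sin (pi * x)) - x^-1 + (1 - x)^-1.

Lemma sin_pi_gt0 (R : realType) (x : R) : 0 < x < 1 -> 0 < sin (pi * x).
Proof.
move=> /andP[x0 x1]; apply: sin_gt0_pi; have pi0 := pi_gt0 R.
by rewrite mulr_gt0//= -[ltRHS]mulr1 ltr_pM2l.
Qed.

Lemma sin_pi_onem (R : realType) (x : R) : sin (pi * (1 - x)) = sin (pi * x).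
Proof. by rewrite mulrBr mulr1 sinB sinpi cospi mul0r; ring. Qed.

Lemma cos_pi_onem (R : realType) (x : R) : cos (pi * (1 - x)) = - cos (pi * x).
Proof. by rewrite mulrBr mulr1 cosB sinpi cospi mul0r; ring. Qed.

Lemma cot_reg_onem (R : realType) (x : R) : cot_reg (1 - x) = - cot_reg x.
Proof.
rewrite /cot_reg sin_pi_onem cos_pi_onem.
have -> : 1 - (1 - x) = x by ring.
by rewrite mulNr; ring.
Qed.

Lemma is_derive_cot_reg (R : realType) (x : R) : 0 < x < 1 ->
  is_derive x 1 (@cot_reg R)
    (- (pi / sin (pi * x)) ^+ 2 + x ^- 2 + (1 - x) ^- 2).
Proof.
move=> x01; have s0 := sin_pi_gt0 x01; move: x01 => /andP[x0 x1].
have s0' : sin (pi * x) != 0 by rewrite lt0r_neq0.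
have x0' : x != 0 by rewrite lt0r_neq0.
have x1' : 1 - x != 0 by rewrite lt0r_neq0// subr_gt0.
have dm : is_derive x 1 (fun x : R => pi * x) pi.
  by apply: is_derive_eq; rewrite /GRing.scale/=; ring.
have ds : is_derive x 1 (fun x : R => sin (pi * x)) (pi * cos (pi * x)).
  by apply: is_derive_eq; rewrite /GRing.scale/=; ring.
have dc : is_derive x 1 (fun x : R => cos (pi * x)) (pi * - sin (pi * x)).
  by apply: is_derive_eq; rewrite /GRing.scale/=; ring.
have d1 : is_derive x 1 (fun x : R => (sin (pi * x))^-1) (- sin (pi * x) ^- 2 * (pi * cos (pi * x))).
  by apply: is_derive_eq; rewrite /GRing.scale/=; ring.
have d2 : is_derive x 1 (fun x : R => x^-1) (- x ^- 2).
  have := is_deriveV x0' (is_derive_id x 1).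
  by rewrite /GRing.scale/= mulr1.
have d3 : is_derive x 1 (fun x : R => (1 - x)^-1) ((1 - x) ^- 2).
  by apply: is_derive_eq; rewrite /GRing.scale/=; ring.
rewrite /cot_reg; apply: is_derive_eq; rewrite /GRing.scale/=.
have E := cos2Dsin2 (pi * x); move: s0' E => S0 E.
transitivity (- pi ^+ 2 * sin (pi * x) ^- 2 * (cos (pi * x) ^+ 2 + sin (pi * x) ^+ 2)
  + x ^- 2 + (1 - x) ^- 2); first by field; rewrite ?S0 ?x0' ?x1'.
by rewrite E; field; rewrite ?S0 ?x0' ?x1'.
Qed.

(** For x <= 1/2, pi^2 bounds the gap between pi^2 / sin^2(pi x) and x^-2, and 4 bounds (1 - x)^-2.
    The other half follows from x -> 1 - x. *)
Lemma cot_reg_lipschitz (R : realType) :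
  {in `]0, 1[ &, forall x y : R,
    `|cot_reg x - cot_reg y| <= (pi ^+ 2 + 4) * `|x - y|}.
Proof.
apply: (@derive_bounded_lipschitz _ _
  (fun x => - (pi / sin (pi * x)) ^+ 2 + x ^- 2 + (1 - x) ^- 2)).
  by move=> x; rewrite in_itv/=; exact: is_derive_cot_reg.
have pi0 := pi_gt0 R.
have half (x : R) : 0 < x <= 2^-1 ->
    `|- (pi / sin (pi * x)) ^+ 2 + x ^- 2 + (1 - x) ^- 2| <= pi ^+ 2 + 4.
  move=> /andP[x0 x2].
  have /invr_sin2_bounds/andP[h1 h2] : 0 < pi * x <= pi / 2.
    by rewrite mulr_gt0//= ler_pM2l.
  have E : x ^- 2 = pi ^+ 2 * (pi * x) ^- 2 .
    have [x0' pi0'] := (lt0r_neq0 x0, lt0r_neq0 pi0).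
    by move: (pi : R) pi0' => P P0; field; rewrite ?x0' ?P0.
  have b1 : 0 <= (1 - x) ^- 2 <= 4.
    rewrite invr_ge0 sqr_ge0/= invf_ple ?posrE ?exprn_gt0//; last by lra.
    have : 2^-1 <= 1 - x by lra.
    by move=> h; apply: le_trans (lerXn2r 2 _ _ h); rewrite ?nnegrE; lra.
  have p2 : 0 <= pi ^+ 2 :> R by rewrite sqr_ge0.
  rewrite E expr_div_n ler_norml; apply/andP; split.
    have : pi ^+ 2 * sin (pi * x) ^- 2 <= pi ^+ 2 * ((pi * x) ^- 2 + 1).
      by rewrite ler_wpM2l.
    by rewrite mulrDr; lra.
  have : pi ^+ 2 * (pi * x) ^- 2 <= pi ^+ 2 * sin (pi * x) ^- 2.
    by rewrite ler_wpM2l.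
  lra.
move=> x; rewrite in_itv/= => /andP[x0 x1].
have [x2|x2] := leP x 2^-1; first by apply: half; rewrite x0.
have := half (1 - x); rewrite sin_pi_onem.
have -> : 1 - (1 - x) = x by ring.
by rewrite -addrA [_ ^- 2 + _]addrC addrA; apply; apply/andP; split; lra.
Qed.

(** The trigonometric part is cot y + cot(y + pi/2) = 2 cot 2y. The cancelled poles leave an
    inhomogeneous term, the same one as in [cot_int_double], so the difference of the two functions
    satisfies the homogeneous formula. *)
Lemma cot_reg_double (R : realType) (x : R) : 0 < x < 1 ->
  cot_reg (x / 2) + cot_reg ((x + 1) / 2) =
  2 * cot_reg x + 2 / (2 - x) - 2 / (x + 1).
Proof.
move=> x01; have s0 := sin_pi_gt0 x01; move: x01 => /andP[x0 x1].
have E1 : pi * ((x + 1) / 2) = pi * (x / 2) + pi / 2 :> R by field.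
have E2 : pi * x = (pi * (x / 2)) *+ 2 by rewrite mulr2n; field.
move: s0; rewrite /cot_reg E1 E2 sinDpihalf cosDpihalf sin_mulr2n cos_mulr2n.
set S := sin _; set c := cos _ => s0.
have [c0 S0] : c != 0 /\ S != 0.
  by move: s0; rewrite -mulr_natr; split; apply: contraTneq s0 => ->;
    rewrite ?mul0r ?mulr0 ?mul0r ltxx.
have E := cos2Dsin2 (pi * (x / 2)); rewrite -/S -/c in E.
have -> : c / S = (c ^+ 2) / (c * S) by field; rewrite c0 S0.
have -> : - S / c = - (S ^+ 2) / (c * S) by field; rewrite c0 S0.
have -> : S ^+ 2 = 1 - c ^+ 2 by rewrite -E; ring.
have h1 : x != 0 by lra.
have h2 : 1 - x != 0 by lra.
have h3 : 2 - x != 0 by lra.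
have h4 : x + 1 != 0 by lra.
by field; rewrite c0 S0 h1 h2 h3 h4.
Qed.

(** From cot y - cot 2y = 1 / sin 2y; it turns values of the cotangent into the cosecant of the
    reflection formula. *)
Lemma cot_half_sub (R : realType) (x : R) : 0 < x < 1 ->
  pi * (cos (pi * (x / 2)) / sin (pi * (x / 2))) -
  pi * (cos (pi * x) / sin (pi * x)) = pi / sin (pi * x).
Proof.
move=> x01; have s0 := sin_pi_gt0 x01; move: x01 => /andP[x0 x1].
have E2 : pi * x = (pi * (x / 2)) *+ 2 by rewrite mulr2n; field.
move: s0; rewrite E2 sin_mulr2n cos_mulr2n.
set S := sin _; set c := cos _ => s0.
have [c0 S0] : c != 0 /\ S != 0.
  by move: s0; rewrite -mulr_natr; split; apply: contraTneq s0 => ->;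
    rewrite ?mul0r ?mulr0 ?mul0r ltxx.
have E := cos2Dsin2 (pi * (x / 2)); rewrite -/S -/c in E.
by field; rewrite c0 S0.
Qed.

(** * Real powers and elementary integrals over ]0, 1[ *)

Lemma powRDpos (R : realType) (x p q : R) : 0 < x -> x `^ (p + q) = x `^ p * x `^ q.
Proof. by move=> x0; rewrite powRD// lt0r_neq0 ?implybT. Qed.

Lemma powRDn (R : realType) (x p : R) (n : nat) : 0 < x ->
  x `^ (p + n%:R) = x `^ p * x ^+ n.
Proof. by move=> x0; rewrite powRDpos// powR_mulrn// ltW. Qed.

Lemma powRB1 (R : realType) (x p : R) : 0 < x -> x `^ (p - 1) = x `^ p / x.
Proof. by move=> x0; rewrite powRDpos// powR_inv1// ltW. Qed.

Lemma continuous_powR (R : realType) (x p : R) : 0 < x ->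
  {for x, continuous (fun y : R => y `^ p)}.
Proof. by move=> x0; exact: is_derive_continuous (is_derive1_powR p x0). Qed.

Lemma continuous_powR_comp (R : realType) (f : R -> R) (x p : R) : 0 < f x ->
  {for x, continuous f} -> {for x, continuous (fun y : R => f y `^ p)}.
Proof.
move=> fx cf; apply: (@continuous_comp _ _ _ f (fun y : R => y `^ p)) => //.
exact: continuous_powR.
Qed.

Lemma continuous_onem (R : realType) (x : R) :
  {for x, continuous (fun y : R => 1 - y)}.
Proof. by apply: continuousB; [exact: cst_continuous|exact: cvg_id]. Qed.

Lemma ge0_integrable (R : realType) (D : set R) (f : R -> R) (l : R) :
  measurable D -> measurable_fun D f -> (forall x, D x -> 0 <= f x) ->
  (\int[lebesgue_measure]_(x in D) (f x)%:E = l%:E)%E ->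
  lebesgue_measure.-integrable D (EFin \o f).
Proof.
move=> mD mf f0 E; apply/integrableP; split; first exact/measurable_EFinP.
under eq_integral => x /set_mem Dx do rewrite /= ger0_norm ?f0//.
by rewrite E ltry.
Qed.

Lemma cvg_inv3 (R : realType) : (n.+3%:R^-1 : R) @[n --> \oo] --> (0 : R).
Proof.
have := @cvg_harmonic R; rewrite -(cvg_shiftn 2) /harmonic /=.
by under eq_cvg do rewrite addn2.
Qed.

Lemma cvg_exhausts_oo_l (R : realType) (a b : R) :
  (a + (b - a) / n.+3%:R) @[n --> \oo] --> a.
Proof.
have -> : nbhs a = nbhs (a + (b - a) * 0) by rewrite mulr0 addr0.
by apply: cvgD; [exact: cvg_cst|apply: cvgM; [exact: cvg_cst|exact: cvg_inv3]].
Qed.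

Lemma cvg_exhausts_oo_r (R : realType) (a b : R) :
  (b - (b - a) / n.+3%:R) @[n --> \oo] --> b.
Proof.
have -> : nbhs b = nbhs (b - (b - a) * 0) by rewrite mulr0 subr0.
by apply: cvgB; [exact: cvg_cst|apply: cvgM; [exact: cvg_cst|exact: cvg_inv3]].
Qed.

Lemma cvg_exhausts_oo (R : realType) (F : R -> R) (a b la lb : R) : a < b ->
  F x @[x --> a^'+] --> la -> F x @[x --> b^'-] --> lb ->
  (F (b - (b - a) / n.+3%:R) - F (a + (b - a) / n.+3%:R)) @[n --> \oo] --> lb - la.
Proof.
move=> ab Fa Fb; have e0 n : 0 < (b - a) / n.+3%:R by rewrite divr_gt0// subr_gt0.
apply: cvgB.
- move/cvg_at_leftP : Fb; apply; split => [n|]; first by rewrite gtrBl.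
  exact: cvg_exhausts_oo_r.
- move/cvg_at_rightP : Fa; apply; split => [n|]; first by rewrite ltrDl.
  exact: cvg_exhausts_oo_l.
Qed.

Lemma integral_powR01 (R : realType) (p : R) : 0 < p ->
  (\int[lebesgue_measure]_(x in `]0%R, 1%R[) (x `^ (p - 1))%:E = (p^-1)%:E)%E.
Proof.
move=> p0; apply: (ge0_improper_FTC (exhausts_oo ltr01) (F := fun x : R => p^-1 * x `^ p)).
- by move=> x /=; rewrite in_itv/= => /andP[x0 _]; exact: continuous_powR.
- by move=> x _; exact: powR_ge0.
- move=> x /=; rewrite in_itv/= => /andP[x0 _].
  have dx := is_derive1_powR p x0; apply: is_derive_eq.
  by rewrite /GRing.scale/= mulrA mulVf ?mul1r// lt0r_neq0.
- suff : (fun n => p^-1 * (1 - (1 - 0) / n.+3%:R) `^ p -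
      p^-1 * (0 + (1 - 0) / n.+3%:R) `^ p) @ \oo --> p^-1 * 1 `^ p - p^-1 * 0.
    have -> // : p^-1 * 1 `^ p - p^-1 * 0 = p^-1 by rewrite powR1; ring.
  apply: (@cvg_exhausts_oo _ (fun x : R => p^-1 * x `^ p)) => //.
    by apply: cvgM; [exact: cvg_cst|exact: powR_cvg0].
  apply: cvg_at_left_filter.
  by apply: cvgM; [exact: cvg_cst|exact: continuous_powR].
Qed.

Lemma integrable_powR01 (R : realType) (p : R) : 0 < p ->
  lebesgue_measure.-integrable `]0, 1[ (EFin \o (fun x : R => x `^ (p - 1))).
Proof.
move=> p0; apply: ge0_integrable (integral_powR01 p0) => //.
- by apply: measurable_funTS; exact: measurable_powR.
- by move=> x _; exact: powR_ge0.
Qed.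

Lemma Rintegral_powR01 (R : realType) (p : R) : 0 < p ->
  \int[lebesgue_measure]_(x in `]0, 1[) (x `^ (p - 1)) = p^-1.
Proof. by move=> p0; rewrite /Rintegral integral_powR01. Qed.

Lemma le_integrable_R (R : realType) (D : set R) (f g : R -> R) :
  measurable D -> measurable_fun D f -> (forall x, D x -> `|f x| <= g x) ->
  lebesgue_measure.-integrable D (EFin \o g) ->
  lebesgue_measure.-integrable D (EFin \o f).
Proof.
move=> mD mf fg; apply: le_integrable => //; first exact/measurable_EFinP.
by move=> x Dx; rewrite /= lee_fin (le_trans (fg x Dx))// ler_norm.
Qed.

Lemma integrable_Z (R : realType) (D : set R) (f : R -> R) (k : R) :
  measurable D -> lebesgue_measure.-integrable D (EFin \o f) ->
  lebesgue_measure.-integrable D (EFin \o (fun x => k * f x)).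
Proof.
move=> mD intf; under [X in _.-integrable _ X]eq_fun do rewrite /= EFinM.
exact: integrableZl.
Qed.

Lemma integrable_ZDZ (R : realType) (D : set R) (f g : R -> R) (k l : R) :
  measurable D ->
  lebesgue_measure.-integrable D (EFin \o f) ->
  lebesgue_measure.-integrable D (EFin \o g) ->
  lebesgue_measure.-integrable D (EFin \o (fun x => k * f x + l * g x)).
Proof.
move=> mD intf intg.
under [X in _.-integrable _ X]eq_fun do rewrite /= EFinD.
by apply: integrableD => //; exact: integrable_Z.
Qed.

Lemma Rintegral_ZDZ (R : realType) (D : set R) (f g : R -> R) (k l : R) :
  measurable D ->
  lebesgue_measure.-integrable D (EFin \o f) ->
  lebesgue_measure.-integrable D (EFin \o g) ->
  \int[lebesgue_measure]_(x in D) (k * f x + l * g x) =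
  k * \int[lebesgue_measure]_(x in D) f x +
  l * \int[lebesgue_measure]_(x in D) g x.
Proof.
move=> mD intf intg; rewrite RintegralD//.
- by rewrite !RintegralZl.
- exact: integrable_Z.
- exact: integrable_Z.
Qed.

Lemma integrable_oo_bounded (R : realType) (a b M : R) (f : R -> R) :
  measurable_fun (`]a, b[%classic : set R) f -> {in `]a, b[, forall x, `|f x| <= M} ->
  lebesgue_measure.-integrable `]a, b[ (EFin \o f).
Proof.
move=> mf fM; apply: (@le_integrable_R _ _ _ (cst M)) => //.
apply: measurable_bounded_integrable => //; last exact: bounded_cst.
by rewrite /= lebesgue_measure_itv/=; case: ifPn => _; rewrite ltry.
Qed.

Lemma ge0_substitution_incr_integrable (R : realType) (D D' : set R)
    (c d c' d' : nat -> R) (phi phi' f : R -> R) :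
  exhausts D c d -> exhausts D' c' d' -> D' = phi @` D ->
  (forall x, D x -> is_derive x 1 phi (phi' x)) ->
  (forall x, D x -> {for x, continuous phi'}) ->
  (forall x, D x -> 0 < phi' x) ->
  (forall x, D' x -> {for x, continuous f}) -> (forall x, D' x -> 0 <= f x) ->
  lebesgue_measure.-integrable D' (EFin \o f) <->
  lebesgue_measure.-integrable D (EFin \o (fun x => f (phi x) * phi' x)).
Proof.
move=> ex ex' D'E dphi cphi' phi'0 cf f0; have [cd cc dd DE] := ex.
have E := ge0_substitution_incr ex D'E dphi cphi' phi'0 cf f0.
have DD' x : D x -> D' (phi x) by move=> Dx; rewrite D'E; exists x.
have g0 x : D x -> 0 <= f (phi x) * phi' x.
  by move=> Dx; rewrite mulr_ge0 ?f0 ?ltW ?phi'0//; exact: DD'.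
have cg x : D x -> {for x, continuous (fun x => f (phi x) * phi' x)}.
  move=> Dx; apply: continuousM; last exact: cphi'.
  apply: continuous_comp; last exact/cf/DD'.
  exact: is_derive_continuous (dphi x Dx).
have mg := exhausts_measurable_fun ex cg.
have absf : (\int[lebesgue_measure]_(x in D') `|(EFin \o f) x| =
    \int[lebesgue_measure]_(x in D') (f x)%:E)%E.
  by apply: eq_integral => x /set_mem Dx; rewrite /= ger0_norm ?f0.
have absg : (\int[lebesgue_measure]_(x in D) `|(EFin \o (fun x => f (phi x) * phi' x)%R) x| =
    \int[lebesgue_measure]_(x in D) (f (phi x) * phi' x)%:E)%E.
  by apply: eq_integral => x /set_mem Dx; rewrite /= ger0_norm ?g0.
split=> /integrableP[mf foo]; apply/integrableP.
  split; first exact/measurable_EFinP.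
  by rewrite absg -E -absf.
split; last by rewrite absf E -absg.
by apply/measurable_EFinP; exact: (exhausts_measurable_fun ex' cf).
Qed.

(** Expanding 1/(1 - w) in powers of w gives the sum over n >= 0 of 1/(n + 1 + x) - 1/(n + 2 - x),
    the partial fraction series of pi cot(pi x) without the poles at 0 and 1. *)
Definition cot_int (R : realType) (x : R) : R :=
  \int[lebesgue_measure]_(w in `]0, 1[) ((w `^ x - w `^ (1 - x)) / (1 - w)).

Lemma continuous_cot_integrand (R : realType) (x w : R) : 0 < w < 1 ->
  {for w, continuous (fun w : R => (w `^ x - w `^ (1 - x)) / (1 - w))}.
Proof.
move=> /andP[w0 w1]; apply: continuousM.
  by apply: continuousB; exact: continuous_powR.
by apply: continuousV; [rewrite gt_eqF// subr_gt0|exact: continuous_onem].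
Qed.

(** For exponents in [0, 1] both powers lie between w and 1, so they differ by at most 1 - w. *)
Lemma cot_integrand_bound (R : realType) (x w : R) : 0 <= x <= 1 -> 0 < w < 1 ->
  `|(w `^ x - w `^ (1 - x)) / (1 - w)| <= 1.
Proof.
move=> /andP[x0 x1] /andP[w0 w1].
have w1' : 0 < 1 - w by rewrite subr_gt0.
rewrite normrM normfV (gtr0_norm w1') ler_pdivrMr// mul1r.
have le1 p : 0 <= p <= 1 -> w <= w `^ p <= 1.
  move=> /andP[p0 p1]; rewrite ger1_powR//= ?w0 ?(ltW w1)//=.
  by rewrite -(powRr0 w) ger_powR// w0 ltW.
have /andP[a1 a2] : w <= w `^ x <= 1 by apply: le1; rewrite x0.
have /andP[b1 b2] : w <= w `^ (1 - x) <= 1 by apply: le1; apply/andP; split; lra.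
rewrite ler_norml; apply/andP; split; lra.
Qed.

Lemma measurable_cot_integrand (R : realType) (x : R) :
  measurable_fun (`]0, 1[%classic : set R) (fun w : R => (w `^ x - w `^ (1 - x)) / (1 - w)).
Proof.
apply: (exhausts_measurable_fun (exhausts_oo ltr01)) => w /=.
by rewrite in_itv/=; exact: continuous_cot_integrand.
Qed.

Lemma integrable_cot (R : realType) (x : R) : 0 <= x <= 1 ->
  lebesgue_measure.-integrable `]0, 1[
    (EFin \o (fun w : R => (w `^ x - w `^ (1 - x)) / (1 - w))).
Proof.
move=> x01; apply: (@integrable_oo_bounded _ _ _ 1).
  exact: measurable_cot_integrand.
by move=> w; rewrite in_itv/=; exact: cot_integrand_bound.
Qed.

(** The difference is at most |x - y| (- ln w). With r = sqrt w, - ln r <= 1/r - 1 <= (1 - r^2)/r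
    bounds - ln w by 2 w^(-1/2) (1 - w): the factor 1 - w cancels the denominator in [cot_int], and
    w^(-1/2) is still integrable. *)
Lemma powR_sub_bound (R : realType) (x y w : R) : 0 <= x -> 0 <= y -> 0 < w < 1 ->
  `|w `^ x - w `^ y| <= 2 * `|x - y| * (w `^ (2^-1 - 1) * (1 - w)).
Proof.
move=> + + /andP[w0 w1].
wlog xy : x y / x <= y => [H x0 y0|x0 y0].
  have [xy|/ltW yx] := leP x y; first exact: H.
  by rewrite distrC (distrC x); exact: H.
have w1' : 0 < 1 - w by rewrite subr_gt0.
have -> : w `^ y = w `^ x * w `^ (y - x) by rewrite -powRDpos// addrC subrK.
have wx1 : w `^ x <= 1 by rewrite -(powRr0 w) ger_powR// w0 ltW.
have wyx1 : w `^ (y - x) <= 1 by rewrite -(powRr0 w) ger_powR ?subr_ge0// w0 ltW.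
have -> : w `^ x - w `^ x * w `^ (y - x) = w `^ x * (1 - w `^ (y - x)) by ring.
rewrite ger0_norm; last by rewrite mulr_ge0 ?powR_ge0// subr_ge0.
rewrite (distrC x) (ger0_norm (_ : 0 <= y - x)) ?subr_ge0//.
apply: (@le_trans _ _ (1 - w `^ (y - x))).
  by rewrite ler_piMl// subr_ge0.
apply: (@le_trans _ _ (- ((y - x) * ln w))).
  have := expR_ge1Dx ((y - x) * ln w); rewrite /powR (gt_eqF w0); lra.
have -> : 2 * (y - x) * (w `^ (2^-1 - 1) * (1 - w)) =
  (y - x) * (2 * (w `^ (2^-1 - 1) * (1 - w))) by ring.
rewrite -mulrN ler_wpM2l ?subr_ge0//.
pose r := Num.sqrt w.
have r0 : 0 < r by rewrite sqrtr_gt0.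
have r2 : r ^+ 2 = w by rewrite sqr_sqrtr// ltW.
have r1 : r < 1 by rewrite -(@ltr_pXn2r _ 2) ?nnegrE ?(ltW r0)// r2 expr1n.
have -> : w `^ (2^-1 - 1) = r^-1.
  rewrite powRB1// powR12_sqrt ?(ltW w0)// -/r -r2; field.
  by rewrite lt0r_neq0.
have lnr : - ln r <= r^-1 - 1.
  rewrite -lnV ?posrE//; have : -1 < r^-1 - 1 by rewrite ltrBrDl addrN invr_gt0.
  by move=> /le_ln1Dx; rewrite addrC subrK.
have -> : ln w = 2 * ln r by rewrite -r2 lnXn// mulr_natl.
have : (r^-1 - 1) <= r^-1 * (1 - r ^+ 2).
  have -> : r^-1 - 1 = r^-1 * (1 - r) by field; rewrite lt0r_neq0.
  by rewrite ler_wpM2l ?invr_ge0 ?(ltW r0)// lerD2l lerN2 expr2 ler_piMl ?(ltW r0)// ltW.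
rewrite r2; lra.
Qed.

Lemma cot_int_onem (R : realType) (x : R) : 0 <= x <= 1 ->
  cot_int (1 - x) = - cot_int x.
Proof.
move=> x01; rewrite -[RHS]mulN1r /cot_int -RintegralZl//; last exact: integrable_cot.
apply: eq_Rintegral => w _; have -> : 1 - (1 - x) = x by ring.
by ring.
Qed.

Lemma cot_int_lipschitz (R : realType) :
  {in `]0, 1[ &, forall x y : R, `|cot_int x - cot_int y| <= 8 * `|x - y|}.
Proof.
move=> x y; rewrite !in_itv/= => /andP[x0 x1] /andP[y0 y1].
have ix : 0 <= x <= 1 by rewrite !ltW.
have iy : 0 <= y <= 1 by rewrite !ltW.
have h0 : 0 < 2^-1 :> R by rewrite invr_gt0.
(* Each of the two differences of powers contributes 2 |x - y|; the integral 2 of w^(-1/2) then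
   turns 4 into 8. *)
pose k := 4 * `|x - y|.
have ipow := integrable_powR01 h0.
have ib : lebesgue_measure.-integrable `]0, 1[
    (EFin \o (fun w : R => k * w `^ (2^-1 - 1))).
  exact: integrable_Z.
have idiff : lebesgue_measure.-integrable `]0, 1[ (EFin \o (fun w : R =>
    (w `^ x - w `^ (1 - x)) / (1 - w) - (w `^ y - w `^ (1 - y)) / (1 - w))).
  have := integrable_ZDZ 1 (-1) (measurable_itv _) (integrable_cot ix) (integrable_cot iy).
  by under [X in _.-integrable _ X -> _]eq_fun do rewrite /= mul1r mulN1r.
rewrite /cot_int -RintegralB//; [|exact: integrable_cot|exact: integrable_cot].
apply: le_trans (le_normr_Rintegral _ idiff) _ => //.
have -> : 8 * `|x - y| = k * (2^-1)^-1 by rewrite /k invrK; ring.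
rewrite -(Rintegral_powR01 h0) -RintegralZl//.
apply: le_Rintegral => //; first exact: integrable_norm.
move=> w /=; rewrite in_itv/= => /andP[w0 w1].
have w1' : 0 < 1 - w by rewrite subr_gt0.
rewrite -mulrBl normrM normfV (gtr0_norm w1') ler_pdivrMr//.
have E : w `^ x - w `^ (1 - x) - (w `^ y - w `^ (1 - y)) =
  (w `^ x - w `^ y) + (w `^ (1 - y) - w `^ (1 - x)) by ring.
rewrite E; apply: le_trans (ler_normD _ _) _.
have b1 : `|w `^ x - w `^ y| <= 2 * `|x - y| * (w `^ (2^-1 - 1) * (1 - w)).
  by apply: powR_sub_bound; rewrite ?ltW ?w0.
have b2 : `|w `^ (1 - y) - w `^ (1 - x)| <=
    2 * `|(1 - y) - (1 - x)| * (w `^ (2^-1 - 1) * (1 - w)).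
  by apply: powR_sub_bound; rewrite ?subr_ge0 ?ltW ?w0.
have E2 : (1 - y) - (1 - x) = x - y by ring.
rewrite E2 in b2; apply: le_trans (lerD b1 b2) _.
by rewrite /k le_eqVlt; apply/orP; left; apply/eqP; ring.
Qed.

(* The substitution [w = v ^+ 2]. *)
Lemma cot_int_half (R : realType) (x : R) : 0 < x < 1 ->
  lebesgue_measure.-integrable `]0, 1[
    (EFin \o (fun v : R => (v `^ x - v `^ (2 - x)) / (1 - v ^+ 2) * (2 * v))) /\
  cot_int (x / 2) =
  \int[lebesgue_measure]_(v in `]0, 1[)
     ((v `^ x - v `^ (2 - x)) / (1 - v ^+ 2) * (2 * v)).
Proof.
move=> /andP[x0 x1]; pose f (w : R) := (w `^ (x / 2) - w `^ (1 - x / 2)) / (1 - w).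
have ex := exhausts_oo (@ltr01 R).
have sq (v : R) : 0 < v -> f (v ^+ 2) * (2 * v) =
    (v `^ x - v `^ (2 - x)) / (1 - v ^+ 2) * (2 * v).
  move=> v0; rewrite /f -!(powR_mulrn _ (ltW v0)) -!powRrM.
  have -> : 2 * (x / 2) = x by field.
  by have -> : 2 * (1 - x / 2) = 2 - x by field.
have im : `]0, 1[%classic = (fun v : R => v ^+ 2) @` `]0, 1[%classic.
  apply/seteqP; split => [w /=|_ [v /= + <-]]; rewrite !in_itv/= => /andP[w0 w1].
    exists (Num.sqrt w); last by rewrite sqr_sqrtr// ltW.
    by rewrite /= in_itv/= sqrtr_gt0 w0/= -(@ltr_pXn2r _ 2) ?nnegrE ?sqrtr_ge0// expr1n sqr_sqrtr// ltW.
  by rewrite exprn_gt0// exprn_ilt1// ltW.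
have d (v : R) : `]0, 1[%classic v -> is_derive v 1 (fun v : R => v ^+ 2) (2 * v).
  by move=> _; apply: is_derive_eq; rewrite /GRing.scale/=; ring.
have cd (v : R) : `]0, 1[%classic v -> {for v, continuous (fun v : R => 2 * v)}.
  by move=> _; apply: continuousM; [exact: cst_continuous|exact: cvg_id].
have d0 (v : R) : `]0, 1[%classic v -> 0 < 2 * v.
  by rewrite /= in_itv/= => /andP[v0 _]; rewrite mulr_gt0.
have cf (w : R) : `]0, 1[%classic w -> {for w, continuous f}.
  by rewrite /= in_itv/=; exact: continuous_cot_integrand.
have f0 (w : R) : `]0, 1[%classic w -> 0 <= f w.
  rewrite /= in_itv/= => /andP[w0 w1]; rewrite divr_ge0 ?subr_ge0 ?(ltW w1)//.
  by rewrite ger_powR ?w0 ?(ltW w1)//; lra.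
have fint : lebesgue_measure.-integrable `]0, 1[ (EFin \o f).
  by apply: integrable_cot; apply/andP; split; lra.
have := (ge0_substitution_incr_integrable ex ex im d cd d0 cf f0).1 fint.
have := ge0_substitution_incr ex im d cd d0 cf f0.
move=> E ig; split.
  apply: eq_integrable ig => // v /set_mem/=; rewrite in_itv/= => /andP[v0 _].
  by rewrite sq.
have EE : (\int[lebesgue_measure]_(v in `]0%R, 1%R[) (f (v ^+ 2) * (2 * v))%:E =
    \int[lebesgue_measure]_(v in `]0%R, 1%R[)
      ((v `^ x - v `^ (2 - x)) / (1 - v ^+ 2) * (2 * v))%:E)%E.
  by apply: eq_integral => v /set_mem/=; rewrite in_itv/= => /andP[v0 _]; rewrite sq.
exact: (congr1 fine (etrans E EE)).
Qed.

Lemma cot_int_double (R : realType) (x : R) : 0 < x < 1 ->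
  cot_int (x / 2) + cot_int ((x + 1) / 2) =
  2 * cot_int x + 2 / (2 - x) - 2 / (x + 1).
Proof.
move=> x01; have /andP[x0 x1] := x01.
have y01 : 0 < 1 - x < 1 by apply/andP; split; lra.
(* Oddness about 1/2 makes both terms instances of [cot_int_half]; in their sum the factor 1 + v
   cancels from 1 - v^2. *)
have -> : (x + 1) / 2 = 1 - (1 - x) / 2 by field.
rewrite cot_int_onem; last by apply/andP; split; lra.
have [i1 ->] := cot_int_half x01; have [i2 ->] := cot_int_half y01.
have ix : 0 <= x <= 1 by rewrite !ltW.
have icot := integrable_cot ix.
have p1 : 0 < x + 1 by lra.
have p2 : 0 < 2 - x by lra.
have ip1 := integrable_powR01 p1; have ip2 := integrable_powR01 p2.
rewrite -[_ / (2 - x)]mulrC -[_ / (x + 1)]mulrC.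
rewrite -(Rintegral_powR01 p1) -(Rintegral_powR01 p2).
have m01 : measurable (`]0, 1[%classic : set R) by [].
have -> : forall A B C : R, 2 * A + B * 2 - C * 2 = 2 * A + 1 * (2 * B + (- 2) * C).
  by move=> A B C; ring.
rewrite /cot_int -(Rintegral_ZDZ 2 (-2) m01 ip2 ip1).
rewrite -(Rintegral_ZDZ 2 1 m01 icot (integrable_ZDZ 2 (-2) m01 ip2 ip1)).
rewrite -RintegralB//; apply: eq_Rintegral => v /set_mem/=.
rewrite in_itv/= => /andP[v0 v1].
have -> : 2 - (1 - x) = x + 1 by ring.
rewrite addrK; have -> : 2 - x - 1 = 1 - x by ring.
have -> : v `^ (x + 1) = v `^ x * v by rewrite powRDpos// powRr1// ltW.
have -> : v `^ (2 - x) = v `^ (1 - x) * v.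
  by rewrite -{3}(powRr1 (ltW v0)) -powRDpos//; congr (_ `^ _); ring.
by field; apply/andP; split; rewrite subr_eq0 ?gt_eqF// ?exprn_ilt1// ltW.
Qed.

(* The difference satisfies the duplication formula, which halves its Lipschitz
   constant; so it is constant, and it is odd about [1/2]. *)
Lemma cot_int_eq (R : realType) (x : R) : 0 < x < 1 -> cot_int x = cot_reg x.
Proof.
pose d (y : R) := cot_int y - cot_reg y.
have half1 (y : R) : 0 < y < 1 -> 0 < y / 2 < 1.
  by move=> /andP[y0 y1]; apply/andP; split; lra.
have half2 (y : R) : 0 < y < 1 -> 0 < (y + 1) / 2 < 1.
  by move=> /andP[y0 y1]; apply/andP; split; lra.
have dd (y : R) : 0 < y < 1 -> 2 * d y = d (y / 2) + d ((y + 1) / 2).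
  move=> y01; move: (cot_int_double y01) (cot_reg_double y01); rewrite /d.
  move: (cot_int (y / 2)) (cot_int ((y + 1) / 2)) (cot_int y) => A B C.
  by move: (cot_reg (y / 2)) (cot_reg ((y + 1) / 2)) (cot_reg y) => A' B' C'; lra.
(* The sum of the Lipschitz constants pi^2 + 4 of [cot_reg] and 8 of [cot_int]. *)
pose L : R := pi ^+ 2 + 12.
have L0 : 0 <= L by rewrite addr_ge0// sqr_ge0.
have lip n : forall y z : R, 0 < y < 1 -> 0 < z < 1 ->
    `|d y - d z| <= L / 2 ^+ n * `|y - z|.
  elim: n => [y z y01 z01|n IHn y z y01 z01].
    rewrite expr0 divr1 /d.
    have -> : cot_int y - cot_reg y - (cot_int z - cot_reg z) =
      (cot_int y - cot_int z) - (cot_reg y - cot_reg z).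
      by move: (cot_int y) (cot_int z) => A B; ring.
    apply: le_trans (ler_normB _ _) _.
    have h1 := @cot_int_lipschitz R y z; have h2 := @cot_reg_lipschitz R y z.
    rewrite !in_itv/= in h1 h2.
    by apply: le_trans (lerD (h1 y01 z01) (h2 y01 z01)) _; rewrite /L -mulrDl ler_wpM2r//; lra.
  have -> : d y - d z = ((d (y / 2) - d (z / 2)) +
      (d ((y + 1) / 2) - d ((z + 1) / 2))) / 2.
    by have := dd y y01; have := dd z z01; lra.
  rewrite normrM normfV (ger0_norm (_ : 0 <= 2 :> R))// ler_pdivrMr//.
  apply: le_trans (ler_normD _ _) _.
  have := IHn _ _ (half1 y y01) (half1 z z01).
  have := IHn _ _ (half2 y y01) (half2 z z01).
  have -> : (y + 1) / 2 - (z + 1) / 2 = (y - z) / 2 by field.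
  rewrite -mulrBl normrM (ger0_norm (_ : 0 <= 2^-1 :> R))//.
  rewrite exprS; set A := _ ^+ n; set B := `|y - z|.
  have -> : L / (2 * A) * B * 2 = L / A * B by field; rewrite expf_neq0.
  by rewrite mulrA; lra.
have dconst (y z : R) : 0 < y < 1 -> 0 < z < 1 -> d y = d z.
  move=> y01 z01; apply/eqP; rewrite -subr_eq0 -normr_le0 leNgt; apply/negP => e0.
  pose e := `|d y - d z|; pose N := Num.truncn (L / e).
  have := lip N y z y01 z01; rewrite leNgt => /negP; apply.
  have yz1 : `|y - z| <= 1.
    by move: y01 z01 => /andP[? ?] /andP[? ?]; rewrite ler_norml; apply/andP; split; lra.
  apply: (@le_lt_trans _ _ (L / 2 ^+ N)).
    by rewrite ler_piMr// divr_ge0// exprn_ge0.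
  rewrite ltr_pdivrMr ?exprn_gt0// -ltr_pdivrMl// mulrC.
  apply: lt_le_trans (truncnS_gt _) _.
  by rewrite -natrX ler_nat ltn_expl.
move=> x01; apply/eqP; rewrite -subr_eq0; apply/eqP.
have x01' : 0 < 1 - x < 1 by move: x01 => /andP[? ?]; apply/andP; split; lra.
have := dconst _ _ x01 x01'.
rewrite /d cot_reg_onem cot_int_onem; last by move: x01 => /andP[? ?]; rewrite !ltW.
lra.
Qed.

(** Partial fractions split the integrand into that of [cot_int (x / 2)] after w = v^2, minus that
    of [cot_int x], plus three powers. The integrals of the powers cancel the rational parts of
    [cot_reg], and pi cot(pi x/2) - pi cot(pi x) remains. *)
Lemma integral_powR_div1D01 (R : realType) (x : R) : 0 < x < 1 ->
  (\int[lebesgue_measure]_(w in `]0%R, 1%R[)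
    ((w `^ (x - 1) + w `^ (- x)) / (1 + w))%:E = (pi / sin (pi * x))%:E)%E.
Proof.
move=> x01; have /andP[x0 x1] := x01.
have p1 : 0 < 1 - x by lra.
have p2 : 0 < 2 - x by lra.
have ip0 := integrable_powR01 x0.
have ip1 := integrable_powR01 p1; have ip2 := integrable_powR01 p2.
have ix : 0 <= x <= 1 by rewrite !ltW.
have icot := integrable_cot ix.
have [i1 E1] := cot_int_half x01.
have m01 : measurable (`]0, 1[%classic : set R) by [].
have h01 : 0 < x / 2 < 1 by apply/andP; split; lra.
have iA := integrable_ZDZ 1 (-1) m01 i1 icot.
have iB := integrable_ZDZ 1 (-2) m01 ip1 ip2.
have iC := integrable_ZDZ 1 1 m01 ip0 iB.
have iT := integrable_ZDZ 1 1 m01 iA iC.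
have EI : {in (`]0, 1[%classic : set R), forall w : R,
    (w `^ (x - 1) + w `^ (- x)) / (1 + w) =
    1 * (1 * ((w `^ x - w `^ (2 - x)) / (1 - w ^+ 2) * (2 * w)) +
         -1 * ((w `^ x - w `^ (1 - x)) / (1 - w))) +
    1 * (1 * w `^ (x - 1) + 1 * (1 * w `^ (1 - x - 1) + -2 * w `^ (2 - x - 1)))}.
  move=> w /set_mem/=; rewrite in_itv/= => /andP[w0 w1].
  have -> : 1 - x - 1 = - x by ring.
  have -> : 2 - x - 1 = - x + 1 by ring.
  have -> : 2 - x = - x + 1 + 1 by ring.
  have -> : 1 - x = - x + 1 by ring.
  rewrite powRB1// !(powRDpos _ _ w0) powRr1 ?(ltW w0)//.
  have h1 : w != 0 by lra.
  have h2 : 1 - w != 0 by lra.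
  have h3 : 1 + w != 0 by lra.
  have h4 : 1 - w ^+ 2 != 0.
    have -> : 1 - w ^+ 2 = (1 - w) * (1 + w) by ring.
    by rewrite mulf_neq0.
  by field; rewrite ?h1 ?h2 ?h3 ?h4.
have := eq_Rintegral lebesgue_measure EI.
rewrite (Rintegral_ZDZ 1 1 m01 iA iC) (Rintegral_ZDZ 1 (-1) m01 i1 icot).
rewrite (Rintegral_ZDZ 1 1 m01 ip0 iB) (Rintegral_ZDZ 1 (-2) m01 ip1 ip2).
rewrite -E1 !Rintegral_powR01//; rewrite -/(cot_int x) !cot_int_eq// /cot_reg.
have Ecot := cot_half_sub x01.
move=> EK.
have {}EK : \int[lebesgue_measure]_(w in `]0, 1[)
    ((w `^ (x - 1) + w `^ (- x)) / (1 + w)) = pi / sin (pi * x).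
  rewrite EK -Ecot.
  have h1 : x != 0 by lra.
  have h2 : 1 - x != 0 by lra.
  have h3 : 2 - x != 0 by lra.
  move: (pi * _) (pi * _) => A B.
  by field; rewrite ?h1 ?h2 ?h3.
rewrite -EK /Rintegral fineK//; apply: integrable_fin_num => //.
apply: eq_integrable iT => // w w01.
by rewrite /= EI.
Qed.

Lemma continuous_powR_div1D (R : realType) (p w : R) : 0 < w ->
  {for w, continuous (fun w : R => w `^ p / (1 + w))}.
Proof.
move=> w0; apply: continuousM; first exact: continuous_powR.
apply: continuousV; first by rewrite gt_eqF// addr_gt0.
by apply: continuousD; [exact: cst_continuous|exact: cvg_id].
Qed.

Lemma exhausts_1y (R : realType) : exhausts (`]1, +oo[%classic : set R)
  (fun n => 1 + n.+2%:R^-1) (fun n => n.+3%:R).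
Proof.
split => [n|n|n|].
- have : n.+2%:R^-1 < 1 :> R by rewrite invf_lt1// ltr1n.
  have : 2 < n.+3%:R :> R by rewrite ltr_nat.
  by move: n.+3%:R n.+2%:R^-1 => A B; lra.
- by rewrite lerD2l lef_pV2 ?posrE// ler_nat.
- by rewrite ler_nat.
- apply/seteqP; split => [x /=|x [n _] /=]; rewrite !in_itv/= ?andbT; last first.
    by move=> /andP[+ _]; apply: lt_le_trans; rewrite ltrDl invr_gt0.
  move=> x1; have x0 : 0 < x - 1 by rewrite subr_gt0.
  pose n := Num.truncn (Num.max x (x - 1)^-1).
  have nE : Num.max x (x - 1)^-1 < n.+1%:R by exact: truncnS_gt.
  have : Num.max x (x - 1)^-1 <= n.+2%:R.
    by apply/ltW; apply: lt_trans nE _; rewrite ltr_nat.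
  rewrite ge_max => /andP[xn xVn]; exists n => //=; rewrite in_itv/=.
  rewrite (le_trans xn) ?ler_nat// andbT -lerBrDl.
  by rewrite -[leRHS]invrK lef_pV2 ?posrE ?invr_gt0.
Qed.

(** The inversion w = 1/v folds the tail ]1, +oo[ onto ]0, 1[, where the integrand becomes v^(-x) /
    (1 + v). *)
Lemma integral_powR_div1D (R : realType) (x : R) : 0 < x < 1 ->
  (\int[lebesgue_measure]_(w in `]0%R, +oo[)
    (w `^ (x - 1) / (1 + w))%:E = (pi / sin (pi * x))%:E)%E.
Proof.
move=> x01; have /andP[x0 x1] := x01; rewrite -integral_powR_div1D01//.
pose f (w : R) := w `^ (x - 1) / (1 + w).
have f0 (w : R) : 0 < w -> 0 <= f w.
  by move=> w0; rewrite divr_ge0 ?powR_ge0// addr_ge0// ltW.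
have cf (w : R) : 0 < w -> {for w, continuous f}.
  by move=> w0; exact: continuous_powR_div1D.
have -> : `]0, +oo[%classic = (`]0, 1[ `|` `[1, +oo[)%classic :> set R.
  by rewrite -itv_bndbnd_setU// bnd_simp.
have m1 : measurable_fun (`]1, +oo[%classic : set R) f.
  apply: (exhausts_measurable_fun (exhausts_1y R)) => w /=.
  by rewrite in_itv/= andbT => w1; apply: cf; exact: lt_trans w1.
have m0 p : measurable_fun (`]0, 1[%classic : set R) (fun w : R => w `^ p / (1 + w)).
  apply: (exhausts_measurable_fun (exhausts_oo (@ltr01 R))) => w /=.
  by rewrite in_itv/= => /andP[w0 _]; exact: continuous_powR_div1D.
rewrite ge0_integral_setU//; last 3 first.
- rewrite -itv_bndbnd_setU ?bnd_simp//; apply/measurable_EFinP.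
  apply: (exhausts_measurable_fun (exhausts_oy R)) => w /=.
  by rewrite in_itv/= andbT; exact: cf.
- move=> w [] /=; rewrite in_itv/= ?andbT => w1; rewrite lee_fin f0//.
    by case/andP: w1.
  exact: lt_le_trans w1.
- apply/disj_setPS => w [] /=; rewrite !in_itv/= andbT => /andP[_ w1].
  by rewrite leNgt w1.
rewrite -integral_itv_obnd_cbnd; last exact/measurable_EFinP.
have im : `]1, +oo[%classic = (fun v : R => v^-1) @` `]0, 1[%classic.
  apply/seteqP; split => [w /=|_ [v /= + <-]]; rewrite !in_itv/= ?andbT; last first.
    by move=> /andP[v0 v1]; rewrite invf_gt1.
  move=> w1; exists w^-1; last by rewrite invrK.
  have w0 : 0 < w by exact: lt_trans w1.
  by rewrite /= in_itv/= invr_gt0 w0/= invf_lt1.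
have d (v : R) : `]0, 1[%classic v -> is_derive v 1 (fun v : R => v^-1) (- v ^- 2).
  rewrite /= in_itv/= => /andP[v0 _]; have v0' : v != 0 by rewrite gt_eqF.
  by have := is_deriveV v0' (is_derive_id v 1); rewrite /GRing.scale/= mulr1.
have cd (v : R) : `]0, 1[%classic v -> {for v, continuous (fun v : R => - v ^- 2)}.
  rewrite /= in_itv/= => /andP[v0 _].
  apply: continuousN; apply: continuousV; first by rewrite expf_neq0// gt_eqF.
  exact: (@exprn_continuous _ 2).
have d0 (v : R) : `]0, 1[%classic v -> - v ^- 2 < 0.
  by rewrite /= in_itv/= => /andP[v0 _]; rewrite oppr_lt0 invr_gt0 exprn_gt0.
have cf1 (w : R) : `]1, +oo[%classic w -> {for w, continuous f}.
  by rewrite /= in_itv/= andbT => w1; apply: cf; exact: lt_trans w1.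
have f01 (w : R) : `]1, +oo[%classic w -> 0 <= f w.
  by rewrite /= in_itv/= andbT => w1; apply: f0; exact: lt_trans w1.
rewrite (ge0_substitution_decr (exhausts_oo ltr01) im d cd d0 cf1 f01).
have key (v : R) : 0 < v -> f v^-1 * - - v ^- 2 = v `^ (- x) / (1 + v).
  move=> v0; rewrite /f opprK; have v0' : v != 0 by rewrite gt_eqF.
  have -> : v^-1 `^ (x - 1) = v `^ (- x) * v.
    rewrite -[v^-1]powR_inv1 ?(ltW v0)// -powRrM.
    have -> : -1 * (x - 1) = - x + 1 by ring.
    by rewrite powRDpos// powRr1// ltW.
  have -> : 1 + v^-1 = (1 + v) / v by field.
  by field; rewrite v0' gt_eqF// addr_gt0.
rewrite [X in (_ + X)%E](_ : _ = \int[lebesgue_measure]_(v in `]0%R, 1%R[)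
    (v `^ (- x) / (1 + v))%:E)%E; last first.
  apply: eq_integral => v /set_mem/=; rewrite in_itv/= => /andP[v0 _].
  by rewrite -key.
have pos p (v : R) : `]0, 1[%classic v -> (0 <= (v `^ p / (1 + v))%:E)%E.
  rewrite /= in_itv/= => /andP[v0 _].
  by rewrite lee_fin divr_ge0 ?powR_ge0// addr_ge0// ltW.
rewrite -ge0_integralD//=.
+ by apply: eq_integral => v _; rewrite -EFinD -mulrDl.
+ exact: pos.
+ by apply/measurable_EFinP; exact: m0.
+ exact: pos.
+ by apply/measurable_EFinP; exact: m0.
Qed.

(** The same integral under u = w/(1 + w), now as B(x, 1 - x). This form gives the limit of the
    moment of order 0; the one on ]0, +oo[ serves the Gamma function. *)
Lemma integral_beta_reflection (R : realType) (x : R) : 0 < x < 1 ->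
  (\int[lebesgue_measure]_(u in `]0%R, 1%R[)
    (u `^ (x - 1) * (1 - u) `^ (- x))%:E = (pi / sin (pi * x))%:E)%E.
Proof.
move=> x01; have /andP[x0 x1] := x01; rewrite -integral_powR_div1D//.
have im : `]0, 1[%classic = (fun w : R => w / (1 + w)) @` `]0, +oo[%classic.
  apply/seteqP; split => [u /=|_ [w /= + <-]]; rewrite !in_itv/= ?andbT.
    move=> /andP[u0 u1]; exists (u / (1 - u)).
      by rewrite /= in_itv/= andbT divr_gt0// subr_gt0.
    have h : 1 - u != 0 by rewrite gt_eqF// subr_gt0.
    have -> : 1 + u / (1 - u) = (1 - u)^-1 by field.
    by rewrite invrK mulfVK.
  move=> w0; have h : 0 < 1 + w by rewrite addr_gt0.
  by rewrite divr_gt0//= ltr_pdivrMr// mul1r ltrDr.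
have d (w : R) : `]0, +oo[%classic w ->
    is_derive w 1 (fun w : R => w / (1 + w)) ((1 + w) ^- 2).
  rewrite /= in_itv/= andbT => w0.
  have h : 1 + w != 0 by rewrite gt_eqF// addr_gt0.
  have d1 : is_derive w 1 (fun w : R => (1 + w)^-1) (- (1 + w) ^- 2).
    by apply: is_derive_eq; rewrite /GRing.scale/=; ring.
  by apply: is_derive_eq; rewrite /GRing.scale/=; field.
have cd (w : R) : `]0, +oo[%classic w -> {for w, continuous (fun w : R => (1 + w) ^- 2)}.
  rewrite /= in_itv/= andbT => w0.
  apply: continuousV; first by rewrite expf_neq0// gt_eqF// addr_gt0.
  apply: (@continuous_comp _ _ _ (fun w : R => 1 + w) (fun z : R => z ^+ 2)).
    by apply: continuousD; [exact: cst_continuous|exact: cvg_id].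
  exact: exprn_continuous.
have d0 (w : R) : `]0, +oo[%classic w -> 0 < (1 + w) ^- 2.
  by rewrite /= in_itv/= andbT => w0; rewrite invr_gt0 exprn_gt0// addr_gt0.
have cf (u : R) : `]0, 1[%classic u ->
    {for u, continuous (fun u : R => u `^ (x - 1) * (1 - u) `^ (- x))}.
  rewrite /= in_itv/= => /andP[u0 u1].
  apply: continuousM; first exact: continuous_powR.
  by apply: continuous_powR_comp; [rewrite subr_gt0|exact: continuous_onem].
have f0 (u : R) : `]0, 1[%classic u -> 0 <= u `^ (x - 1) * (1 - u) `^ (- x).
  by move=> _; rewrite mulr_ge0// powR_ge0.
rewrite (ge0_substitution_incr (exhausts_oy R) im d cd d0 cf f0).
apply: eq_integral => w /set_mem/=; rewrite in_itv/= andbT => w0.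
have h : 0 < 1 + w by rewrite addr_gt0.
have -> : 1 - w / (1 + w) = (1 + w)^-1 by field; rewrite gt_eqF.
congr EFin.
have -> : (1 + w)^-1 `^ (- x) = (1 + w) `^ x.
  by rewrite -powR_inv1 ?(ltW h)// -powRrM mulN1r opprK.
rewrite powRM ?invr_ge0 ?(ltW h) ?(ltW w0)//.
have -> : (1 + w)^-1 `^ (x - 1) = (1 + w) / (1 + w) `^ x.
  rewrite -[(1 + w)^-1]powR_inv1 ?(ltW h)// -powRrM.
  have -> : -1 * (x - 1) = 1 + - x by ring.
  by rewrite powRDpos// powRr1 ?(ltW h)// powRN.
have hx : (1 + w) `^ x != 0 by rewrite gt_eqF// powR_gt0.
by field; rewrite hx gt_eqF.
Qed.

(** * The Gamma integral: reflection, finiteness, functional equation *)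

Lemma tonelli_set (R : realType) (D E : set R) (g : R -> R -> R) :
  measurable D -> measurable E ->
  measurable_fun setT (fun z : R * R => g z.1 z.2) ->
  (forall x y, 0 <= g x y) ->
  (\int[lebesgue_measure]_(x in D) \int[lebesgue_measure]_(y in E) (g x y)%:E =
   \int[lebesgue_measure]_(y in E) \int[lebesgue_measure]_(x in D) (g x y)%:E)%E.
Proof.
move=> mD mE mg g0.
pose F := ((fun z : R * R => (g z.1 z.2)%:E) \_ (D `*` E))%E.
have F0 z : (0 <= F z)%E.
  by rewrite /F patchE; case: ifPn => // _; rewrite lee_fin.
have mF : measurable_fun setT F.
  apply/(measurable_restrictT _ _).1; first exact: measurableX.
  by apply: measurable_funTS; exact/measurable_EFinP.
have H1 : (\int[lebesgue_measure]_(x in D) \int[lebesgue_measure]_(y in E) (g x y)%:E =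
  \int[lebesgue_measure]_x \int[lebesgue_measure]_y F (x, y))%E.
  rewrite integral_mkcond; apply: eq_integral => x _; rewrite patchE.
  case: ifPn => xD.
    rewrite integral_mkcond; apply: eq_integral => y _; rewrite /F !patchE.
    by rewrite in_setX/= xD.
  rewrite integral0_eq// => y _; rewrite /F patchE in_setX/=.
  by rewrite (negbTE xD).
have H2 : (\int[lebesgue_measure]_(y in E) \int[lebesgue_measure]_(x in D) (g x y)%:E =
  \int[lebesgue_measure]_y \int[lebesgue_measure]_x F (x, y))%E.
  rewrite integral_mkcond; apply: eq_integral => y _; rewrite patchE.
  case: ifPn => yE.
    rewrite integral_mkcond; apply: eq_integral => x _; rewrite /F !patchE.
    by rewrite in_setX/= yE andbT.
  rewrite integral0_eq// => x _; rewrite /F patchE in_setX/=.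
  by rewrite (negbTE yE) andbF.
by rewrite H1 H2; exact: fubini_tonelli.
Qed.

Lemma cvg_inv2 (R : realType) : (n.+2%:R^-1 : R) @[n --> \oo] --> (0 : R).
Proof.
have := @cvg_harmonic R; rewrite -(cvg_shiftn 1) /harmonic /=.
by under eq_cvg do rewrite addn1.
Qed.

Lemma cvg_expRN2 (R : realType) (k : R) : 0 < k ->
  expR (- (k * n.+2%:R)) @[n --> \oo] --> (0 : R).
Proof.
move=> k0; apply: (@squeeze_cvgr _ _ _ _ (cst 0) (fun n => k^-1 * n.+2%:R^-1)).
- apply: nearW => n; rewrite expR_ge0/= -invfM expRN lef_pV2 ?posrE ?expR_gt0 ?mulr_gt0//.
  by apply: le_trans (expR_ge1Dx _); rewrite lerDr.
- exact: cvg_cst.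
- have -> : nbhs (0 : R) = nbhs (k^-1 * 0) by rewrite mulr0.
  by apply: cvgM; [exact: cvg_cst|exact: cvg_inv2].
Qed.

Lemma is_derive_expRN (R : realType) (k x : R) :
  is_derive x 1 (fun x : R => expR (- (k * x))) (- k * expR (- (k * x))).
Proof.
have d : is_derive x 1 (fun x : R => - (k * x)) (- k).
  by apply: is_derive_eq; rewrite /GRing.scale/=; ring.
by apply: is_derive_eq; rewrite /GRing.scale/=; ring.
Qed.

Lemma integral_expRN (R : realType) (k : R) : 0 < k ->
  (\int[lebesgue_measure]_(x in `]0%R, +oo[) (expR (- (k * x)))%:E = (k^-1)%:E)%E.
Proof.
move=> k0; apply: (ge0_improper_FTC (exhausts_oy R)
  (F := fun x : R => - k^-1 * expR (- (k * x)))).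
- by move=> x _; exact: is_derive_continuous (is_derive_expRN k x).
- by move=> x _; exact: expR_ge0.
- move=> x _; have d := is_derive_expRN k x.
  by apply: is_derive_eq; rewrite /GRing.scale/=; field; rewrite gt_eqF.
- have -> : nbhs k^-1 = nbhs (- k^-1 * 0 - - k^-1 * expR (- (k * 0))).
    by congr nbhs; rewrite !mulr0 oppr0 expR0; ring.
  apply: cvgB; apply: cvgM; [exact: cvg_cst|exact: cvg_expRN2|exact: cvg_cst|].
  have c0 := is_derive_continuous (is_derive_expRN k 0).
  by have := cvg_comp _ _ (@cvg_inv2 R) c0.
Qed.

(** Kept in the extended reals because [Gamma] applies [fine], which would send an infinite integral
    to 0. *)
Definition gamma_integral (R : realType) (s : R) : \bar R :=
  (\int[lebesgue_measure]_(x in `]0%R, +oo[) (x `^ (s - 1) * expR (- x))%:E)%E.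

Lemma Gamma_fine (R : realType) (s : R) : Gamma s = fine (gamma_integral s).
Proof. by rewrite /Gamma /Rintegral /gamma_integral set_itvoy. Qed.

Lemma continuous_gamma_integrand (R : realType) (s x : R) : 0 < x ->
  {for x, continuous (fun x : R => x `^ (s - 1) * expR (- x))}.
Proof.
move=> x0; apply: continuousM; first exact: continuous_powR.
apply: (@continuous_comp _ _ _ (fun x : R => - x) expR); last exact: continuous_expR.
by apply: continuousN; exact: cvg_id.
Qed.

Lemma measurable_gamma_integrand (R : realType) (s : R) (D : set R) :
  measurable_fun D (fun x : R => x `^ (s - 1) * expR (- x)).
Proof.
apply: measurable_funTS; apply: measurable_funM; first exact: measurable_powR.
by apply: measurableT_comp => //; exact: measurable_expR.
Qed.

Lemma gamma_integrand_ge0 (R : realType) (s x : R) : 0 <= x `^ (s - 1) * expR (- x).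
Proof. by rewrite mulr_ge0 ?powR_ge0 ?expR_ge0. Qed.

Lemma gamma_integral_ge0 (R : realType) (s : R) : (0 <= gamma_integral s)%E.
Proof. by apply: integral_ge0 => x _; rewrite lee_fin gamma_integrand_ge0. Qed.

Lemma gamma_integral_scale (R : realType) (s x : R) : 0 < x ->
  gamma_integral s = (\int[lebesgue_measure]_(w in `]0%R, +oo[)
    ((x * w) `^ (s - 1) * expR (- (x * w)) * x)%:E)%E.
Proof.
move=> x0.
have im : `]0, +oo[%classic = (fun w : R => x * w) @` `]0, +oo[%classic.
  apply/seteqP; split => [u /=|_ [w /= + <-]]; rewrite !in_itv/= !andbT => u0.
    by exists (u / x); [rewrite /= in_itv/= andbT divr_gt0|rewrite mulrC divfK// gt_eqF].
  by rewrite mulr_gt0.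
apply: (ge0_substitution_incr (exhausts_oy R) im).
- by move=> w _; apply: is_derive_eq; rewrite /GRing.scale/=; ring.
- by move=> w _; exact: cst_continuous.
- by [].
- by move=> w /=; rewrite in_itv/= andbT; exact: continuous_gamma_integrand.
- by move=> w _; exact: gamma_integrand_ge0.
Qed.

(* Tonelli applied to [x^(s-1) y^(-s) exp(-x-y)] after the scaling [y = x w]. *)
Lemma gamma_integral_reflection (R : realType) (s : R) : 0 < s < 1 ->
  (gamma_integral s * gamma_integral (1 - s) = (pi / sin (pi * s))%:E)%E.
Proof.
move=> s01; have /andP[s0 s1] := s01.
have s01' : 0 < 1 - s < 1 by apply/andP; split; lra.
rewrite {1}/gamma_integral -ge0_integralZr//; last 3 first.
- by apply/measurable_EFinP; exact: measurable_gamma_integrand.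
- by move=> x _; rewrite lee_fin gamma_integrand_ge0.
- exact: gamma_integral_ge0.
transitivity (\int[lebesgue_measure]_(x in `]0%R, +oo[)
    \int[lebesgue_measure]_(w in `]0%R, +oo[)
      (w `^ (- s) * expR (- ((1 + w) * x)))%:E)%E.
  apply: eq_integral => x /set_mem/=; rewrite in_itv/= andbT => x0.
  rewrite (gamma_integral_scale _ x0) -ge0_integralZl_EFin//; last 3 first.
  - move=> w _; rewrite lee_fin mulr_ge0 ?(ltW x0)//.
    by rewrite mulr_ge0 ?powR_ge0 ?expR_ge0.
  - apply/measurable_EFinP/measurable_funTS/measurable_funM => //.
    have mx : measurable_fun setT (fun w : R => x * w) by exact: mulrl_measurable.
    apply: measurable_funM.
      by apply: (measurableT_comp (measurable_powR _) mx).
    apply: (measurableT_comp (@measurable_expR R)).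
    exact: (measurableT_comp (@oppr_measurable R setT) mx).
  - exact: gamma_integrand_ge0.
  apply: eq_integral => w /set_mem/=; rewrite in_itv/= andbT => w0.
  rewrite -EFinM; congr EFin.
  have -> : 1 - s - 1 = - s by ring.
  rewrite powRM ?(ltW x0) ?(ltW w0)// powRB1// powRN.
  have -> : - ((1 + w) * x) = - x + - (x * w) by ring.
  rewrite expRD; have xs : x `^ s != 0 by rewrite gt_eqF// powR_gt0.
  by field; rewrite xs gt_eqF.
rewrite (@tonelli_set _ _ _ (fun x w => w `^ (- s) * expR (- ((1 + w) * x))))//; last first.
- by move=> x w; rewrite mulr_ge0 ?powR_ge0 ?expR_ge0.
- apply: measurable_funM.
    exact: (measurableT_comp (measurable_powR (- s)) measurable_snd).
  apply: (measurableT_comp (@measurable_expR R)).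
  apply: measurableT_comp; first exact: oppr_measurable.
  apply: measurable_funM; last exact: measurable_fst.
  by apply: measurable_funD => //; exact: measurable_snd.
(* Integrating out x leaves w^(-s) / (1 + w), which is [integral_powR_div1D] at 1 - s. *)
have -> : pi / sin (pi * s) = pi / sin (pi * (1 - s)) by rewrite sin_pi_onem.
rewrite -integral_powR_div1D//.
apply: eq_integral => w /set_mem/=; rewrite in_itv/= andbT => w0.
have h : 0 < 1 + w by rewrite addr_gt0.
under eq_integral do rewrite EFinM.
rewrite ge0_integralZl_EFin ?powR_ge0//.
- rewrite integral_expRN// -EFinM; congr EFin; congr (_ `^ _ / _); ring.
- apply/measurable_EFinP/measurable_funTS/(measurableT_comp (@measurable_expR R)).
  apply: (measurableT_comp (@oppr_measurable R setT)).
  exact: mulrl_measurable.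
Qed.

(** Read off from the reflection product: two nonnegative extended reals with a finite positive
    product are both finite and nonzero, as 0 times +oo is 0. *)
Lemma gamma_integral_fin (R : realType) (s : R) : 0 < s < 1 ->
  [/\ gamma_integral s \is a fin_num, gamma_integral (1 - s) \is a fin_num,
    Gamma s != 0 & Gamma (1 - s) != 0].
Proof.
move=> s01; have := gamma_integral_reflection s01.
have s0 := sin_pi_gt0 s01; have pi0 := pi_gt0 R.
have : 0 < pi / sin (pi * s) by rewrite divr_gt0.
move: (pi / _) => c c0; rewrite !Gamma_fine.
have := gamma_integral_ge0 s; have := gamma_integral_ge0 (1 - s).
case: (gamma_integral s) => [x||]//; case: (gamma_integral (1 - s)) => [y||]//=;
  rewrite ?lee_fin => y0 x0 E.
- have E' : x * y = c by case: E.
  split => //; apply: contraTneq c0 => h; rewrite -E' h ?mul0r ?mulr0 ltxx //.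
- exfalso; move: x0; rewrite le_eqVlt => /predU1P[x0|x0].
    by move: E c0; rewrite -x0 mul0e => -[->]; rewrite ltxx.
  by move: E; rewrite gt0_muley// lte_fin.
- exfalso; move: y0; rewrite le_eqVlt => /predU1P[y0|y0].
    by move: E c0; rewrite -y0 mule0 => -[->]; rewrite ltxx.
  by move: E; rewrite gt0_mulye// lte_fin.
Qed.

Lemma Gamma_reflection (R : realType) (s : R) : 0 < s < 1 ->
  Gamma s * Gamma (1 - s) = pi / sin (pi * s).
Proof.
move=> s01; have [f1 f2 _ _] := gamma_integral_fin s01.
by rewrite !Gamma_fine -fineM// gamma_integral_reflection.
Qed.

(** From ln z <= z at z = x/(2p): the scale 2p makes p z equal x/2, which spends half of the
    exponential decay. *)
Lemma powR_expRN_bound (R : realType) (p x : R) : 0 < p -> 0 < x ->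
  x `^ p * expR (- x) <= (2 * p) `^ p * expR (- (2^-1 * x)).
Proof.
move=> p0 x0; have pp : 0 < 2 * p by rewrite mulr_gt0.
rewrite /powR !gt_eqF// -!expRD ler_expR.
have h : ln (x / (2 * p)) <= x / (2 * p) by apply/ltW/ln_sublinear; rewrite divr_gt0.
move: h; rewrite ln_div ?posrE// => h.
have : p * (ln x - ln (2 * p)) <= p * (x / (2 * p)) by rewrite ler_pM2l.
have -> : p * (x / (2 * p)) = x / 2 by field; rewrite gt_eqF.
lra.
Qed.

Lemma integrable_gamma1 (R : realType) (p : R) : 0 < p ->
  lebesgue_measure.-integrable `]0, +oo[
    (EFin \o (fun x : R => x `^ p * expR (- x))).
Proof.
move=> p0; apply: (@le_integrable_R _ _ _ (fun x => (2 * p) `^ p * expR (- (2^-1 * x)))) => //.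
- by have := measurable_gamma_integrand (p + 1) (D := `]0, +oo[%classic); rewrite addrK.
- move=> x /=; rewrite in_itv/= andbT => x0.
  by rewrite ger0_norm ?mulr_ge0 ?powR_ge0 ?expR_ge0// powR_expRN_bound.
- apply: integrable_Z => //; apply: (@ge0_integrable _ _ _ (2^-1)^-1) => //.
  + apply/measurable_funTS/(measurableT_comp (@measurable_expR R)).
    apply: (measurableT_comp (@oppr_measurable R setT)).
    exact: mulrl_measurable.
  + by rewrite integral_expRN// invr_gt0.
Qed.

Lemma gamma_integral_fin1 (R : realType) (p : R) : 0 < p ->
  gamma_integral (p + 1) \is a fin_num.
Proof.
move=> p0; apply: integrable_fin_num => //.
by have := integrable_gamma1 p0; apply: eq_integrable => // x _; rewrite /= addrK.
Qed.

(** Integrates the derivative of x^p exp(-x), which tends to 0 at both ends. *)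
Lemma Gamma_succ (R : realType) (p : R) : 0 < p -> gamma_integral p \is a fin_num ->
  Gamma (p + 1) = p * Gamma p.
Proof.
move=> p0 pfin.
have i1 := integrable_gamma1 p0.
have i0 : lebesgue_measure.-integrable `]0, +oo[
    (EFin \o (fun x : R => x `^ (p - 1) * expR (- x))).
  apply: (@ge0_integrable _ _ _ (fine (gamma_integral p))) => //.
  - exact: measurable_gamma_integrand.
  - by move=> x _; exact: gamma_integrand_ge0.
  - by rewrite fineK.
have my : measurable (`]0, +oo[%classic : set R) by [].
have cn0 : (n.+2%:R `^ p * expR (- n.+2%:R) : R) @[n --> \oo] --> (0 : R).
  apply: (@squeeze_cvgr _ _ _ _ (cst 0) (fun n => (2 * p) `^ p * expR (- (2^-1 * n.+2%:R)))).
  - apply: nearW => n; rewrite mulr_ge0 ?powR_ge0 ?expR_ge0//=.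
    exact: powR_expRN_bound.
  - exact: cvg_cst.
  - have -> : nbhs (0 : R) = nbhs ((2 * p) `^ p * 0) by rewrite mulr0.
    by apply: cvgM; [exact: cvg_cst|apply: cvg_expRN2; rewrite invr_gt0].
have cn1 : (n.+2%:R^-1 `^ p * expR (- n.+2%:R^-1) : R) @[n --> \oo] --> (0 : R).
  have -> : nbhs (0 : R) = nbhs (0 * expR (- (1 * 0)) : R) by rewrite mul0r.
  apply: cvgM.
    move/cvg_at_rightP : (powR_cvg0 p0); apply; split => [n|]; first by rewrite invr_gt0.
    exact: cvg_inv2.
  have c0 := is_derive_continuous (is_derive_expRN 1 (0 : R)).
  have -> : (fun n => expR (- n.+2%:R^-1 : R)) =
      (fun x : R => expR (- (1 * x))) \o (fun n => n.+2%:R^-1).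
    by apply/funext => n /=; rewrite mul1r.
  exact: cvg_comp _ _ (@cvg_inv2 R) c0.
have : \int[lebesgue_measure]_(x in `]0, +oo[)
    (p * (x `^ (p - 1) * expR (- x)) + -1 * (x `^ p * expR (- x))) = 0 - 0.
  apply: (improper_FTC (exhausts_oy R) (F := fun x : R => x `^ p * expR (- x))).
  - move=> x /=; rewrite in_itv/= andbT => x0; apply: continuousD.
      by apply: continuousM; [exact: cst_continuous|exact: continuous_gamma_integrand].
    apply: continuousM; first exact: cst_continuous.
    by have := @continuous_gamma_integrand R (p + 1) x x0; rewrite addrK.
  - exact: integrable_ZDZ.
  - move=> x /=; rewrite in_itv/= andbT => x0.
    have d1 := is_derive1_powR p x0.
    have d2 := is_derive_expRN 1 x; rewrite mul1r in d2.
    have d3 : is_derive x 1 (fun x : R => expR (- x)) (- expR (- x)).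
      apply: is_derive_eq; rewrite /GRing.scale/=; ring.
    by apply: is_derive_eq; rewrite /GRing.scale/=; ring.
  - exact: cvgB.
rewrite (Rintegral_ZDZ _ _ my i0 i1) subrr mulN1r => /subr0_eq E.
rewrite !Gamma_fine; symmetry; rewrite /gamma_integral addrK; exact: E.
Qed.

Lemma gamma_integral1 (R : realType) : gamma_integral (1 : R) = 1%:E.
Proof.
rewrite -[X in _ = X%:E]invr1 -(integral_expRN (@ltr01 R)) /gamma_integral subrr.
by apply: eq_integral => x _; rewrite powRr0 !mul1r.
Qed.

Lemma Gamma_rising (R : realType) (p : R) (n : nat) : 0 < p ->
  gamma_integral p \is a fin_num ->
  Gamma (n%:R + p) = (\prod_(i < n) (p + i%:R)) * Gamma p.
Proof.
move=> p0 pfin; elim: n => [|n IHn]; first by rewrite big_ord0 mul1r add0r.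
have np0 : 0 < n%:R + p by rewrite ltr_wpDl.
have -> : n.+1%:R + p = (n%:R + p) + 1 by rewrite -natr1; ring.
rewrite Gamma_succ; [|exact: np0|]; last first.
  case: n {IHn} np0 => [|n] _; first by rewrite add0r.
  have -> : n.+1%:R + p = (n%:R + p) + 1 by rewrite -natr1; ring.
  by apply: gamma_integral_fin1; rewrite ltr_wpDl.
by rewrite IHn big_ord_recr/=; ring.
Qed.

Lemma Gamma_fact (R : realType) (n : nat) : Gamma (n%:R + 1 : R) = n`!%:R.
Proof.
rewrite Gamma_rising ?gamma_integral1// Gamma_fine gamma_integral1 mulr1.
elim: n => [|n IHn]; first by rewrite big_ord0.
by rewrite big_ord_recr/= IHn factS natrM mulrC addrC natr1.
Qed.

(** * Euler integrals and the moments *)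

Lemma integral_onem01 (R : realType) (f : R -> R) :
  (forall x, 0 < x < 1 -> {for x, continuous f}) ->
  (forall x, 0 < x < 1 -> 0 <= f x) ->
  (\int[lebesgue_measure]_(x in `]0%R, 1%R[) (f x)%:E =
   \int[lebesgue_measure]_(x in `]0%R, 1%R[) (f (1 - x))%:E)%E.
Proof.
move=> cf f0.
have im : `]0, 1[%classic = (fun u : R => 1 - u) @` `]0, 1[%classic.
  apply/seteqP; split => [u /=|_ [w /= + <-]]; rewrite !in_itv/= => /andP[u0 u1].
    exists (1 - u); last by ring.
    by rewrite /= in_itv/=; apply/andP; split; lra.
  by apply/andP; split; lra.
have d (u : R) : `]0, 1[%classic u -> is_derive u 1 (fun u : R => 1 - u) (-1).
  by move=> _; apply: is_derive_eq; rewrite /GRing.scale/=; ring.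
have cd (u : R) : `]0, 1[%classic u -> {for u, continuous (fun _ : R => -1 : R)}.
  by move=> _; exact: cst_continuous.
have d0 (u : R) : `]0, 1[%classic u -> -1 < 0 :> R by rewrite ltrN10.
have cf' (u : R) : `]0, 1[%classic u -> {for u, continuous f}.
  by rewrite /= in_itv/=; exact: cf.
have f0' (u : R) : `]0, 1[%classic u -> 0 <= f u.
  by rewrite /= in_itv/=; exact: f0.
rewrite (ge0_substitution_decr (exhausts_oo ltr01) im d cd d0 cf' f0').
by apply: eq_integral => u _; rewrite opprK mulr1.
Qed.

Lemma integrable_powR_onem01 (R : realType) (p : R) : 0 < p ->
  lebesgue_measure.-integrable `]0, 1[ (EFin \o (fun x : R => (1 - x) `^ (p - 1))).
Proof.
move=> p0; apply: (@ge0_integrable _ _ _ p^-1) => //.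
- apply: (exhausts_measurable_fun (exhausts_oo (@ltr01 R))) => x /=.
  rewrite in_itv/= => /andP[_ x1].
  by apply: continuous_powR_comp; [rewrite subr_gt0|exact: continuous_onem].
- by move=> x _; exact: powR_ge0.
- rewrite -(integral_powR01 p0) integral_onem01.
  + by apply: eq_integral => x _; have -> : 1 - (1 - x) = x by ring.
  + move=> x /andP[_ x1].
    by apply: continuous_powR_comp; [rewrite subr_gt0|exact: continuous_onem].
  + by move=> x _; exact: powR_ge0.
Qed.

Lemma is_derive_powR_comp (R : realType) (f : R -> R) (x df p : R) :
  is_derive x 1 f df -> 0 < f x -> is_derive x 1 (fun y => f y `^ p) (p * f x `^ (p - 1) * df).
Proof.
move=> dfx fx0; have dp := is_derive1_powR p fx0.
exact: (@is_derive1_comp _ (fun y : R => y `^ p) f x _ _ dp dfx).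
Qed.

Definition beta_integrand (R : realType) (s r u : R) : R :=
  u `^ (s - 1) * (1 - u) `^ r.

Lemma beta_integrand_ge0 (R : realType) (s r u : R) : 0 <= beta_integrand s r u.
Proof. by rewrite mulr_ge0// powR_ge0. Qed.

Lemma continuous_beta_integrand (R : realType) (s r u : R) : 0 < u < 1 ->
  {for u, continuous (beta_integrand s r)}.
Proof.
move=> /andP[u0 u1]; apply: continuousM; first exact: continuous_powR.
by apply: continuous_powR_comp; [rewrite subr_gt0|exact: continuous_onem].
Qed.

Lemma measurable_fun01 (R : realType) (f : R -> R) :
  (forall x, 0 < x < 1 -> {for x, continuous f}) ->
  measurable_fun (`]0, 1[%classic : set R) f.
Proof.
move=> cf; apply: (exhausts_measurable_fun (exhausts_oo (@ltr01 R))) => x /=.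
by rewrite in_itv/=; exact: cf.
Qed.

(** On each half of ]0, 1[ one factor has base at least 1/2 and exponent above -1, hence is at most
    2; the other factor is an integrable power. *)
Lemma integrable_beta (R : realType) (s r : R) : 0 < s -> -1 < r ->
  lebesgue_measure.-integrable `]0, 1[ (EFin \o (beta_integrand s r)).
Proof.
move=> s0 r1; have r0 : 0 < r + 1 by rewrite -ltrBlDr sub0r.
apply: (@le_integrable_R _ _ _
  (fun u : R => 2 * u `^ (s - 1) + 2 * (1 - u) `^ ((r + 1) - 1))) => //.
- by apply: measurable_fun01 => u; exact: continuous_beta_integrand.
- move=> u /=; rewrite in_itv/= => /andP[u0 u1]; rewrite addrK.
  have u1' : 0 < 1 - u by rewrite subr_gt0.
  have bnd (x p : R) : 2^-1 <= x -> x < 1 -> -1 < p -> x `^ p <= 2.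
    move=> x2 x1 p1; have x0 : 0 < x by apply: lt_le_trans x2; rewrite invr_gt0.
    have -> : p = (p + 1) - 1 by ring.
    rewrite powRB1// ler_pdivrMr//; apply: (@le_trans _ _ 1); last by lra.
    by rewrite -[leRHS](powRr0 x) ger_powR ?x0 ?(ltW x1)//; lra.
  rewrite ger0_norm ?beta_integrand_ge0// /beta_integrand.
  have p1 := powR_ge0 u (s - 1); have p2 := powR_ge0 (1 - u) r.
  have [u2|u2] := leP u 2^-1.
    have h := bnd (1 - u) r; apply: (@le_trans _ _ (2 * u `^ (s - 1))).
      by rewrite mulrC ler_wpM2r// h//; lra.
    by rewrite lerDl mulr_ge0.
  have h := bnd u (s - 1); apply: (@le_trans _ _ (2 * (1 - u) `^ r)).
    by rewrite ler_wpM2r// h//; lra.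
  by rewrite lerDr mulr_ge0.
- by apply: integrable_ZDZ => //; [exact: integrable_powR01|exact: integrable_powR_onem01].
Qed.

Lemma integrable_beta_mul (R : realType) (s r M : R) (h : R -> R) : 0 < s -> -1 < r ->
  (forall u, 0 < u < 1 -> {for u, continuous h}) ->
  (forall u, 0 < u < 1 -> `|h u| <= M) ->
  lebesgue_measure.-integrable `]0, 1[ (EFin \o (fun u => beta_integrand s r u * h u)).
Proof.
move=> s0 r1 ch hM.
apply: (@le_integrable_R _ _ _ (fun u => M * beta_integrand s r u)) => //.
- apply: measurable_fun01 => u u01.
  by apply: continuousM; [exact: continuous_beta_integrand|exact: ch].
- move=> u /=; rewrite in_itv/= => u01.
  rewrite normrM (ger0_norm (beta_integrand_ge0 _ _ _)) mulrC.
  by rewrite ler_wpM2r ?beta_integrand_ge0// hM.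
- by apply: integrable_Z => //; exact: integrable_beta.
Qed.

(** Euler's integral for B(s, r + 1) 2F1(- c, r + 1; s + r + 1; 1 - tau). Both halves of a moment
    take this form on ]0, 1[, so the limits of integration no longer depend on t and differentiation
    under the integral applies. *)
Definition euler_int (R : realType) (s r c tau : R) : R :=
  \int[lebesgue_measure]_(u in `]0, 1[)
    (beta_integrand s r u * (tau + (1 - tau) * u) `^ c).

Lemma segment_bounds (R : realType) (tau u : R) : 0 < tau < 1 -> 0 < u < 1 ->
  [/\ tau <= tau + (1 - tau) * u, tau + (1 - tau) * u < 1,
     u <= tau + (1 - tau) * u & 0 < tau + (1 - tau) * u].
Proof. by move=> /andP[t0 t1] /andP[u0 u1]; split; nra. Qed.

(** The sum covers both signs of c: the power is at most 1 for c >= 0 and at most tau^c for c <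
    0. *)
Lemma powR_segment_bound (R : realType) (tau q c : R) : 0 < tau -> tau <= q -> q < 1 ->
  q `^ c <= 1 + tau `^ c.
Proof.
move=> t0 tq q1; have q0 : 0 < q by exact: lt_le_trans tq.
have [c0|c0] := leP 0 c.
  apply: (@le_trans _ _ 1); last by rewrite lerDl powR_ge0.
  by rewrite -(powRr0 q) ger_powR// q0 ltW.
apply: (@le_trans _ _ (tau `^ c)); last by rewrite lerDr.
have -> : c = - (- c) by rewrite opprK.
rewrite !(powRN _ (- c)) lef_pV2 ?posrE ?powR_gt0//.
by apply: ge0_ler_powR => //; rewrite ?nnegrE ?oppr_ge0 ltW.
Qed.

Lemma continuous_segment (R : realType) (tau u : R) :
  {for u, continuous (fun u : R => tau + (1 - tau) * u)}.
Proof.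
apply: continuousD; first exact: cst_continuous.
by apply: continuousM; [exact: cst_continuous|exact: cvg_id].
Qed.

Lemma continuous_powR_segment (R : realType) (c tau u : R) : 0 < tau < 1 -> 0 < u < 1 ->
  {for u, continuous (fun u : R => (tau + (1 - tau) * u) `^ c)}.
Proof.
move=> t01 u01; have [_ _ _ q0] := segment_bounds t01 u01.
by apply: continuous_powR_comp; [|exact: continuous_segment].
Qed.

Lemma integrable_euler (R : realType) (s r c tau : R) : 0 < s -> -1 < r ->
  0 < tau < 1 -> lebesgue_measure.-integrable `]0, 1[
    (EFin \o (fun u => beta_integrand s r u * (tau + (1 - tau) * u) `^ c)).
Proof.
move=> s0 r1 t01; have /andP[t0 t1] := t01.
apply: (@integrable_beta_mul _ _ _ (1 + tau `^ c)) => // u u01.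
  exact: continuous_powR_segment.
have [h1 h2 _ _] := segment_bounds t01 u01.
by rewrite ger0_norm ?powR_ge0// powR_segment_bound.
Qed.

Lemma powR_onem_cvg0 (R : realType) (p : R) : 0 < p ->
  (1 - u) `^ p @[u --> (1 : R)^'-] --> (0 : R).
Proof.
move=> p0; apply/cvg_at_leftP => u_ [u1 ucvg].
move/cvg_at_rightP : (powR_cvg0 p0); apply; split => [n|]; first by rewrite subr_gt0.
have -> : nbhs (0 : R) = nbhs (1 - 1 : R) by rewrite subrr.
by apply: cvgB => //; exact: cvg_cst.
Qed.

(** With q = tau + (1 - tau) u, the integrand is the derivative of u^s (1-u)^(r+1) q^(c+1), which
    vanishes at both ends. Expanding the polynomial factor in powers of q or of 1 - u yields the two
    contiguous relations below. *)
Lemma euler_parts (R : realType) (s r c tau : R) : 0 < s -> -1 < r -> 0 < tau < 1 ->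
  \int[lebesgue_measure]_(u in `]0, 1[)
    (beta_integrand s r u * ((tau + (1 - tau) * u) `^ c *
      (s * (1 - u) * (tau + (1 - tau) * u) - (r + 1) * u * (tau + (1 - tau) * u) +
       (c + 1) * (1 - tau) * u * (1 - u)))) = 0.
Proof.
move=> s0 r1 t01; have /andP[t0 t1] := t01.
have r0 : 0 < r + 1 by rewrite -ltrBlDr sub0r.
pose q (u : R) := tau + (1 - tau) * u.
pose P (u : R) := s * (1 - u) * q u - (r + 1) * u * q u + (c + 1) * (1 - tau) * u * (1 - u).
pose F (u : R) := u `^ s * (1 - u) `^ (r + 1) * q u `^ (c + 1).
have cq (u : R) : {for u, continuous q} by exact: continuous_segment.
have cP (u : R) : {for u, continuous P}.
  have cM (k : R) (f : R -> R) : {for u, continuous f} ->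
      {for u, continuous (fun u => k * f u)}.
    by move=> cf; apply: continuousM => //; exact: cst_continuous.
  have c1 := @continuous_onem R u; have cid : {for u, continuous (@id R)} by exact: cvg_id.
  apply: continuousD; first apply: continuousB.
  - by apply: continuousM; [exact: (cM s _ c1)|exact: cq].
  - by apply: continuousM; [exact: (cM (r + 1) _ cid)|exact: cq].
  - by apply: continuousM; [exact: (cM _ _ cid)|exact: c1].
have q1 (u : R) : 0 < u < 1 -> 0 < q u < 1.
  by move=> u01; have [_ h2 _ h4] := segment_bounds t01 u01; rewrite h4.
have Pb (u : R) : 0 < u < 1 -> `|P u| <= s + (r + 1) + `|c + 1|.
  move=> u01; have /andP[q0 q1'] := q1 _ u01; have /andP[u0 u1] := u01.
  have b1 : 0 <= (1 - u) * q u <= 1 by nra.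
  have b2 : 0 <= u * q u <= 1 by nra.
  have b3 : 0 <= (1 - tau) * u * (1 - u) <= 1.
    have : 0 <= u * (1 - u) <= 1 by nra.
    move=> /andP[x1 x2]; rewrite -mulrA; apply/andP; split; first by rewrite mulr_ge0//; lra.
    by rewrite -[leRHS]mulr1 ler_pM//; lra.
  rewrite /P; apply: (le_trans (ler_normD _ _)); apply: lerD.
    apply: (le_trans (ler_normB _ _)); rewrite -!mulrA; apply: lerD.
      move/andP: b1 => [x1 x2].
      by rewrite normrM (gtr0_norm s0) (ger0_norm x1) ler_piMr// ltW.
    move/andP: b2 => [x1 x2].
    by rewrite normrM (gtr0_norm r0) (ger0_norm x1) ler_piMr// ltW.
  move/andP: b3 => [x1 x2].
  have -> : (c + 1) * (1 - tau) * u * (1 - u) = (c + 1) * ((1 - tau) * u * (1 - u)) by ring.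
  by rewrite normrM (ger0_norm x1) ler_piMr.
rewrite -[RHS](subrr (0 : R)).
apply: (improper_FTC (exhausts_oo ltr01) (F := F)).
- move=> u /=; rewrite in_itv/= => u01.
  apply: continuousM; first exact: continuous_beta_integrand.
  by apply: continuousM; [exact: continuous_powR_segment|exact: cP].
- apply: (@integrable_beta_mul _ _ _ ((1 + tau `^ c) * (s + (r + 1) + `|c + 1|))) => //.
    move=> u u01.
    by apply: continuousM; [exact: continuous_powR_segment|exact: cP].
  move=> u u01; rewrite normrM ler_pM//; last exact: Pb.
  have [h1 h2 _ _] := segment_bounds t01 u01.
  by rewrite ger0_norm ?powR_ge0// powR_segment_bound.
- move=> u /=; rewrite in_itv/= => u01.
  have /andP[q0 q1'] := q1 _ u01; have /andP[u0 u1] := u01.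
  have u1' : 0 < 1 - u by rewrite subr_gt0.
  have d1 := is_derive1_powR s u0.
  have dq : is_derive u 1 q (1 - tau).
    by rewrite /q; apply: is_derive_eq; rewrite /GRing.scale/=; ring.
  have dn : is_derive u 1 (fun u : R => 1 - u) (-1).
    by apply: is_derive_eq; rewrite /GRing.scale/=; ring.
  have d2 : is_derive u 1 (fun u : R => (1 - u) `^ (r + 1)) ((r + 1) * (1 - u) `^ r * -1).
    by have := is_derive_powR_comp (r + 1) dn u1'; rewrite addrK.
  have d3 : is_derive u 1 (fun u : R => q u `^ (c + 1)) ((c + 1) * q u `^ c * (1 - tau)).
    by have := is_derive_powR_comp (c + 1) dq q0; rewrite addrK.
  rewrite /F; apply: is_derive_eq; rewrite /GRing.scale/= /beta_integrand -/(q u).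
  have -> : u `^ s = u `^ (s - 1) * u by rewrite powRB1// divfK// gt_eqF.
  rewrite !(powRDpos _ _ u1') !(powRDpos _ _ q0) !powRr1 ?(ltW u1') ?(ltW q0)//.
  by ring.
- have c1 (x p : R) : x < 1 -> {for x, continuous (fun x : R => (1 - x) `^ p)}.
    move=> x1; apply: continuous_powR_comp; last exact: continuous_onem.
    by rewrite subr_gt0.
  have c2 (x p : R) : 0 < q x -> {for x, continuous (fun x : R => q x `^ p)}.
    by move=> qx; apply: continuous_powR_comp => //; exact: cq.
  have q00 : 0 < q 0 by rewrite /q mulr0 addr0.
  have q10 : 0 < q 1 by rewrite /q; lra.
  apply: (@cvg_exhausts_oo _ F) => //.
    have -> : nbhs (0 : R) = nbhs (0 * (1 - 0) `^ (r + 1) * q 0 `^ (c + 1) : R).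
      by rewrite !mul0r.
    apply: cvgM; last exact: cvg_at_right_filter (c2 0 (c + 1) q00).
    by apply: cvgM; [exact: powR_cvg0|exact: cvg_at_right_filter (c1 0 (r + 1) ltr01)].
  have -> : nbhs (0 : R) = nbhs (1 `^ s * 0 * q 1 `^ (c + 1) : R).
    by rewrite mulr0 mul0r.
  apply: cvgM; last exact: cvg_at_left_filter (c2 1 (c + 1) q10).
  apply: cvgM; last exact: powR_onem_cvg0.
  by apply: cvg_at_left_filter; exact: continuous_powR.
Qed.

(** Differentiation under the integral gives c q^(c-1) (1 - u) with q = tau + (1 - tau) u, and 1 - u
    = (1 - q)/(1 - tau) returns it to Euler integrals. *)
Lemma is_derive_euler (R : realType) (s r c tau : R) : 0 < s -> -1 < r -> 0 < tau < 1 ->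
  is_derive tau 1 (euler_int s r c)
    (c * (euler_int s r (c - 1) tau - euler_int s r c tau) / (1 - tau)).
Proof.
move=> s0 r1 t01; have /andP[t0 t1] := t01.
have m01 : measurable (`]0, 1[%classic : set (measurableTypeR R)) by [].
pose f (t u : R) := beta_integrand s r u * (t + (1 - t) * u) `^ c.
have sub (t : R) : `]tau / 2, 1[%classic t -> 0 < t < 1.
  by rewrite /= in_itv/= => /andP[h1 h2]; rewrite h2 andbT; lra.
have df (t u : R) : 0 < t < 1 -> 0 < u < 1 -> is_derive t 1 (f ^~ u)
    (beta_integrand s r u * (c * (t + (1 - t) * u) `^ (c - 1) * (1 - u))).
  move=> t01' u01; have [_ _ _ q0] := segment_bounds t01' u01.
  have dq : is_derive t 1 (fun t : R => t + (1 - t) * u) (1 - u).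
    by apply: is_derive_eq; rewrite /GRing.scale/=; ring.
  have d := is_derive_powR_comp c dq q0.
  by rewrite /f; apply: is_derive_eq; rewrite /GRing.scale/=; ring.
have Itau : (`]tau / 2, 1[%classic : set R) tau by rewrite /= in_itv/= t1 andbT; lra.
have intf (t : R) : `]tau / 2, 1[%classic t -> lebesgue_measure.-integrable `]0, 1[ (EFin \o f t).
  by move=> /sub t01'; exact: integrable_euler.
have derf (t u : R) : `]tau / 2, 1[%classic t -> `]0, 1[%classic u -> derivable (f ^~ u) t 1.
  by move=> /sub t01'; rewrite /= in_itv/= => u01; have [] := df t u t01' u01.
(* For t in ]tau/2, 1[ the base stays above tau/2, which gives a dominating function independent of
   t. *)
pose G (u : R) := `|c| * (1 + (tau / 2) `^ (c - 1)) * beta_integrand s r u.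
have G0 (u : R) : 0 <= G u.
  by rewrite mulr_ge0 ?beta_integrand_ge0// mulr_ge0// addr_ge0// powR_ge0.
have intG : lebesgue_measure.-integrable `]0, 1[ (EFin \o G).
  by apply: integrable_Z => //; exact: integrable_beta.
have Gub (t u : R) : `]tau / 2, 1[%classic t -> `]0, 1[%classic u -> `|partial1of2 f t u| <= G u.
  move=> tI; have t01' := sub _ tI; rewrite /= in_itv/= => u01.
  rewrite partial1of2E; have [_ ->] := df t u t01' u01.
  have [h1 h2 _ q0] := segment_bounds t01' u01.
  rewrite normrM (ger0_norm (beta_integrand_ge0 _ _ _)) mulrC /G.
  rewrite ler_wpM2r ?beta_integrand_ge0// !normrM.
  have /andP[u0 u1] := u01.
  rewrite -[leRHS]mulr1 ler_pM ?mulr_ge0//; last by rewrite ger0_norm; lra.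
  rewrite ler_wpM2l// ger0_norm ?powR_ge0//; apply: powR_segment_bound => //.
    by rewrite divr_gt0.
  by apply: le_trans h1; move: tI; rewrite /= in_itv/= => /andP[/ltW].
have E := differentiation_under_integral m01 Itau intf derf G0 intG Gub.
have D := derivable_under_integral m01 Itau intf derf G0 intG Gub.
apply: DeriveDef => //; rewrite -derive1E E.
have i1 := integrable_euler (c - 1) s0 r1 t01.
have i2 := integrable_euler c s0 r1 t01.
transitivity (\int[lebesgue_measure]_(u in `]0, 1[)
   (c / (1 - tau) * (beta_integrand s r u * (tau + (1 - tau) * u) `^ (c - 1)) +
    - (c / (1 - tau)) * (beta_integrand s r u * (tau + (1 - tau) * u) `^ c))); last first.
  rewrite Rintegral_ZDZ// -/(euler_int s r (c - 1) tau) -/(euler_int s r c tau).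
  by move: (euler_int _ _ _ _) (euler_int _ _ _ _) => A B; field; rewrite gt_eqF// subr_gt0.
apply: eq_Rintegral => u /set_mem/=; rewrite in_itv/= => u01.
rewrite /= partial1of2E; have [_ ->] := df tau u t01 u01.
have [_ _ _ q0] := segment_bounds t01 u01.
have -> : (tau + (1 - tau) * u) `^ c =
    (tau + (1 - tau) * u) `^ (c - 1) * (tau + (1 - tau) * u).
  by rewrite powRB1// divfK// gt_eqF.
by field; rewrite gt_eqF// subr_gt0.
Qed.

Lemma Rintegral_comb3 (R : realType) (k1 k2 k3 : R) (f1 f2 f3 : R -> R) :
  lebesgue_measure.-integrable `]0, 1[ (EFin \o f1) ->
  lebesgue_measure.-integrable `]0, 1[ (EFin \o f2) ->
  lebesgue_measure.-integrable `]0, 1[ (EFin \o f3) ->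
  \int[lebesgue_measure]_(u in `]0, 1[) (k1 * f1 u + k2 * f2 u + k3 * f3 u) =
  k1 * \int[lebesgue_measure]_(u in `]0, 1[) f1 u +
  k2 * \int[lebesgue_measure]_(u in `]0, 1[) f2 u +
  k3 * \int[lebesgue_measure]_(u in `]0, 1[) f3 u.
Proof.
move=> i1 i2 i3; have m01 : measurable (`]0, 1[%classic : set R) by [].
have := Rintegral_ZDZ 1 k3 m01 (integrable_ZDZ k1 k2 m01 i1 i2) i3.
rewrite (Rintegral_ZDZ k1 k2 m01 i1 i2) mul1r => <-.
by apply: eq_Rintegral => u _; rewrite mul1r.
Qed.

(** Substituting u = (q - tau)/(1 - tau) makes the polynomial factor of [euler_parts] at c - 1 a
    quadratic in q, whose three terms are the three neighbours in c. *)
Lemma euler_contiguous (R : realType) (s r c tau : R) : 0 < s -> -1 < r -> 0 < tau < 1 ->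
  (c + 1 + s + r) * euler_int s r (c + 1) tau =
  (s + c + (r + 1 + c) * tau) * euler_int s r c tau -
  c * tau * euler_int s r (c - 1) tau.
Proof.
move=> s0 r1 t01; have /andP[t0 t1] := t01.
have := euler_parts (c - 1) s0 r1 t01.
have i0 := integrable_euler (c - 1) s0 r1 t01.
have i1 := integrable_euler c s0 r1 t01.
have i2 := integrable_euler (c + 1) s0 r1 t01.
move=> E.
have t1' : 1 - tau != 0 by rewrite gt_eqF// subr_gt0.
have := Rintegral_comb3 (- (c + 1 + s + r) / (1 - tau))
  ((s + c + (r + 1 + c) * tau) / (1 - tau)) (- (c * tau) / (1 - tau)) i2 i1 i0.
rewrite -/(euler_int s r (c + 1) tau) -/(euler_int s r c tau) -/(euler_int s r (c - 1) tau).
have -> : \int[lebesgue_measure]_(u in `]0, 1[)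
  (- (c + 1 + s + r) / (1 - tau) * (beta_integrand s r u * (tau + (1 - tau) * u) `^ (c + 1)) +
   (s + c + (r + 1 + c) * tau) / (1 - tau) * (beta_integrand s r u * (tau + (1 - tau) * u) `^ c) +
   - (c * tau) / (1 - tau) * (beta_integrand s r u * (tau + (1 - tau) * u) `^ (c - 1))) = 0.
  rewrite -[RHS]E; apply: eq_Rintegral => u /set_mem/=; rewrite in_itv/= => u01.
  have [_ _ _ q0] := segment_bounds t01 u01; rewrite subrK.
  have -> : u = ((tau + (1 - tau) * u) - tau) / (1 - tau) by field.
  have E0 : tau + (1 - tau) * (((tau + (1 - tau) * u) - tau) / (1 - tau)) =
    tau + (1 - tau) * u by field.
  rewrite E0; move: (tau + (1 - tau) * u) q0 => q q0.
  have -> : q `^ (c + 1) = q `^ (c - 1) * q ^+ 2.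
    by rewrite -powRDn//; congr (_ `^ _); ring.
  have -> : q `^ c = q `^ (c - 1) * q by rewrite powRB1// divfK// gt_eqF.
  by field.
move: (euler_int _ _ _ _) (euler_int _ _ _ _) (euler_int _ _ _ _) => A B C H.
apply: (mulfI (invr_neq0 t1')); apply: subr0_eq; rewrite -[RHS]oppr0 [in RHS]H.
by field.
Qed.

(** The companion relation raises r at fixed c, because on the left half the order of the moment
    sits in the exponent of 1 - u. *)
Lemma euler_contiguous_onem (R : realType) (s r c t : R) : 0 < s -> -1 < r -> 0 < t < 1 ->
  (r + s + c + 2) * t * euler_int s (r + 1 + 1) c (1 - t) =
  (r + 1 + s + (r + c + 2) * t) * euler_int s (r + 1) c (1 - t) -
  (r + 1) * euler_int s r c (1 - t).
Proof.
move=> s0 r1 t01; have /andP[t0 t1] := t01.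
have t01' : 0 < 1 - t < 1 by apply/andP; split; lra.
have r2 : -1 < r + 1 by lra.
have r3 : -1 < r + 1 + 1 by lra.
have E := euler_parts c s0 r1 t01'.
have i0 := integrable_euler c s0 r1 t01'.
have i1 := integrable_euler c s0 r2 t01'.
have i2 := integrable_euler c s0 r3 t01'.
have := Rintegral_comb3 (- ((r + s + c + 2) * t))
  (r + 1 + s + (r + c + 2) * t) (- (r + 1)) i2 i1 i0.
rewrite -/(euler_int s (r + 1 + 1) c (1 - t)) -/(euler_int s (r + 1) c (1 - t)).
rewrite -/(euler_int s r c (1 - t)).
have -> : \int[lebesgue_measure]_(u in `]0, 1[)
  (- ((r + s + c + 2) * t) * (beta_integrand s (r + 1 + 1) u * (1 - t + (1 - (1 - t)) * u) `^ c) +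
   (r + 1 + s + (r + c + 2) * t) * (beta_integrand s (r + 1) u * (1 - t + (1 - (1 - t)) * u) `^ c) +
   - (r + 1) * (beta_integrand s r u * (1 - t + (1 - (1 - t)) * u) `^ c)) = 0.
  rewrite -[RHS]E; apply: eq_Rintegral => u /set_mem/=; rewrite in_itv/= => /andP[u0 u1].
  have u1' : 0 < 1 - u by rewrite subr_gt0.
  rewrite /beta_integrand !(powRDpos _ _ u1') !powRr1 ?(ltW u1')//.
  by ring.
move: (euler_int _ _ _ _) (euler_int _ _ _ _) (euler_int _ _ _ _) => A B C H.
by lra.
Qed.

(** At t = 0 the integrand becomes u^(a-1) (1-u)^(-a). It also dominates for every t, since the base
    is at least u and its exponent - b is negative. *)
Lemma euler_lim0 (R : realType) (a b : R) : 0 < a -> 0 < b -> a + b < 1 ->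
  euler_int (a + b) (- a) (- b) n.+3%:R^-1 @[n --> \oo] --> pi / sin (pi * a) /\
  forall t, 0 < t < 1 -> 0 <= euler_int (a + b) (- a) (- b) t <= pi / sin (pi * a).
Proof.
move=> a0 b0 ab1; have a01 : 0 < a < 1 by rewrite a0; lra.
have m01 : measurable (`]0, 1[%classic : set (measurableTypeR R)) by [].
pose g (u : R) := u `^ (a - 1) * (1 - u) `^ (- a).
have gE u : 0 < u -> g u = beta_integrand (a + b) (- a) u * u `^ (- b).
  move=> u0; rewrite /g /beta_integrand mulrAC -powRDpos//.
  by congr (_ `^ _ * _); ring.
have cg u : 0 < u < 1 -> {for u, continuous g}.
  move=> /andP[u0 u1]; apply: continuousM; first exact: continuous_powR.
  by apply: continuous_powR_comp; [rewrite subr_gt0|exact: continuous_onem].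
have mg := measurable_fun01 cg.
have ig : lebesgue_measure.-integrable `]0, 1[ (EFin \o g).
  apply: ge0_integrable (integral_beta_reflection a01) => //.
  by move=> u _; rewrite mulr_ge0// powR_ge0.
have Ig : \int[lebesgue_measure]_(u in `]0, 1[) g u = pi / sin (pi * a).
  by rewrite /Rintegral integral_beta_reflection.
have dom (t u : R) : 0 < t < 1 -> 0 < u < 1 ->
    0 <= beta_integrand (a + b) (- a) u * (t + (1 - t) * u) `^ (- b) <= g u.
  move=> t01 u01; have [_ _ h q0] := segment_bounds t01 u01.
  have /andP[u0 _] := u01.
  rewrite mulr_ge0 ?beta_integrand_ge0 ?powR_ge0//= gE// ler_wpM2l ?beta_integrand_ge0//.
  rewrite !powRN lef_pV2 ?posrE ?powR_gt0//.
  by apply: ge0_ler_powR => //; rewrite ?nnegrE ltW.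
have tn (n : nat) : 0 < (n.+3%:R^-1 : R) < 1 by rewrite invr_gt0 ltr0n/= invf_lt1// ltr1n.
have an : -1 < - a by lra.
have s0 : 0 < a + b by rewrite addr_gt0.
split; last first.
  move=> t t01; have it := integrable_euler (- b) s0 an t01.
  apply/andP; split.
    by apply: Rintegral_ge0 => u /=; rewrite in_itv/= => u01; have /andP[] := dom t u t01 u01.
  rewrite -Ig; apply: le_Rintegral => // u /=; rewrite in_itv/= => u01.
  by have /andP[] := dom t u t01 u01.
rewrite -Ig; apply: fine_cvg; rewrite fineK; last exact: integrable_fin_num.
pose f_ (n : nat) (u : R) := (beta_integrand (a + b) (- a) u *
  (n.+3%:R^-1 + (1 - n.+3%:R^-1) * u) `^ (- b))%:E.
have mf_ n : measurable_fun (`]0, 1[%classic : set (measurableTypeR R)) (f_ n).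
  by have /integrableP[] := integrable_euler (- b) s0 an (tn n).
have mgE : measurable_fun (`]0, 1[%classic : set (measurableTypeR R)) (EFin \o g).
  by have /integrableP[] := ig.
have f_f (u : R) : `]0, 1[%classic u -> f_ ^~ u @ \oo --> (EFin \o g) u.
  rewrite /= in_itv/= => /andP[u0 u1]; apply: cvg_EFin; first exact: nearW.
  rewrite /= gE//; apply: cvgM; first exact: cvg_cst.
  have H : (n.+3%:R^-1 + (1 - n.+3%:R^-1) * u) @[n --> \oo] --> u.
    have -> : nbhs u = nbhs (0 + (1 - 0) * u) by rewrite subr0 mul1r add0r.
    apply: cvgD; first exact: cvg_inv3.
    apply: cvgM; last exact: cvg_cst.
    by apply: cvgB; [exact: cvg_cst|exact: cvg_inv3].
  by have := cvg_comp _ _ H (@continuous_powR R u (- b) u0).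
have f_g (u : R) (n : nat) : `]0, 1[%classic u -> (`|f_ n u| <= (EFin \o g) u)%E.
  rewrite /= in_itv/= => u01; have /andP[h1 h2] := dom _ _ (tn n) u01.
  by rewrite lee_fin ger0_norm.
have [_ _ +] := @dominated_convergence _ _ _ (@lebesgue_measure R) _ m01 f_ _
  (EFin \o g) mf_ mgE (aeW (@lebesgue_measure R) f_f) ig (aeW (@lebesgue_measure R) f_g).
by [].
Qed.

(** * The moment of order 0 is constant *)

Lemma derive0_const (R : realType) (f : R -> R) (x y : R) :
  {in `]0, 1[, forall z : R, is_derive z 1 f 0} -> 0 < x < 1 -> 0 < y < 1 -> f x = f y.
Proof.
move=> df x01 y01; apply/eqP; rewrite -subr_eq0 -normr_le0 -(mul0r `|x - y|).
apply: (@derive_bounded_lipschitz _ f (fun=> 0) 0 0 1); rewrite ?in_itv//=.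
by move=> z _; rewrite normr0.
Qed.

(** The constant value of t^(1-a) times the Euler integral, read off at the arbitrary point 1/2. No
    closed form enters: only the combination [moment0_slope] matters, and it is shown to vanish. *)
Definition euler_const (R : realType) (a b : R) : R :=
  2^-1 `^ (1 - a) * euler_int (a + b) (- a) (- b - 1) 2^-1.

(** At c = - b - 1 the coefficient c + 1 + s + r of [euler_contiguous] is 0. The two-term relation
    that is left, together with [is_derive_euler], says that t^(1-a) times the integral has
    derivative 0. *)
Lemma euler_constE (R : realType) (a b t : R) : 0 < a -> 0 < b -> a + b < 1 ->
  0 < t < 1 -> euler_int (a + b) (- a) (- b - 1) t = euler_const a b * t `^ (a - 1).
Proof.
move=> a0 b0 ab1 t01.
have an : -1 < - a by lra.
have s0 : 0 < a + b by rewrite addr_gt0.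
have h01 : 0 < (2^-1 : R) < 1 by apply/andP; split; lra.
have E : t `^ (1 - a) * euler_int (a + b) (- a) (- b - 1) t = euler_const a b.
  apply: (@derive0_const _ (fun t => t `^ (1 - a) * euler_int (a + b) (- a) (- b - 1) t)) => //.
  move=> z; rewrite in_itv/= => z01; have /andP[z0 z1] := z01.
  have d1 := is_derive1_powR (1 - a) z0.
  have d2 := is_derive_euler (- b - 1) s0 an z01.
  have H0 := euler_contiguous (- b - 1) s0 an z01.
  apply: is_derive_eq; rewrite /GRing.scale/=.
  have -> : 1 - a - 1 = - a by ring.
  have -> : z `^ (1 - a) = z `^ (- a) * z.
    by rewrite -{3}(powRr1 (ltW z0)) -powRDpos//; congr (_ `^ _); ring.
  have z1' : 1 - z != 0 by rewrite gt_eqF// subr_gt0.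
  have z0' : z != 0 by rewrite gt_eqF.
  move: H0; move: (euler_int _ _ _ _) (euler_int _ _ _ _) (euler_int _ _ _ _) (z `^ _) => C B A D H.
  have HC : (b + 1) * z * C = ((1 - a) + (a + b) * z) * B.
    have c0 : - b - 1 + 1 + (a + b) - a = 0 by ring.
    by move: H; rewrite c0 mul0r => H; apply: subr0_eq; rewrite [RHS]H; ring.
  transitivity (D / (1 - z) * (- ((b + 1) * z * C) + (b + 1) * z * B + (1 - a) * (1 - z) * B)).
    by field.
  by rewrite HC; ring.
have /andP[t0 t1] := t01.
move: E; move: (euler_int _ _ _ t) => I <-; rewrite mulrAC.
have -> : a - 1 = - (1 - a) by ring.
by rewrite powRN mulfV ?mul1r// gt_eqF// powR_gt0.
Qed.

Definition right_moment0 (R : realType) (a b t : R) : R :=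
  (1 - t) `^ b * euler_int (a + b) (- a) (- b) t.

(** In the product rule the integrals with exponent - b cancel, leaving the one with - b - 1, known
    from [euler_constE]. *)
Lemma is_derive_right_moment0 (R : realType) (a b t : R) : 0 < a -> 0 < b ->
  a + b < 1 -> 0 < t < 1 ->
  is_derive t 1 (right_moment0 a b)
    (- (b * euler_const a b * (t `^ (a - 1) * (1 - t) `^ (b - 1)))).
Proof.
move=> a0 b0 ab1 t01; have /andP[t0 t1] := t01.
have an : -1 < - a by lra.
have s0 : 0 < a + b by rewrite addr_gt0.
have t1' : 0 < 1 - t by rewrite subr_gt0.
have d2 := is_derive_euler (- b) s0 an t01.
have dn : is_derive t 1 (fun u : R => 1 - u) (-1).
  by apply: is_derive_eq; rewrite /GRing.scale/=; ring.
have d1 := is_derive_powR_comp b dn t1'.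
have := euler_constE a0 b0 ab1 t01 => EC.
rewrite /right_moment0; apply: is_derive_eq; rewrite /GRing.scale/= EC.
have -> : (1 - t) `^ b = (1 - t) `^ (b - 1) * (1 - t) by rewrite powRB1// divfK// gt_eqF.
by move: (euler_int _ _ _ _) => A; field; rewrite gt_eqF.
Qed.

(** The reflection y -> 1 - y makes the left integral a right one with a and b exchanged, so only
    right halves need to be studied. *)
Definition moment0 (R : realType) (a b t : R) : R :=
  sin (pi * a) * right_moment0 a b t + sin (pi * b) * right_moment0 b a (1 - t).

Lemma moment0_onem (R : realType) (a b t : R) : moment0 a b (1 - t) = moment0 b a t.
Proof. by rewrite /moment0 subKr; exact: addrC. Qed.

Definition moment0_slope (R : realType) (a b : R) : R :=
  sin (pi * b) * (a * euler_const b a) - sin (pi * a) * (b * euler_const a b).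

Lemma is_derive_moment0 (R : realType) (a b t : R) : 0 < a -> 0 < b ->
  a + b < 1 -> 0 < t < 1 ->
  is_derive t 1 (moment0 a b)
    (moment0_slope a b * (t `^ (a - 1) * (1 - t) `^ (b - 1))).
Proof.
move=> a0 b0 ab1 t01; have /andP[t0 t1] := t01.
have t01' : 0 < 1 - t < 1 by apply/andP; split; lra.
have ba1 : b + a < 1 by lra.
have d1 := is_derive_right_moment0 a0 b0 ab1 t01.
have d2 := is_derive_right_moment0 b0 a0 ba1 t01'.
have dn : is_derive t 1 (fun u : R => 1 - u) (-1).
  by apply: is_derive_eq; rewrite /GRing.scale/=; ring.
have d3 := @is_derive1_comp _ (right_moment0 b a) (fun u : R => 1 - u) t _ _ d2 dn.
have d4 : is_derive t 1 (fun u : R => right_moment0 b a (1 - u))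
    (- (a * euler_const b a * ((1 - t) `^ (b - 1) * (1 - (1 - t)) `^ (a - 1))) * -1).
  exact: d3.
rewrite /moment0 /moment0_slope; apply: is_derive_eq; rewrite /GRing.scale/=.
have -> : 1 - (1 - t) = t by ring.
by move: (sin _) (sin _) (euler_const _ _) (euler_const _ _) => A B C D; ring.
Qed.

(** The right half tends to pi / sin(pi a), while the left half is t^a times a bounded integral and
    disappears. *)
Lemma moment0_cvg (R : realType) (a b : R) : 0 < a -> 0 < b -> a + b < 1 ->
  moment0 a b n.+3%:R^-1 @[n --> \oo] --> (pi : R).
Proof.
move=> a0 b0 ab1; have ba1 : b + a < 1 by lra.
have a01 : 0 < a < 1 by rewrite a0; lra.
have sa := sin_pi_gt0 a01.
have [l1 _] := euler_lim0 a0 b0 ab1; have [_ bd] := euler_lim0 b0 a0 ba1.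
have tn (n : nat) : 0 < (n.+3%:R^-1 : R) < 1 by rewrite invr_gt0 ltr0n/= invf_lt1// ltr1n.
have -> : nbhs (pi : R) = nbhs (sin (pi * a) * ((1 - 0) `^ b * (pi / sin (pi * a))) +
   sin (pi * b) * 0).
  congr nbhs; rewrite subr0 powR1 mul1r mulr0 addr0; move: (pi) (sin _) sa => P S S0.
  by field; rewrite gt_eqF.
apply: cvgD; apply: cvgM; [exact: cvg_cst| |exact: cvg_cst|].
  apply: cvgM => //.
  have c1 : {for 0, continuous (fun x : R => (1 - x) `^ b)}.
    by apply: continuous_powR_comp; [rewrite subr0|exact: continuous_onem].
  by have := cvg_comp _ _ (@cvg_inv3 R) c1.
apply: (@squeeze_cvgr _ _ _ _ (cst 0)
  (fun n => n.+3%:R^-1 `^ a * (pi / sin (pi * b)))).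
- apply: nearW => n; rewrite /right_moment0.
  rewrite subKr.
  have /andP[h1 h2] : 0 < (1 - n.+3%:R^-1 : R) < 1.
    by have := tn n; move: (n.+3%:R^-1) => x; lra.
  have /andP[e0 e1] := bd (1 - n.+3%:R^-1) (introT andP (conj h1 h2)).
  by rewrite mulr_ge0 ?powR_ge0//= ler_wpM2l ?powR_ge0.
- exact: cvg_cst.
- have -> : nbhs (0 : R) = nbhs (0 * (pi / sin (pi * b)) : R) by rewrite mul0r.
  apply: cvgM; last exact: cvg_cst.
  move/cvg_at_rightP : (powR_cvg0 a0); apply; split => [n|]; last exact: cvg_inv3.
  by rewrite invr_gt0.
Qed.

(* [moment0] is monotone, because its derivative has the constant sign of
   [moment0_slope], and it has the same limit [pi] at both ends. *)
Lemma moment0_pi (R : realType) (a b t : R) : 0 < a -> 0 < b -> a + b < 1 ->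
  0 < t < 1 -> moment0 a b t = pi.
Proof.
move=> a0 b0 ab1 t01; have /andP[t0 t1] := t01; have ba1 : b + a < 1 by lra.
have l0 := moment0_cvg a0 b0 ab1; have l1 := moment0_cvg b0 a0 ba1.
have eventually (e : R) : 0 < e -> \forall n \near \oo, (n.+3%:R^-1 : R) < e.
  move=> e0; have /cvgrPdist_lt/(_ e e0) := @cvg_inv3 R.
  apply: filterS => n; rewrite sub0r normrN ger0_norm// invr_ge0.
have tn (n : nat) : 0 < (n.+3%:R^-1 : R) < 1 by rewrite invr_gt0 ltr0n/= invf_lt1// ltr1n.
have cm : {in `]0, 1[, continuous (moment0 a b)}.
  move=> x; rewrite in_itv/= => x01.
  exact: is_derive_continuous (is_derive_moment0 a0 b0 ab1 x01).
have dm x : x \in `]0, 1[ -> derivable (moment0 a b) x 1.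
  by rewrite in_itv/= => x01; have [] := is_derive_moment0 a0 b0 ab1 x01.
have dmE x : x \in `]0, 1[ -> derive1 (moment0 a b) x =
    moment0_slope a b * (x `^ (a - 1) * (1 - x) `^ (b - 1)).
  rewrite in_itv/= => x01; rewrite derive1E.
  by have [_] := is_derive_moment0 a0 b0 ab1 x01.
have pos (x : R) : 0 <= x `^ (a - 1) * (1 - x) `^ (b - 1) by rewrite mulr_ge0// powR_ge0.
have near_t : \forall n \near \oo, (n.+3%:R^-1 : R) < t by exact: eventually.
have near_1t : \forall n \near \oo, (n.+3%:R^-1 : R) < 1 - t.
  by apply: eventually; rewrite subr_gt0.
have tn1 (n : nat) : (1 - n.+3%:R^-1 : R) \in `]0, 1[.
  by have := tn n; rewrite in_itv/=; move: (n.+3%:R^-1) => x; lra.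
have tn0 (n : nat) : (n.+3%:R^-1 : R) \in `]0, 1[ by rewrite in_itv/= tn.
have tI : t \in `]0, 1[ by rewrite in_itv/=.
have [N0|N0] := leP 0 (moment0_slope a b).
- have mono := @ger0_derive1_le_oo _ (moment0 a b) 0 1 dm.
  have {}mono : {in `]0, 1[ &, {homo moment0 a b : x y / x <= y}}.
    by apply: mono => [x xI|x /set_mem xI]; [rewrite dmE// mulr_ge0|exact: cm].
  apply/eqP; rewrite eq_le; apply/andP; split.
  + apply: (cvgr_to_ge l1); apply: filterS near_1t => n nt.
    rewrite -(moment0_onem a b n.+3%:R^-1) mono//.
    by move: nt; move: (n.+3%:R^-1) => x; lra.
  + apply: (cvgr_to_le l0); apply: filterS near_t => n nt.
    by rewrite mono// ltW.
- have mono := @ler0_derive1_le_oo _ (moment0 a b) 0 1 dm.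
  have {}mono : {in `]0, 1[ &, {homo moment0 a b : x y /~ x <= y}}.
    apply: mono => [x xI|x /set_mem xI]; last exact: cm.
    by rewrite dmE// mulr_le0_ge0// ltW.
  apply/eqP; rewrite eq_le; apply/andP; split.
  + apply: (cvgr_to_ge l0); apply: filterS near_t => n nt.
    by rewrite mono// ltW.
  + apply: (cvgr_to_le l1); apply: filterS near_1t => n nt.
    rewrite -(moment0_onem a b n.+3%:R^-1) mono//.
    by move: nt; move: (n.+3%:R^-1) => x; lra.
Qed.

(** The mean value theorem on a constant function, whose derivative is the slope times a positive
    weight. [moment_1] needs the resulting relation between the two Euler constants. *)
Lemma moment0_slope0 (R : realType) (a b : R) : 0 < a -> 0 < b -> a + b < 1 ->
  moment0_slope a b = 0.
Proof.
move=> a0 b0 ab1.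
pose x : R := 3^-1; pose y : R := 2 / 3.
have xy : x < y by rewrite /x /y; lra.
have sub z : z \in `[x, y] -> 0 < z < 1.
  by rewrite in_itv/= /x /y => /andP[? ?]; apply/andP; split; lra.
have [z zxy E] : exists2 z, z \in `]x, y[%R & moment0 a b y - moment0 a b x =
    moment0_slope a b * (z `^ (a - 1) * (1 - z) `^ (b - 1)) * (y - x).
  apply: (@MVT _ (moment0 a b)
    (fun t => moment0_slope a b * (t `^ (a - 1) * (1 - t) `^ (b - 1))) _ _ xy).
    by move=> z zxy; apply: is_derive_moment0 => //; apply: sub; exact: subset_itv_oo_cc.
  apply: continuous_in_subspaceT => z /set_mem/= /sub z01.
  exact: is_derive_continuous (is_derive_moment0 a0 b0 ab1 z01).
have /andP[z0 z1] : 0 < z < 1 by apply: sub; exact: subset_itv_oo_cc.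
move: E; rewrite !moment0_pi//; [|by apply: sub; rewrite in_itv/= lexx ltW..].
rewrite subrr => /esym/eqP; rewrite mulf_eq0 (subr_eq0 y x) (gt_eqF xy) orbF !mulf_eq0.
have p1 := powR_gt0 (a - 1) z0.
have p2 : 0 < (1 - z) `^ (b - 1) by rewrite powR_gt0// subr_gt0.
by rewrite (gt_eqF p1) (gt_eqF p2) !orbF => /eqP.
Qed.

(** * Moments of all orders and their recursion *)

Definition right_moment (R : realType) (a b t : R) (m : nat) : R :=
  (1 - t) `^ b * euler_int (a + b) (- a) (m%:R - b) t.

(** Here y = t (1 - u), so y^m splits into t^m and (1 - u)^m; on the right half y = t + (1 - t) u is
    the base itself. *)
Definition left_moment (R : realType) (a b t : R) (m : nat) : R :=
  t `^ (a + m%:R) * euler_int (a + b) (m%:R - b) (- a) (1 - t).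

Definition moment (R : realType) (a b t : R) (m : nat) : R :=
  sin (pi * a) * right_moment a b t m + sin (pi * b) * left_moment a b t m.

Lemma moment_0 (R : realType) (a b t : R) : 0 < a -> 0 < b -> a + b < 1 ->
  0 < t < 1 -> moment a b t 0 = pi.
Proof.
move=> a0 b0 ab1 t01; rewrite -(moment0_pi a0 b0 ab1 t01).
rewrite /moment /moment0 /right_moment /left_moment /right_moment0 !add0r addr0 subKr.
by rewrite (addrC b a).
Qed.

(** [euler_contiguous] at c = - b has leading coefficient 1, and its last integral is explicit by
    [euler_constE]; this is the source of the term t^a (1-t)^b. *)
Lemma right_moment1 (R : realType) (a b t : R) : 0 < a -> 0 < b -> a + b < 1 ->
  0 < t < 1 -> (1 - t) `^ b * euler_int (a + b) (- a) (1 - b) t =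
  (a + (1 - (a + b)) * t) * ((1 - t) `^ b * euler_int (a + b) (- a) (- b) t) +
  b * euler_const a b * (t `^ a * (1 - t) `^ b).
Proof.
move=> a0 b0 ab1 t01; have /andP[t0 t1] := t01.
have an : -1 < - a by lra.
have s0 : 0 < a + b by rewrite addr_gt0.
have := euler_contiguous (- b) s0 an t01.
rewrite (euler_constE a0 b0 ab1 t01) (addrC (- b) 1).
have -> : t `^ a = t `^ (a - 1) * t by rewrite powRB1// divfK// gt_eqF.
have -> : 1 - b + (a + b) - a = 1 by ring.
rewrite mul1r => ->.
by move: (euler_int _ _ _ _) (euler_const _ _) => A B; ring.
Qed.

Lemma moment_1 (R : realType) (a b t : R) : 0 < a -> 0 < b -> a + b < 1 ->
  0 < t < 1 -> moment a b t 1 = pi * (a + (1 - (a + b)) * t).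
Proof.
move=> a0 b0 ab1 t01; have /andP[t0 t1] := t01.
have ba1 : b + a < 1 by lra.
have t01' : 0 < 1 - t < 1 by apply/andP; split; lra.
have bn : -1 < - b by lra.
have bn1 : -1 < 1 - b by lra.
have s0 : 0 < a + b by rewrite addr_gt0.
(* On the left half y = 1 - (1 - y), so the first moment is the zeroth one minus an integral to
   which [right_moment1] applies after exchanging a and b. *)
have L1 : t `^ a * euler_int (a + b) (- b) (1 - a) (1 - t) =
    t `^ a * euler_int (a + b) (- b) (- a) (1 - t) - left_moment a b t 1.
  rewrite /left_moment powRDn// expr1 -mulrA -mulrBr; congr (_ * _).
  have i1 := integrable_euler (- a) s0 bn t01'.
  have i2 := integrable_euler (- a) s0 bn1 t01'.
  have m01 : measurable (`]0, 1[%classic : set R) by [].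
  have := Rintegral_ZDZ 1 (- t) m01 i1 i2.
  rewrite -/(euler_int (a + b) (- b) (- a) (1 - t)) -/(euler_int (a + b) (1 - b) (- a) (1 - t)).
  rewrite mul1r mulNr => <-; apply: eq_Rintegral => u /set_mem/=; rewrite in_itv/= => u01.
  have [_ _ _ q0] := segment_bounds t01' u01; have /andP[u0 u1] := u01.
  have u1' : 0 < 1 - u by rewrite subr_gt0.
  rewrite /beta_integrand (addrC 1 (- a)) (addrC 1 (- b)).
  rewrite !(powRDpos _ _ q0) !(powRDpos _ _ u1') !powRr1 ?(ltW q0) ?(ltW u1')//.
  by ring.
have R1 := right_moment1 a0 b0 ab1 t01.
have R1' := right_moment1 b0 a0 ba1 t01'.
rewrite subKr (addrC b a) in R1'.
have E0 := moment_0 a0 b0 ab1 t01.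
rewrite /moment /right_moment /left_moment !sub0r addr0 in E0.
have N := moment0_slope0 a0 b0 ab1; rewrite /moment0_slope in N.
have E1 : left_moment a b t 1 = t `^ a * euler_int (a + b) (- b) (- a) (1 - t) -
   t `^ a * euler_int (a + b) (- b) (1 - a) (1 - t) by rewrite L1; ring.
rewrite /moment E1 R1' /right_moment R1 -[X in _ = X * _]E0.
move: (euler_int (a + b) (- b) (- a) (1 - t)) (euler_int (a + b) (- a) (- b) t) => A B.
move: (euler_const a b) (euler_const b a) N => C D.
move: (sin _) (sin _) => S1 S2 N.
(* The two nonpolynomial terms add up to a multiple of [moment0_slope a b], which is 0. *)
apply: subr0_eq; rewrite -[RHS](mul0r (- (t `^ a * (1 - t) `^ b))) -N; ring.
Qed.

(** Both halves satisfy this recursion separately, the right one by contiguity in c and the left one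
    by contiguity in r; hence so does their combination. *)
Lemma moment_rec (R : realType) (a b t : R) (m : nat) : 0 < a -> 0 < b -> a + b < 1 ->
  0 < t < 1 -> m.+2%:R * moment a b t m.+2 =
  (m.+1%:R + a + (m.+2%:R - (a + b)) * t) * moment a b t m.+1 -
  (m.+1%:R - b) * t * moment a b t m.
Proof.
move=> a0 b0 ab1 t01; have /andP[t0 t1] := t01.
have t01' : 0 < 1 - t < 1 by apply/andP; split; lra.
have an : -1 < - a by lra.
have s0 : 0 < a + b by rewrite addr_gt0.
have bn : -1 < m%:R - b by have : 0 <= m%:R :> R by []; lra.
have Hr : m.+2%:R * right_moment a b t m.+2 =
  (m.+1%:R + a + (m.+2%:R - (a + b)) * t) * right_moment a b t m.+1 -
  (m.+1%:R - b) * t * right_moment a b t m.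
  have := euler_contiguous (m%:R + 1 - b) s0 an t01.
  have -> : m%:R + 1 - b - 1 = m%:R - b by ring.
  have -> : m%:R + 1 - b + 1 = m.+2%:R - b by rewrite -!natr1; ring.
  rewrite /right_moment !natr1.
  have -> : m.+2%:R - b + (a + b) - a = m.+2%:R by ring.
  move=> E; rewrite mulrCA E.
  move: (euler_int _ _ _ _) (euler_int _ _ _ _) => A B; rewrite -!natr1; ring.
have Hl : m.+2%:R * left_moment a b t m.+2 =
  (m.+1%:R + a + (m.+2%:R - (a + b)) * t) * left_moment a b t m.+1 -
  (m.+1%:R - b) * t * left_moment a b t m.
  have := euler_contiguous_onem (- a) s0 bn t01.
  have -> : m%:R - b + 1 = m.+1%:R - b by rewrite -natr1; ring.
  have -> : m.+1%:R - b + 1 = m.+2%:R - b by rewrite -!natr1; ring.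
  have -> : m%:R - b + (a + b) - a + 2 = m.+2%:R by rewrite -!natr1; ring.
  rewrite /left_moment !(powRDn _ _ t0) !exprS => E.
  transitivity (t `^ a * t ^+ m * t *
    (m.+2%:R * t * euler_int (a + b) (m.+2%:R - b) (- a) (1 - t))); first by ring.
  rewrite E.
  move: (euler_int _ _ _ _) (euler_int _ _ _ _) => A B; rewrite -!natr1; ring.
move: Hr Hl; rewrite /moment; move: (left_moment a b t m.+2) (right_moment a b t m.+2).
move: (left_moment a b t m.+1) (right_moment a b t m.+1).
move: (left_moment a b t m) (right_moment a b t m) (sin _) (sin _).
move=> l0 r0 S1 S2 l1 r1 l2 r2 Hr Hl.
transitivity (S2 * (m.+2%:R * r2) + S1 * (m.+2%:R * l2)); first by ring.
by rewrite Hr Hl; ring.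
Qed.

(** * The Jacobi operator on moment polynomials *)

(** The coefficient of z^k in (1 - z)^(-x). *)
Definition rising_ratio (R : realType) (x : R) (k : nat) : R :=
  (\prod_(i < k) (x + i%:R)) / k`!%:R.

Lemma rising_ratio0 (R : realType) (x : R) : rising_ratio x 0 = 1.
Proof. by rewrite /rising_ratio big_ord0 fact0 divr1. Qed.

Lemma rising_ratioS (R : realType) (x : R) k :
  rising_ratio x k.+1 = (x + k%:R) / k.+1%:R * rising_ratio x k.
Proof.
rewrite /rising_ratio big_ord_recr/= factS natrM.
have h1 : k`!%:R != 0 :> R by rewrite pnatr_eq0 -lt0n fact_gt0.
by rewrite -natr1; field; rewrite h1 natr1 pnatr_eq0.
Qed.

(** The test guards against truncated subtraction: for k > m the difference m - k would be 0 and the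
    product need not vanish. *)
Definition moment_coef (R : realType) (a s : R) (m k : nat) : R :=
  if (k <= m)%N then rising_ratio (1 - s) k * rising_ratio a (m - k) else 0.

(* The coefficient of [z^m] in [(1 - 'X z)^(s-1) (1 - z)^(-a)]. *)
Definition moment_poly (R : realType) (a s : R) (m : nat) : {poly R} :=
  \poly_(k < m.+1) moment_coef a s m k.

Lemma coef_moment_poly (R : realType) (a s : R) (m k : nat) :
  (moment_poly a s m)`_k = moment_coef a s m k.
Proof. by rewrite coef_poly /moment_coef ltnS; case: leqP. Qed.

(** The coefficient form of the first-order equation in z satisfied by the generating function. At s
    = a + b it is the recursion of [moment_rec]. *)
Lemma moment_poly_rec (R : realType) (a s : R) (m : nat) : s < 1 ->
  m.+2%:R *: moment_poly a s m.+2 =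
  ((m.+1%:R + a)%:P + (m.+2%:R - s) *: 'X) * moment_poly a s m.+1 -
  (m.+1%:R - (s - a)) *: ('X * moment_poly a s m).
Proof.
move=> s1; apply/polyP => k.
have -> : ((m.+1%:R + a)%:P + (m.+2%:R - s) *: 'X) * moment_poly a s m.+1 =
  (m.+1%:R + a)%:P * moment_poly a s m.+1 + (m.+2%:R - s) *: ('X * moment_poly a s m.+1).
  by rewrite mulrDl -scalerAl.
rewrite coefZ coefB coefD coefCM !coefZ !coefXM !coef_moment_poly.
have nz (i : nat) : i.+1%:R != 0 :> R by rewrite pnatr_eq0.
have ds (i : nat) : 1 - s + i%:R != 0 by rewrite gt_eqF// ltr_wpDr// subr_gt0.
case: k => [|k] /=.
  rewrite /moment_coef/= !subn0 rising_ratio0 rising_ratioS -!natr1.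
  have h2 := nz m.+1; rewrite -!natr1 in h2.
  by field; rewrite ?h2.
rewrite /moment_coef; have [km|mk|<-] := ltngtP k m; last first.
- have -> : (k < k.+2)%N by lia.
  rewrite ltnSn leqnSn !subSnn !subnn.
  rewrite !rising_ratioS !rising_ratio0 -!natr1 /=.
  by have h2 := nz k; rewrite -!natr1 in h2; field; rewrite ?h2.
- have [->|k1] := eqVneq k m.+1.
    rewrite !ltnS leqnn ltnn !subnn !rising_ratioS !rising_ratio0.
    have h2 := nz m.+1; have h3 := nz m; rewrite -!natr1 in h2 h3 *.
    by field; rewrite ?h2 ?h3.
  have mk1 : (m.+1 < k)%N by rewrite ltn_neqAle eq_sym k1.
  have -> : (k.+1 <= m.+2)%N = false by rewrite ltnS leqNgt mk1.
  have -> : (k.+1 <= m.+1)%N = false by rewrite ltnS leqNgt mk.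
  have -> : (k <= m.+1)%N = false by rewrite leqNgt mk1.
  by rewrite !mulr0 !add0r oppr0.
- have -> : (k.+1 <= m.+2)%N by rewrite ltnS (leq_trans (ltnW km)).
  have -> : (k.+1 <= m.+1)%N by rewrite ltnS ltnW.
  have -> : (k <= m.+1)%N by rewrite (leq_trans (ltnW km)).
  have [j mE] : exists j, m = (j + k.+1)%N by exists (m - k.+1)%N; rewrite subnK.
  have -> : (m.+2 - k.+1 = j.+2)%N by rewrite mE; lia.
  have -> : (m.+1 - k.+1 = j.+1)%N by rewrite mE; lia.
  have -> : (m.+1 - k = j.+2)%N by rewrite mE; lia.
  have -> : (m - k = j.+1)%N by rewrite mE; lia.
  rewrite (rising_ratioS (1 - s) k) (rising_ratioS a j.+1) mE.
  have h1 := ds k; have h2 := nz k; have h3 := nz j.+1.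
  rewrite -!natr1 natrD -!natr1 in h1 h2 h3 *.
  by field; rewrite ?h1 ?h2 ?h3.
Qed.

(** The Sturm-Liouville operator of the weight x^(-b) (1-x)^(b-s) on ]0, 1[. *)
Definition jacobi_op (R : realType) (b s : R) (p : {poly R}) : {poly R} :=
  'X * (1 - 'X) * p^`()^`() + ((1 - b)%:P - (2 - s) *: 'X) * p^`().

Lemma coef_jacobi_op (R : realType) (b s : R) (p : {poly R}) k :
  (jacobi_op b s p)`_k =
  k.+1%:R * (k.+1%:R - b) * p`_k.+1 - k%:R * (k.+1%:R - s) * p`_k.
Proof.
rewrite /jacobi_op.
have -> : 'X * (1 - 'X) * p^`()^`() + ((1 - b)%:P - (2 - s) *: 'X) * p^`() =
  'X * p^`()^`() - 'X * ('X * p^`()^`()) + (1 - b)%:P * p^`() - (2 - s) *: ('X * p^`()).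
  by rewrite -!mul_polyC; ring.
rewrite !coefD !coefN coefCM coefZ !coefXM !coef_deriv.
by case: k => [|[|k]] /=; ring.
Qed.

Lemma jacobi_opD (R : realType) (b s : R) (p q : {poly R}) :
  jacobi_op b s (p + q) = jacobi_op b s p + jacobi_op b s q.
Proof. by rewrite /jacobi_op !derivD; ring. Qed.

Lemma jacobi_opZ (R : realType) (b s k : R) (p : {poly R}) :
  jacobi_op b s (k *: p) = k *: jacobi_op b s p.
Proof. by rewrite /jacobi_op !derivZ -!mul_polyC; ring. Qed.

Lemma jacobi_op0 (R : realType) (b s : R) : jacobi_op b s 0 = 0.
Proof. by rewrite /jacobi_op !deriv0; ring. Qed.

(* The right-hand side is the image under [y^m |-> moment_poly a s m] of
   [jacobi_op (s - a) s 'X^m], which is the intertwining property. *)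
Lemma jacobi_op_moment (R : realType) (a s : R) (m : nat) : s < 1 ->
  jacobi_op a s (moment_poly a s m) =
  (m%:R * (m%:R - (s - a))) *: moment_poly a s m.-1 -
  (m%:R * (m.+1%:R - s)) *: moment_poly a s m.
Proof.
move=> s1; apply/polyP => k.
rewrite coef_jacobi_op coefB !coefZ !coef_moment_poly.
have nz (i : nat) : i.+1%:R != 0 :> R by rewrite pnatr_eq0.
have ds (i : nat) : 1 - s + i%:R != 0 by rewrite gt_eqF// ltr_wpDr// subr_gt0.
case: m => [|m] /=.
  rewrite /moment_coef; case: k => [|k] /=; rewrite ?rising_ratio0; ring.
rewrite /moment_coef; have [km|mk|->] := ltngtP k m; last first.
- rewrite leqnn leqnSn !subSnn !subnn !rising_ratioS !rising_ratio0.
  by have h2 := nz m; rewrite -!natr1 in h2 *; field; rewrite ?h2.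
- have [->|k1] := eqVneq k m.+1.
    by rewrite ltnn leqnn; ring.
  have mk1 : (m.+1 < k)%N by rewrite ltn_neqAle eq_sym k1.
  have -> : (k.+1 <= m.+1)%N = false by rewrite ltnS leqNgt mk.
  have -> : (k <= m.+1)%N = false by rewrite leqNgt mk1.
  by ring.
- have -> : (k.+1 <= m.+1)%N by rewrite ltnS ltnW.
  have -> : (k <= m.+1)%N by rewrite (leq_trans (ltnW km)).
  have [j mE] : exists j, m = (j + k.+1)%N by exists (m - k.+1)%N; rewrite subnK.
  have -> : (m.+1 - k.+1 = j.+1)%N by rewrite mE; lia.
  have -> : (m.+1 - k = j.+2)%N by rewrite mE; lia.
  have -> : (m - k = j.+1)%N by rewrite mE; lia.
  rewrite (rising_ratioS (1 - s) k) (rising_ratioS a j.+1) mE.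
  have h1 := ds k; have h2 := nz k; have h3 := nz j.+1.
  rewrite -!natr1 natrD -!natr1 in h1 h2 h3 *.
  by field; rewrite ?h1 ?h2 ?h3.
Qed.

(* The operator is triangular on monomials with distinct eigenvalues. *)
Lemma jacobi_op_eigen_eq0 (R : realType) (a s : R) (n : nat) (q : {poly R}) : s < 1 ->
  jacobi_op a s q = - (n%:R * (n.+1%:R - s)) *: q ->
  (size q <= n.+1)%N -> q`_n = 0 -> q = 0.
Proof.
move=> s1 Lq szq qn.
suff H i : q`_(n - i) = 0.
  apply/polyP => k; rewrite coef0; have [kn|nk] := leqP k n.
    by rewrite -(subKn kn).
  by rewrite nth_default// (leq_trans szq).
elim: i => [|i IHi]; first by rewrite subn0.
have [ni|ni] := leqP n i; first by move: IHi; have [-> ->] : (n - i = 0 /\ n - i.+1 = 0)%N by lia.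
have := congr1 (fun p : {poly R} => p`_(n - i.+1)) Lq.
rewrite coef_jacobi_op coefZ.
have -> : ((n - i.+1).+1 = n - i)%N by lia.
rewrite IHi mulr0 sub0r.
set k := (n - i.+1)%N; have nE : n = (k + i.+1)%N by rewrite /k; lia.
have -> : (n - i = k.+1)%N by lia.
move=> /eqP; rewrite mulNr eqr_opp -subr_eq0 -mulrBl mulf_eq0 => /orP[|/eqP//].
rewrite nE -!natr1 natrD -natr1.
(* The difference of the eigenvalues is - (n - k) (n + k + 1 - s), whose factors are positive
   because k < n and s < 1. *)
have -> : k%:R * (k%:R + 1 - s) - (k%:R + (i%:R + 1)) * (k%:R + (i%:R + 1) + 1 - s) =
  - ((i%:R + 1) * (2 * k%:R + i%:R + 1 + (1 - s))) :> R by ring.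
rewrite oppr_eq0 mulf_eq0 => /orP[|] /eqP h; exfalso; move: h; apply/eqP.
  by rewrite natr1 pnatr_eq0.
by rewrite gt_eqF// ltr_wpDl ?subr_gt0// addr_ge0// addr_ge0// mulr_ge0.
Qed.

(** * Jacobi polynomials as eigenvectors *)

Definition jacobi_coef (R : realType) (n : nat) (mu nu : R) (k : nat) : R :=
  genbinom (n%:R + mu) (n - k) * genbinom (n%:R + nu) k.

Definition jacobi_poly (R : realType) (n : nat) (mu nu : R) : {poly R} :=
  \sum_(k < n.+1) jacobi_coef n mu nu k *: (('X - 1) ^+ k * 'X ^+ (n - k)).

Lemma horner_jacobi_poly (R : realType) (n : nat) (mu nu t : R) :
  (jacobi_poly n mu nu).[t] = Gn n mu nu t.
Proof.
rewrite /jacobi_poly horner_sum /Gn /jacobiP; apply: eq_bigr => k _.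
rewrite !hornerE /jacobi_coef.
have -> : (2 * t - 1 - 1) / 2 = t - 1 by field.
have -> : (2 * t - 1 + 1) / 2 = t by field.
by rewrite mulrA.
Qed.

Lemma monic_jacobi_basis (R : realType) (n k : nat) : (k <= n)%N ->
  size (('X - 1) ^+ k * 'X ^+ (n - k) : {poly R}) = n.+1 /\
  (('X - 1) ^+ k * 'X ^+ (n - k) : {poly R})`_n = 1.
Proof.
move=> kn.
have m1 : ('X - 1) ^+ k \is @monic R by rewrite monic_exp// monicXsubC.
have sz : size (('X - 1) ^+ k * 'X ^+ (n - k) : {poly R}) = n.+1.
  rewrite size_monicM// ?size_polyXn ?monic_neq0 ?monicXn//.
  by rewrite -polyC1 size_exp_XsubC addnS/= addSn subnKC.
split => //; have : ('X - 1) ^+ k * 'X ^+ (n - k) \is @monic R.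
  by rewrite monicMr// monicXn.
by rewrite monicE lead_coefE sz => /eqP.
Qed.

Lemma size_jacobi_poly (R : realType) (n : nat) (mu nu : R) :
  (size (jacobi_poly n mu nu) <= n.+1)%N.
Proof.
apply: (leq_trans (size_sum _ _ _)); apply/bigmax_leqP => k _.
apply: (leq_trans (size_scale_leq _ _)).
by rewrite (monic_jacobi_basis R (leq_ord k)).1.
Qed.

(** The basis products are monic of degree n, so the top coefficient is the sum of the
    [jacobi_coef]; reversing the sum exchanges mu and nu. *)
Lemma coef_jacobi_poly_top (R : realType) (n : nat) (mu nu : R) :
  (jacobi_poly n mu nu)`_n = (jacobi_poly n nu mu)`_n.
Proof.
have E (x y : R) : (jacobi_poly n x y)`_n = \sum_(k < n.+1) jacobi_coef n x y k.
  rewrite /jacobi_poly coef_sum; apply: eq_bigr => k _.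
  by rewrite coefZ (monic_jacobi_basis R (leq_ord k)).2 mulr1.
rewrite !E (reindex_inj rev_ord_inj); apply: eq_bigr => k _ /=.
by rewrite /jacobi_coef subSS subKn ?leq_ord// mulrC.
Qed.

Lemma genbinomS (R : realType) (r : R) (m : nat) :
  genbinom r m.+1 * m.+1%:R = genbinom r m * (r - m%:R).
Proof.
rewrite /genbinom big_ord_recr/= factS natrM.
have h1 : m`!%:R != 0 :> R by rewrite pnatr_eq0 -lt0n fact_gt0.
by rewrite -natr1; field; rewrite h1 natr1 pnatr_eq0.
Qed.

Lemma jacobi_coefS (R : realType) (n : nat) (mu nu : R) (k : nat) : (k < n)%N ->
  jacobi_coef n mu nu k.+1 * k.+1%:R * (k.+1%:R + mu) =
  jacobi_coef n mu nu k * (n - k)%:R * ((n - k)%:R + nu).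
Proof.
move=> kn; have [j nE] : exists j, n = (j + k.+1)%N by exists (n - k.+1)%N; rewrite subnK.
rewrite /jacobi_coef.
have -> : (n - k = j.+1)%N by rewrite nE; lia.
have -> : (n - k.+1 = j)%N by rewrite nE; lia.
have E1 := genbinomS (n%:R + mu) j; have E2 := genbinomS (n%:R + nu) k.
have -> : k.+1%:R + mu = n%:R + mu - j%:R by rewrite nE natrD; ring.
have -> : j.+1%:R + nu = n%:R + nu - k%:R by rewrite nE natrD -!natr1; ring.
transitivity ((genbinom (n%:R + mu) j * (n%:R + mu - j%:R)) *
  (genbinom (n%:R + nu) k.+1 * k.+1%:R)); first by ring.
by rewrite -E1 E2; ring.
Qed.

(** The factor X (X - 1) keeps lowered powers out of the formula: X d/dX and (X - 1) d/dX act on the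
    powers of X and of X - 1 as scalars. *)
Lemma jacobi_op_basis (R : realType) (mu nu : R) (i j : nat) :
  'X * ('X - 1) * jacobi_op (- nu) (- (mu + nu)) (('X - 1) ^+ j * 'X ^+ i) =
  - ((i%:R * (i%:R + nu))%:P * ('X - 1) ^+ 2 +
     (2 * i%:R * j%:R + (1 + nu) * j%:R + (1 + mu) * i%:R)%:P * ('X * ('X - 1)) +
     (j%:R * (j%:R + mu))%:P * 'X ^+ 2) * (('X - 1) ^+ j * 'X ^+ i).
Proof.
have D1 : 'X * ('X^i)^`() = i%:R%:P * 'X^i :> {poly R}.
  case: i => [|i]; first by rewrite derivXn/= mulr0n mulr0 mul0r.
  by rewrite derivXn/= -mulr_natr mulrA -exprS mulrC polyC_natr.
have D2 : 'X * ('X^i)^`()^`() = (i%:R - 1)%:P * ('X^i)^`() :> {poly R}.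
  have := congr1 (@deriv R) D1; rewrite !derivM derivX derivC mul1r mul0r add0r => E.
  by apply: (addrI ('X^i)^`()); rewrite E polyCB; ring.
have d1 : ('X - 1)^`() = 1 :> {poly R} by rewrite derivB derivX derivC subr0.
have E1 : ('X - 1) * (('X - 1) ^+ j)^`() = j%:R%:P * ('X - 1) ^+ j :> {poly R}.
  case: j => [|j]; first by rewrite expr0 derivC mulr0 mul0r.
  by rewrite deriv_exp d1 mul1r/= -mulr_natr mulrA -exprS mulrC polyC_natr.
have E2 : ('X - 1) * (('X - 1) ^+ j)^`()^`() =
    (j%:R - 1)%:P * (('X - 1) ^+ j)^`() :> {poly R}.
  have := congr1 (@deriv R) E1; rewrite !derivM d1 derivC mul1r mul0r add0r => E.
  by apply: (addrI (('X - 1) ^+ j)^`()); rewrite E polyCB; ring.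
rewrite /jacobi_op !(derivM, derivD) -mul_polyC.
move: ('X^i) ('X^i)^`() ('X^i)^`()^`() D1 D2 => u u1 u2 D1 D2.
move: (('X - 1) ^+ j) (('X - 1) ^+ j)^`() (('X - 1) ^+ j)^`()^`() E1 E2 => v v1 v2 E1 E2.
have F2 : ('X - 1) * (('X - 1) * v2) = (j%:R - 1)%:P * (j%:R%:P * v).
  by rewrite E2 mulrCA E1.
have G2 : 'X * ('X * u2) = (i%:R - 1)%:P * (i%:R%:P * u) by rewrite D2 mulrCA D1.
transitivity (- 'X ^+ 2 * u * (('X - 1) * (('X - 1) * v2))
  - 2 * ('X * ('X - 1)) * ('X * u1) * (('X - 1) * v1)
  - ('X - 1) ^+ 2 * v * ('X * ('X * u2))
  + ((1 - - nu)%:P - (2 - - (mu + nu))%:P * 'X) *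
    ('X * u * (('X - 1) * v1) + ('X - 1) * v * ('X * u1))); first by ring.
rewrite F2 G2 E1 D1 !(polyCD, polyCM, polyCN, polyCB).
by rewrite polyC1; ring.
Qed.

Lemma jacobi_op_sum (R : realType) (b s : R) (n : nat) (c : nat -> R) (e : nat -> {poly R}) :
  jacobi_op b s (\sum_(k < n) c k *: e k) = \sum_(k < n) c k *: jacobi_op b s (e k).
Proof.
elim: n => [|n IHn]; first by rewrite !big_ord0 jacobi_op0.
by rewrite !big_ord_recr/= jacobi_opD jacobi_opZ IHn.
Qed.

(** With e_k = (X-1)^k X^(n-k), one has (X-1)^2 e_k = X (X-1) e_(k+1) and X^2 e_(k+1) = X (X-1) e_k.
    By [jacobi_coefS] both outer families of [jacobi_op_basis] shift onto the middle one, and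
    scalars are compared. *)
Lemma jacobi_op_jacobi (R : realType) (n : nat) (mu nu : R) :
  jacobi_op (- nu) (- (mu + nu)) (jacobi_poly n mu nu) =
  - (n%:R * (n.+1%:R + (mu + nu))) *: jacobi_poly n mu nu.
Proof.
have X1 : 'X * ('X - 1) != 0 :> {poly R}.
  by rewrite mulf_neq0 ?polyX_eq0// -size_poly_eq0 size_XsubC.
apply: (mulfI X1).
pose A k := jacobi_coef n mu nu k.
pose e (k : nat) : {poly R} := ('X - 1) ^+ k * 'X ^+ (n - k).
pose B (k : nat) := A k * k%:R * (k%:R + mu).
pose B' (k : nat) := A k * (n - k)%:R * ((n - k)%:R + nu).
rewrite /jacobi_poly (jacobi_op_sum _ _ _ A e) -scalerAr !mulr_sumr.
have S1 : \sum_(k < n.+1) B' k *: (('X - 1) ^+ 2 * e k) =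
    \sum_(k < n.+1) B k *: ('X * ('X - 1) * e k).
  rewrite big_ord_recr/= [in RHS]big_ord_recl/=.
  rewrite /B' /B subnn !mulr0 !mul0r !scale0r addr0 add0r.
  apply: eq_bigr => k _; rewrite /bump/= add1n jacobi_coefS//; congr (_ *: _).
  rewrite /e; have -> : (n - k = (n - k.+1).+1)%N by rewrite subnSK.
  by rewrite !exprS; ring.
have S2 : \sum_(k < n.+1) B k *: ('X ^+ 2 * e k) =
    \sum_(k < n.+1) B' k *: ('X * ('X - 1) * e k).
  rewrite big_ord_recl/= [in RHS]big_ord_recr/=.
  rewrite /B' /B subnn !mulr0 !mul0r !scale0r addr0 add0r.
  apply: eq_bigr => k _; rewrite /bump/= add1n jacobi_coefS//; congr (_ *: _).
  rewrite /e; have -> : (n - k = (n - k.+1).+1)%N by rewrite subnSK.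
  by rewrite !exprS; ring.
pose M (k : nat) := 2 * (n - k)%:R * k%:R + (1 + nu) * k%:R + (1 + mu) * (n - k)%:R.
transitivity (- (\sum_(k < n.+1) B' k *: (('X - 1) ^+ 2 * e k) +
    \sum_(k < n.+1) (A k * M k) *: ('X * ('X - 1) * e k) +
    \sum_(k < n.+1) B k *: ('X ^+ 2 * e k))).
  rewrite -!big_split -sumrN; apply: eq_bigr => k _ /=.
  rewrite -scalerAr jacobi_op_basis -/(e k) /B' /B /M -!mul_polyC.
  by rewrite !(polyCD, polyCM, polyCN); ring.
rewrite S1 S2 -!big_split/= -sumrN scaler_sumr; apply: eq_bigr => k _.
rewrite -!scalerAr !scalerA -!scalerDl -scaleNr; congr (_ *: _).
rewrite /B /B' /M -/(A k) natrB ?leq_ord// -natr1; ring.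
Qed.

Lemma moment_jacobi (R : realType) (a b s : R) (n : nat) : s < 1 -> a + b = s ->
  \sum_(m < n.+1) (jacobi_poly n (- a) (- b))`_m *: moment_poly a s m =
  rising_ratio (1 - s) n *: jacobi_poly n (- b) (- a).
Proof.
move=> s1 abs; set g := jacobi_poly n (- a) (- b); set g' := jacobi_poly n (- b) (- a).
have bE : b = s - a by rewrite -abs; ring.
have Lg k : k.+1%:R * (k.+1%:R - b) * g`_k.+1 - k%:R * (k.+1%:R - s) * g`_k =
    - (n%:R * (n.+1%:R - s)) * g`_k.
  have := jacobi_op_jacobi n (- a) (- b); rewrite opprK -opprD opprK abs -/g => E.
  by rewrite -coef_jacobi_op E coefZ.
have Lg' : jacobi_op a s g' = - (n%:R * (n.+1%:R - s)) *: g'.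
  by have := jacobi_op_jacobi n (- b) (- a); rewrite opprK -opprD opprK addrC abs.
apply/eqP; rewrite -subr_eq0; apply/eqP.
apply: (@jacobi_op_eigen_eq0 _ a s n) => //.
- rewrite -scaleN1r scalerA jacobi_opD jacobi_opZ Lg' scalerDr !scalerA.
  congr (_ + _); last by congr (_ *: _); ring.
  rewrite (jacobi_op_sum _ _ _ (fun m => g`_m) (fun m => moment_poly a s m)).
  transitivity (\sum_(m < n.+1) (g`_m * (m%:R * (m%:R - (s - a)))) *: moment_poly a s m.-1 -
     \sum_(m < n.+1) (g`_m * (m%:R * (m.+1%:R - s))) *: moment_poly a s m).
    rewrite -sumrB; apply: eq_bigr => m _.
    by rewrite jacobi_op_moment// scalerBr !scalerA.
  (* After this index shift the coefficient of each [moment_poly] is the eigenvalue equation [Lg];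
     the extra top term vanishes by the size bound. *)
  have -> : \sum_(m < n.+1) (g`_m * (m%:R * (m%:R - (s - a)))) *: moment_poly a s m.-1 =
      \sum_(m < n.+1) (g`_m.+1 * (m.+1%:R * (m.+1%:R - b))) *: moment_poly a s m.
    rewrite big_ord_recl [in RHS]big_ord_recr/= mul0r mulr0 scale0r add0r.
    have -> : g`_n.+1 = 0 by rewrite nth_default// size_jacobi_poly.
    by rewrite mul0r scale0r addr0 -bE; apply: eq_bigr => m _.
  rewrite -sumrB scaler_sumr; apply: eq_bigr => m _.
  rewrite -scalerBl scalerA; congr (_ *: _).
  by rewrite -Lg; ring.
- apply: (leq_trans (size_polyD _ _)); rewrite geq_max size_polyN; apply/andP; split.
    apply: (leq_trans (size_sum _ _ _)); apply/bigmax_leqP => m _.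
    apply: (leq_trans (size_scale_leq _ _)).
    by apply: (leq_trans (size_poly _ _)).
  by apply: (leq_trans (size_scale_leq _ _)); exact: size_jacobi_poly.
- rewrite coefB coefZ coef_sum big_ord_recr/= big1 ?add0r => [|m _].
    rewrite coefZ coef_moment_poly /moment_coef leqnn subnn rising_ratio0 mulr1.
    by rewrite /g /g' coef_jacobi_poly_top mulrC subrr.
  by rewrite coefZ coef_moment_poly /moment_coef leqNgt ltn_ord mulr0.
Qed.

(** * The fractional integral *)

(** The map y = t + (1 - t) u collects 1 - t to the power (a + b - 1) - a + 1 = b. The value
    computed in the extended reals also gives integrability. *)
Lemma right_substitution (R : realType) (a b t : R) (m : nat) :
  0 < a -> 0 < b -> a + b < 1 -> 0 < t < 1 ->
  lebesgue_measure.-integrable `]t, 1[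
    (EFin \o (fun y : R => (y - t) `^ (a + b - 1) * (y `^ (- b) * (1 - y) `^ (- a)) * y ^+ m)) /\
  \int[lebesgue_measure]_(y in `]t, 1[)
    ((y - t) `^ (a + b - 1) * (y `^ (- b) * (1 - y) `^ (- a)) * y ^+ m) =
  right_moment a b t m.
Proof.
move=> a0 b0 ab1 t01; have /andP[t0 t1] := t01.
have t1' : 0 < 1 - t by rewrite subr_gt0.
have an : -1 < - a by lra.
have s0 : 0 < a + b by rewrite addr_gt0.
pose f (y : R) := (y - t) `^ (a + b - 1) * (y `^ (- b) * (1 - y) `^ (- a)) * y ^+ m.
have im : `]t, 1[%classic = (fun u : R => t + (1 - t) * u) @` `]0, 1[%classic.
  apply/seteqP; split => [y /=|_ [u /= + <-]]; rewrite !in_itv/= => /andP[y0 y1].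
    exists ((y - t) / (1 - t)).
      by rewrite /= in_itv/= divr_gt0 ?subr_gt0//= ltr_pdivrMr// mul1r ltrD2r.
    by rewrite mulrC divfK ?gt_eqF// addrC subrK.
  by apply/andP; split; nra.
have d (u : R) : `]0, 1[%classic u -> is_derive u 1 (fun u : R => t + (1 - t) * u) (1 - t).
  by move=> _; apply: is_derive_eq; rewrite /GRing.scale/=; ring.
have cd (u : R) : `]0, 1[%classic u -> {for u, continuous (fun _ : R => 1 - t)}.
  by move=> _; exact: cst_continuous.
have d0 (u : R) : `]0, 1[%classic u -> 0 < 1 - t by [].
have cf (y : R) : `]t, 1[%classic y -> {for y, continuous f}.
  rewrite /= in_itv/= => /andP[y0 y1]; have y0' : 0 < y by exact: lt_trans y0.
  apply: continuousM; last exact: exprn_continuous.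
  apply: continuousM.
    apply: continuous_powR_comp; first by rewrite subr_gt0.
    by apply: continuousB; [exact: cvg_id|exact: cst_continuous].
  apply: continuousM; first exact: continuous_powR.
  by apply: continuous_powR_comp; [rewrite subr_gt0|exact: continuous_onem].
have f0 (y : R) : `]t, 1[%classic y -> 0 <= f y.
  rewrite /= in_itv/= => /andP[y0 y1].
  by rewrite !mulr_ge0 ?powR_ge0// exprn_ge0// ltW// (lt_trans t0).
have E := ge0_substitution_incr (exhausts_oo ltr01) im d cd d0 cf f0.
have ie := integrable_Z ((1 - t) `^ b) (measurable_itv `]0, 1[)
  (integrable_euler (m%:R - b) s0 an t01).
have EE : (\int[lebesgue_measure]_(u in `]0%R, 1%R[) (f (t + (1 - t) * u) * (1 - t))%:E =
    \int[lebesgue_measure]_(u in `]0%R, 1%R[)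
      ((1 - t) `^ b * (beta_integrand (a + b) (- a) u * (t + (1 - t) * u) `^ (m%:R - b)))%:E)%E.
  apply: eq_integral => u /set_mem/=; rewrite in_itv/= => u01; congr EFin.
  have [_ _ _ q0] := segment_bounds t01 u01; have /andP[u0 u1] := u01.
  have u1' : 0 < 1 - u by rewrite subr_gt0.
  rewrite /f /beta_integrand.
  have -> : t + (1 - t) * u - t = (1 - t) * u by ring.
  have -> : 1 - (t + (1 - t) * u) = (1 - t) * (1 - u) by ring.
  rewrite !powRM ?(ltW t1') ?(ltW u0) ?(ltW u1')// (addrC m%:R) powRDn//.
  have -> : (1 - t) `^ b = (1 - t) `^ (a + b - 1) * (1 - t) `^ (- a) * (1 - t).
    rewrite -[X in _ = _ * _ * X](powRr1 (ltW t1')) -!powRDpos//.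
    by congr (_ `^ _); ring.
  by ring.
have El : (\int[lebesgue_measure]_(y in `]t, 1%R[) (f y)%:E = (right_moment a b t m)%:E)%E.
  rewrite E EE -[LHS]fineK; last exact: integrable_fin_num.
  congr EFin; rewrite /right_moment /euler_int -RintegralZl//.
  exact: integrable_euler.
split; last by rewrite /Rintegral El.
apply: ge0_integrable El => //; exact: (exhausts_measurable_fun (exhausts_oo t1) cf).
Qed.

(** The decreasing map y = t (1 - u) puts the kernel singularity y = t at u = 0, as on the right
    half, and collects t to the power (a + b - 1) - b + 1 + m = a + m. *)
Lemma left_substitution (R : realType) (a b t : R) (m : nat) :
  0 < a -> 0 < b -> a + b < 1 -> 0 < t < 1 ->
  lebesgue_measure.-integrable `]0, t[
    (EFin \o (fun y : R => (t - y) `^ (a + b - 1) * (y `^ (- b) * (1 - y) `^ (- a)) * y ^+ m)) /\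
  \int[lebesgue_measure]_(y in `]0, t[)
    ((t - y) `^ (a + b - 1) * (y `^ (- b) * (1 - y) `^ (- a)) * y ^+ m) =
  left_moment a b t m.
Proof.
move=> a0 b0 ab1 t01; have /andP[t0 t1] := t01.
have t01' : 0 < 1 - t < 1 by apply/andP; split; lra.
have bn : -1 < m%:R - b by have : 0 <= m%:R :> R by []; lra.
have s0 : 0 < a + b by rewrite addr_gt0.
pose f (y : R) := (t - y) `^ (a + b - 1) * (y `^ (- b) * (1 - y) `^ (- a)) * y ^+ m.
have im : `]0, t[%classic = (fun u : R => t * (1 - u)) @` `]0, 1[%classic.
  apply/seteqP; split => [y /=|_ [u /= + <-]]; rewrite !in_itv/= => /andP[y0 y1].
    exists (1 - y / t).
      by rewrite /= in_itv/= subr_gt0 ltr_pdivrMr// mul1r y1 gtrBl divr_gt0.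
    by rewrite subKr mulrC divfK// gt_eqF.
  by apply/andP; split; nra.
have d (u : R) : `]0, 1[%classic u -> is_derive u 1 (fun u : R => t * (1 - u)) (- t).
  by move=> _; apply: is_derive_eq; rewrite /GRing.scale/=; ring.
have cd (u : R) : `]0, 1[%classic u -> {for u, continuous (fun _ : R => - t)}.
  by move=> _; exact: cst_continuous.
have d0 (u : R) : `]0, 1[%classic u -> - t < 0 by rewrite oppr_lt0.
have cf (y : R) : `]0, t[%classic y -> {for y, continuous f}.
  rewrite /= in_itv/= => /andP[y0 y1]; have y1' : y < 1 by exact: lt_trans t1.
  apply: continuousM; last exact: exprn_continuous.
  apply: continuousM.
    apply: continuous_powR_comp; first by rewrite subr_gt0.
    by apply: continuousB; [exact: cst_continuous|exact: cvg_id].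
  apply: continuousM; first exact: continuous_powR.
  by apply: continuous_powR_comp; [rewrite subr_gt0|exact: continuous_onem].
have f0 (y : R) : `]0, t[%classic y -> 0 <= f y.
  rewrite /= in_itv/= => /andP[y0 y1].
  by rewrite !mulr_ge0 ?powR_ge0// exprn_ge0// ltW.
have E := ge0_substitution_decr (exhausts_oo ltr01) im d cd d0 cf f0.
have ie := integrable_Z (t `^ (a + m%:R)) (measurable_itv `]0, 1[)
  (integrable_euler (- a) s0 bn t01').
have EE : (\int[lebesgue_measure]_(u in `]0%R, 1%R[) (f (t * (1 - u)) * - - t)%:E =
    \int[lebesgue_measure]_(u in `]0%R, 1%R[)
      (t `^ (a + m%:R) * (beta_integrand (a + b) (m%:R - b) u *
        (1 - t + (1 - (1 - t)) * u) `^ (- a)))%:E)%E.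
  apply: eq_integral => u /set_mem/=; rewrite in_itv/= => u01; congr EFin.
  have [_ _ _ q0] := segment_bounds t01' u01; have /andP[u0 u1] := u01.
  have u1' : 0 < 1 - u by rewrite subr_gt0.
  rewrite /f /beta_integrand opprK.
  have -> : t - t * (1 - u) = t * u by ring.
  have -> : 1 - t * (1 - u) = 1 - t + (1 - (1 - t)) * u by ring.
  rewrite !powRM ?(ltW t0) ?(ltW u0) ?(ltW u1')// (addrC m%:R) !(powRDn _ _ u1') !(powRDn _ _ t0) exprMn.
  have -> : t `^ a = t `^ (a + b - 1) * t `^ (- b) * t.
    rewrite -[X in _ = _ * _ * X](powRr1 (ltW t0)) -!powRDpos//.
    by congr (_ `^ _); ring.
  by ring.
have El : (\int[lebesgue_measure]_(y in `]0%R, t[) (f y)%:E = (left_moment a b t m)%:E)%E.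
  rewrite E EE -[LHS]fineK; last exact: integrable_fin_num.
  congr EFin; rewrite /left_moment /euler_int -RintegralZl//.
  exact: integrable_euler.
split; last by rewrite /Rintegral El.
apply: ge0_integrable El => //; exact: (exhausts_measurable_fun (exhausts_oo t0) cf).
Qed.

Lemma Rintegral_sum (R : realType) (D : set R) (f : nat -> R -> R) (c : nat -> R) (n : nat) :
  measurable D ->
  (forall m, lebesgue_measure.-integrable D (EFin \o f m)) ->
  lebesgue_measure.-integrable D (EFin \o (fun x => \sum_(m < n) c m * f m x)) /\
  \int[lebesgue_measure]_(x in D) (\sum_(m < n) c m * f m x) =
  \sum_(m < n) c m * \int[lebesgue_measure]_(x in D) f m x.
Proof.
move=> mD fi; elim: n => [|n [IHi IHn]].
  split; last first.
    rewrite big_ord0 -[RHS](mul0r (\int[lebesgue_measure]_(x in D) f 0 x)) -RintegralZl//.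
    by apply: eq_Rintegral => x _; rewrite big_ord0 mul0r.
  have := integrable_Z 0 mD (fi 0); apply: eq_integrable => // x _.
  by rewrite /= big_ord0 mul0r.
have E x : \sum_(m < n.+1) c m * f m x = 1 * (\sum_(m < n) c m * f m x) + c n * f n x.
  by rewrite big_ord_recr/= mul1r.
split.
  have := integrable_ZDZ 1 (c n) mD IHi (fi n); apply: eq_integrable => // x _.
  by rewrite /= E.
under eq_Rintegral do rewrite E.
by rewrite Rintegral_ZDZ// IHn mul1r big_ord_recr.
Qed.

Lemma moment_horner (R : realType) (a b t : R) (m : nat) :
  0 < a -> 0 < b -> a + b < 1 -> 0 < t < 1 ->
  moment a b t m = pi * (moment_poly a (a + b) m).[t].
Proof.
move=> a0 b0 ab1 t01.
have [//] : moment a b t m = pi * (moment_poly a (a + b) m).[t] /\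
  moment a b t m.+1 = pi * (moment_poly a (a + b) m.+1).[t].
elim: m => [|m [IHm IHm1]]; split => //.
- rewrite moment_0// horner_poly big_ord1 /moment_coef/= !rising_ratio0; ring.
- rewrite moment_1// horner_poly big_ord_recr big_ord1/= /moment_coef/=.
  have r1 (x : R) : rising_ratio x 1 = x by rewrite /rising_ratio big_ord1 addr0 divr1.
  by rewrite subn0 subnn !r1 !rising_ratio0 expr0 expr1; ring.
- have nz : m.+2%:R != 0 :> R by rewrite pnatr_eq0.
  apply: (mulfI nz); rewrite moment_rec// IHm IHm1.
  have E : m.+2%:R * (moment_poly a (a + b) m.+2).[t] =
      (m.+1%:R + a + (m.+2%:R - (a + b)) * t) * (moment_poly a (a + b) m.+1).[t] -
      (m.+1%:R - (a + b - a)) * t * (moment_poly a (a + b) m).[t].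
    by have := congr1 (horner^~ t) (moment_poly_rec a m ab1); rewrite !hornerE.
  by rewrite [RHS](mulrCA _ pi) E; ring.
Qed.

(** The condition on p says p (Sa + Sb) = Sb and (1 - p) (Sa + Sb) = Sa, so the numerator of
    [C_const] absorbs both weights. *)
Lemma two_sided_weights (R : realType) (p Sa Sb Ss G A B : R) : Ss != 0 -> G != 0 ->
  p * - Sa = (1 - p) * - Sb ->
  (- Sa - Sb) / - Ss * (p * (G^-1 * A) + (1 - p) * (G^-1 * B)) =
  G^-1 / Ss * (Sb * A + Sa * B).
Proof.
move=> Ss0 G0 psin.
have h1 : p * (Sa + Sb) = Sb by lra.
have h2 : (1 - p) * (Sa + Sb) = Sa by lra.
transitivity (G^-1 / Ss * (p * (Sa + Sb) * A + (1 - p) * (Sa + Sb) * B)); last by rewrite h1 h2.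
by field; rewrite Ss0 G0.
Qed.

Theorem theorem2p1 (R : realType) (p alpha mu nu : R) :
  0 < p < 1 -> 1 < alpha < 2 ->
  alpha - 2 < mu < 0 -> alpha - 2 < nu < 0 ->
  mu + nu = alpha - 2 ->
  p * sin (pi * mu) = (1 - p) * sin (pi * nu) ->
  forall (n : nat) (t : R), 0 < t < 1 ->
    frac_int2 alpha p 0 1 mu nu (2 - alpha)
      (fun y => omega_star mu nu y * Gn n mu nu y) t
    = Gamma (n%:R + alpha - 1) / Gamma (n%:R + 1) * Gn n nu mu t.
Proof.
move=> p01 /andP[al1 al2] /andP[mu1 mu0] /andP[nu1 nu0] munu psin n t t01.
have [a muE] : exists a, mu = - a by exists (- mu); rewrite opprK.
have [b nuE] : exists b, nu = - b by exists (- nu); rewrite opprK.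
have alE : alpha = 2 - (a + b) by move: munu; rewrite muE nuE; lra.
subst mu nu alpha.
have a0 : 0 < a by lra.
have b0 : 0 < b by lra.
have ab1 : a + b < 1 by lra.
have s1' : 0 < 1 - (a + b) by rewrite subr_gt0.
have sE : 2 - (2 - (a + b)) = a + b by ring.
have s01 : 0 < a + b < 1 by rewrite addr_gt0.
have sinE (x : R) : sin (pi * - x) = - sin (pi * x) by rewrite mulrN sinN.
have sina := @sin_pi_gt0 R a; have sinb := @sin_pi_gt0 R b.
have {}sina : 0 < sin (pi * a) by apply: sina; rewrite a0; lra.
have {}sinb : 0 < sin (pi * b) by apply: sinb; rewrite b0; lra.
have sins := sin_pi_gt0 s01.
have sinal : sin (pi * (2 - (a + b))) = - sin (pi * (a + b)).
  have -> : pi * (2 - (a + b)) = - (pi * (a + b)) + pi *+ 2 by rewrite mulr2n; ring.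
  by rewrite sinD2pi sinN.
pose g := jacobi_poly n (- a) (- b).
have gE (y : R) : Gn n (- a) (- b) y = \sum_(m < n.+1) g`_m * y ^+ m.
  by rewrite -horner_jacobi_poly (horner_coef_wide _ (size_jacobi_poly n (- a) (- b))).
have IL : \int[lebesgue_measure]_(y in [set y : R | 0 < y < t])
    ((t - y) `^ (a + b - 1) * (omega_star (- a) (- b) y * Gn n (- a) (- b) y)) =
    \sum_(m < n.+1) g`_m * left_moment a b t m.
  rewrite -set_itvoo.
  have H m := left_substitution m a0 b0 ab1 t01.
  have := (Rintegral_sum (fun m => g`_m) n.+1 (measurable_itv `]0, t[) (fun m => (H m).1)).2.
  under [in X in _ = X -> _]eq_bigr do rewrite (H _).2.
  move=> <-; apply: eq_Rintegral => y _; rewrite gE mulrA mulr_sumr.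
  by apply: eq_bigr => m _; rewrite /omega_star; ring.
have IR : \int[lebesgue_measure]_(y in [set y : R | t < y < 1])
    ((y - t) `^ (a + b - 1) * (omega_star (- a) (- b) y * Gn n (- a) (- b) y)) =
    \sum_(m < n.+1) g`_m * right_moment a b t m.
  rewrite -set_itvoo.
  have H m := right_substitution m a0 b0 ab1 t01.
  have := (Rintegral_sum (fun m => g`_m) n.+1 (measurable_itv `]t, 1[) (fun m => (H m).1)).2.
  under [in X in _ = X -> _]eq_bigr do rewrite (H _).2.
  move=> <-; apply: eq_Rintegral => y _; rewrite gE mulrA mulr_sumr.
  by apply: eq_bigr => m _; rewrite /omega_star; ring.
rewrite /frac_int2 /RL_left /RL_right /C_const sE IL IR.
have [_ fin2 Gs0 _] := gamma_integral_fin s01.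
have -> : n%:R + (2 - (a + b)) - 1 = n%:R + (1 - (a + b)) by ring.
have -> := Gamma_rising n s1' fin2; rewrite Gamma_fact.
have S : sin (pi * b) * (\sum_(m < n.+1) g`_m * left_moment a b t m) +
    sin (pi * a) * (\sum_(m < n.+1) g`_m * right_moment a b t m) =
    pi * (rising_ratio (1 - (a + b)) n * Gn n (- b) (- a) t).
  have := congr1 (horner^~ t) (moment_jacobi n ab1 (erefl (a + b))).
  rewrite hornerZ horner_jacobi_poly => <-.
  rewrite horner_sum !mulr_sumr -big_split/=; apply: eq_bigr => m _.
  by rewrite hornerZ [RHS](mulrCA pi) -(moment_horner m a0 b0 ab1 t01) /moment; ring.
have refl := Gamma_reflection s01.
have -> : \prod_(i < n) (1 - (a + b) + i%:R) * Gamma (1 - (a + b)) / n`!%:R * Gn n (- b) (- a) t =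
    Gamma (1 - (a + b)) * (rising_ratio (1 - (a + b)) n * Gn n (- b) (- a) t).
  by rewrite /rising_ratio; ring.
(* The kernels contribute 1/Gamma(s), [C_const] contributes 1/sin(pi s) and the moments contribute
   pi; reflection merges them into Gamma(1 - s). *)
have -> : Gamma (1 - (a + b)) = (Gamma (a + b))^-1 * (pi / sin (pi * (a + b))).
  by rewrite -refl mulKf.
move: psin; rewrite !sinE sinal => psin.
transitivity ((Gamma (a + b))^-1 / sin (pi * (a + b)) *
   (sin (pi * b) * (\sum_(m < n.+1) g`_m * left_moment a b t m) +
    sin (pi * a) * (\sum_(m < n.+1) g`_m * right_moment a b t m))); last first.
  by rewrite S; ring.
exact: (two_sided_weights _ _ (lt0r_neq0 sins) Gs0 psin).
Qed.
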